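(* Fix a field $k$. For each integer $n\ge 0$ let $$A_n=k[x_1,\ldots,x_n]_{(x_1,\ldots,x_n)},\qquad R_n=\mathcal T(A_n),$$ where $A_0=k$. Then for every $n\geq 0$ $$Q(R_n)=R_n,\qquad \mathrm{w.gl.dim}\,R_n=\dim R_n=n.$$ Every $R_n$ is reduced and non-Noetherian. For $n\ge 1$, $R_n$ is non-coherent; $R_0$ is coherent and von Neumann regular.
   Context: All rings are commutative with identity. For a nonzero local ring $(A,\mathfrak m)$ (not necessarily Noetherian) with residue field $\kappa=A/\mathfrak m$ and residue map $a\mapsto\bar a$, define the ring, with coordinatewise operations, $$\mathcal T(A)=\{(a,(c_i)_{i\in\mathbb N})\in A\times\kappa^{\mathbb N}: c_i=\bar a\text{ for all but finitely many }i\},\quad \mathbb N=\{1,2,\ldots\}.$$ For a ring $B$, $Q(B)$ denotes the total ring of quotients (localization at the set of non-zero-divisors); $Q(B)=B$ means that every non-zero-divisor is a unit. The flat dimension $\mathrm{fd}_B M$ is the least length of a flat resolution of $M$ ($\infty$ if none), with $\mathrm{fd}_B0=0$; the weak global dimension is $\mathrm{w.gl.dim}\,B=\sup_M\mathrm{fd}_B M$ over all $B$-modules. $\dim$ is Krull dimension. A ring is coherent if every finitely generated ideal is finitely presented. *)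

(* Defs.v *)
From HB Require Import structures.
From mathcomp Require Import all_boot all_order all_algebra.
From mathcomp Require Import mpoly.
From mathcomp Require Import boolp classical_sets functions cardinality.
From mathcomp Require Import constructive_ereal.

Set Implicit Arguments.
Unset Strict Implicit.
Unset Printing Implicit Defensive.

Import GRing.Theory.
Local Open Scope classical_set_scope.
Local Open Scope quotient_scope.
Local Open Scope ring_scope.

(* ** Tensor products and flatness *)

Section Tensor.
Variables (R : comNzRingType) (M N : lmodType R).
Implicit Types (s t : seq (M * N)) (P : lmodType R).

(* A list [:: (m_1, n_1); ...; (m_r, n_r)] is the formal sum of the
   m_i (x) n_i; two formal sums are the same element of the tensor product
   when no bilinear map separates them. The lemmas below show that the quotient
   has the universal property of the tensor product. *)
Definition tens_eq s t : Prop :=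
  forall P (b : M -> N -> P), bilinear_for *:%R *:%R b ->
    \sum_(p <- s) b p.1 p.2 = \sum_(p <- t) b p.1 p.2.

Definition tens_rel : rel (seq (M * N)) := fun s t => `[< tens_eq s t >].

Lemma tens_rel_equiv : equiv_class_of tens_rel.
Proof.
split=> [s|s t|t s u].
- by apply/asboolP.
- by apply/asboolP/asboolP => st P b bb; rewrite (st P b bb).
- move=> /asboolP st /asboolP tu; apply/asboolP => P b bb.
  by rewrite (st P b bb) (tu P b bb).
Qed.

Canonical tens_equiv := EquivRelPack tens_rel_equiv.
Canonical tens_encModRel := defaultEncModRel tens_rel.

Definition tensor := {eq_quot tens_rel}.
HB.instance Definition _ : EqQuotient _ tens_rel tensor :=
  EqQuotient.on tensor.
HB.instance Definition _ := Choice.on tensor.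

Definition tens_sum s : tensor := \pi s.

Lemma tens_sumP s t : tens_eq s t <-> tens_sum s = tens_sum t.
Proof.
split=> [st|/eqmodP/asboolP//].
by apply/eqmodP/asboolP.
Qed.

Lemma repr_tens_sum s : tens_eq (repr (tens_sum s)) s.
Proof. by apply/tens_sumP; rewrite /tens_sum reprK. Qed.

Lemma tensW (Q : tensor -> Prop) : (forall s, Q (tens_sum s)) -> forall x, Q x.
Proof. by move=> Qs x; rewrite -[x]reprK; apply: Qs. Qed.

Definition tens_scale_seq (a : R) s := [seq (a *: p.1, p.2) | p <- s].

Lemma tens_eq_cat s s' t t' :
  tens_eq s s' -> tens_eq t t' -> tens_eq (s ++ t) (s' ++ t').
Proof.
by move=> ss tt P b bb; rewrite !big_cat /= (ss P b bb) (tt P b bb).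
Qed.

Lemma sum_tens_scale_seq P (b : M -> N -> P) a s :
  bilinear_for *:%R *:%R b ->
  \sum_(p <- tens_scale_seq a s) b p.1 p.2 = a *: \sum_(p <- s) b p.1 p.2.
Proof.
case=> bl _; rewrite big_map scaler_sumr; apply: eq_bigr => p _ /=.
by rewrite (scalable_linear (bl p.2)).
Qed.

Lemma tens_eq_scale a s s' :
  tens_eq s s' -> tens_eq (tens_scale_seq a s) (tens_scale_seq a s').
Proof. by move=> ss P b bb; rewrite !sum_tens_scale_seq// (ss P b bb). Qed.

Definition tens_add (x y : tensor) := tens_sum (repr x ++ repr y).
Definition tens_scale (a : R) (x : tensor) := tens_sum (tens_scale_seq a (repr x)).
Definition tens_opp (x : tensor) := tens_scale (-1) x.
Definition tens_zero := tens_sum [::].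

Lemma tens_addE s t : tens_add (tens_sum s) (tens_sum t) = tens_sum (s ++ t).
Proof. by apply/tens_sumP/tens_eq_cat; apply: repr_tens_sum. Qed.

Lemma tens_scaleE a s :
  tens_scale a (tens_sum s) = tens_sum (tens_scale_seq a s).
Proof. by apply/tens_sumP/tens_eq_scale/repr_tens_sum. Qed.

Fact tens_addA : associative tens_add.
Proof.
elim/tensW=> s; elim/tensW=> t; elim/tensW=> u.
by rewrite !tens_addE catA.
Qed.

Fact tens_addC : commutative tens_add.
Proof.
elim/tensW=> s; elim/tensW=> t; rewrite !tens_addE; apply/tens_sumP => P b bb.
by rewrite !big_cat /= addrC.
Qed.

Fact tens_add0 : left_id tens_zero tens_add.
Proof. by elim/tensW=> s; rewrite tens_addE. Qed.

Fact tens_addN : left_inverse tens_zero tens_opp tens_add.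
Proof.
elim/tensW=> s; rewrite /tens_opp tens_scaleE tens_addE.
apply/tens_sumP => P b bb.
by rewrite big_cat /= sum_tens_scale_seq // scaleN1r addNr big_nil.
Qed.

HB.instance Definition _ :=
  GRing.isZmodule.Build tensor tens_addA tens_addC tens_add0 tens_addN.

Fact tens_scaleA a b x : tens_scale a (tens_scale b x) = tens_scale (a * b) x.
Proof.
elim/tensW: x => s; rewrite !tens_scaleE; apply/tens_sumP => P f fb.
by rewrite !sum_tens_scale_seq// scalerA.
Qed.

Fact tens_scale1 : left_id 1 tens_scale.
Proof.
elim/tensW=> s; rewrite tens_scaleE; apply/tens_sumP => P f fb.
by rewrite sum_tens_scale_seq// scale1r.
Qed.

Fact tens_scaleDr : right_distributive tens_scale +%R.
Proof.
move=> a; elim/tensW=> s; elim/tensW=> t.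
rewrite [LHS](congr1 _ (tens_addE s t)) !tens_scaleE [RHS]tens_addE.
by rewrite /tens_scale_seq map_cat.
Qed.

Fact tens_scaleDl x : {morph tens_scale^~ x : a b / a + b}.
Proof.
elim/tensW: x => s a b; rewrite !tens_scaleE [RHS]tens_addE.
apply/tens_sumP => P f fb.
by rewrite big_cat /= !sum_tens_scale_seq// scalerDl.
Qed.

HB.instance Definition _ := GRing.Zmodule_isLmodule.Build R tensor
  tens_scaleA tens_scale1 tens_scaleDr tens_scaleDl.

Definition pure_tensor (m : M) (n : N) : tensor := tens_sum [:: (m, n)].

Lemma pure_tensor_bilinear : bilinear_for *:%R *:%R pure_tensor.
Proof.
split=> [n a m m'|m a n n'].
  rewrite -[RHS]/(tens_add (tens_scale a (tens_sum [:: (m, n)]))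
                           (tens_sum [:: (m', n)])) tens_scaleE tens_addE.
  apply/tens_sumP => P b [bl _].
  by rewrite !big_cons !big_nil /= !addr0 [LHS](bl n) (scalable_linear (bl n)).
rewrite -[RHS]/(tens_add (tens_scale a (tens_sum [:: (m, n)]))
                         (tens_sum [:: (m, n')])) tens_scaleE tens_addE.
apply/tens_sumP => P b [bl br].
rewrite !big_cons !big_nil /= !addr0 [LHS](br m).
by rewrite [X in _ = X + _](scalable_linear (bl n)).
Qed.

Lemma tens_sumE s : tens_sum s = \sum_(p <- s) pure_tensor p.1 p.2.
Proof.
elim: s => [|[m n] s IHs]; first by rewrite big_nil.
by rewrite big_cons -IHs [RHS]tens_addE.
Qed.

Definition tens_lift P (b : M -> N -> P) (x : tensor) : P :=
  \sum_(p <- repr x) b p.1 p.2.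

Lemma tens_lift_sum P (b : M -> N -> P) s : bilinear_for *:%R *:%R b ->
  tens_lift b (tens_sum s) = \sum_(p <- s) b p.1 p.2.
Proof. by move=> bb; apply: repr_tens_sum. Qed.

Lemma tens_lift_pure P (b : M -> N -> P) m n : bilinear_for *:%R *:%R b ->
  tens_lift b (pure_tensor m n) = b m n.
Proof. by move=> bb; rewrite tens_lift_sum// big_seq1. Qed.

Lemma tens_lift_linear P (b : M -> N -> P) : bilinear_for *:%R *:%R b ->
  linear (tens_lift b).
Proof.
move=> bb a; elim/tensW=> s; elim/tensW=> t.
have -> : a *: tens_sum s + tens_sum t = tens_sum (tens_scale_seq a s ++ t).
  by rewrite -tens_addE -tens_scaleE.
by rewrite !tens_lift_sum// big_cat /= sum_tens_scale_seq.
Qed.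

Lemma tens_lift_uniq P (b : M -> N -> P) (f : {linear tensor -> P}) :
  bilinear_for *:%R *:%R b -> (forall m n, f (pure_tensor m n) = b m n) ->
  f =1 tens_lift b.
Proof.
move=> bb fb; elim/tensW=> s; rewrite tens_lift_sum// tens_sumE raddf_sum.
by apply: eq_bigr => p _; apply: fb.
Qed.

End Tensor.

Definition tens_map (R : comNzRingType) (M N N' : lmodType R)
    (f : {linear N -> N'}) : tensor M N -> tensor M N' :=
  tens_lift (fun m n => pure_tensor m (f n)).

Lemma tens_map_bilinear (R : comNzRingType) (M N N' : lmodType R)
    (f : {linear N -> N'}) :
  bilinear_for *:%R *:%R (fun (m : M) n => pure_tensor m (f n)).
Proof.
split=> [n a m m'|m a n n'].
  exact: (pure_tensor_bilinear M N').1.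
by rewrite linearP; apply: (pure_tensor_bilinear M N').2.
Qed.

Definition flat (R : comNzRingType) (M : lmodType R) : Prop :=
  forall (N N' : lmodType R) (f : {linear N -> N'}),
    injective f -> injective (@tens_map R M N N' f).

(* ** Flat and weak global dimension *)

Definition exact_at (R : comNzRingType) (L M N : lmodType R)
    (f : L -> M) (g : M -> N) : Prop :=
  forall y, g y = 0 <-> exists x, f x = y.

(* F : 0 -> F_n -> ... -> F_1 -> F_0 -> M -> 0, padded by zero modules *)
Definition has_flat_resolution (R : comNzRingType) (M : lmodType R)
    (n : nat) : Prop :=
  exists (F : nat -> lmodType R) (d : forall i, {linear F i.+1 -> F i})
         (eps : {linear F 0%N -> M}),
    [/\ forall i, flat (F i),
        forall i, (n < i)%N -> forall x : F i, x = 0,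
        forall y, exists x, eps x = y,
        exact_at (d 0%N) eps
      & forall i, exact_at (d i.+1) (d i)].

(* Dimensions take values in \bar int. The operators [supremum] and [infimum]
   return a default value when the bound does not exist; the next two lemmas
   show that this never happens for the sets considered here. *)
Lemma supremums_bar_int (S : set (\bar int)) :
  S !=set0 -> (forall x, S x -> 0 <= x)%E -> supremums S !=set0.
Proof.
move=> [s Ss] S0.
have ub_nat u : ubound S u -> u = +oo%E \/ exists n : nat, u = n%:Z%:E.
  move=> /(_ s Ss); have := S0 s Ss; case: u => [[m|m]| |] s0 su.
  - by right; exists m.
  - by have := Order.POrderTheory.le_trans s0 su; rewrite lee_fin.
  - by left.
  - by have := Order.POrderTheory.le_trans s0 su.
have [bS|nbS] := pselect (exists n, `[< ubound S n%:Z%:E >]).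
  case: (ex_minnP bS) => n /asboolP bn nmin.
  exists n%:Z%:E; split=> // u uS.
  have [->|[m um]] := ub_nat u uS; first by rewrite leey.
  by rewrite um lee_fin lez_nat; apply/nmin/asboolP; rewrite -um.
exists +oo%E; split=> [x _|u uS]; first by rewrite leey.
have [->//|[m um]] := ub_nat u uS.
by case: nbS; exists m; apply/asboolP; rewrite -um.
Qed.

Lemma infimums_bar_int (S : set nat) :
  S !=set0 -> infimums [set n%:Z%:E | n in S] !=set0.
Proof.
move=> [s Ss]; have exS : exists n, `[< S n >] by exists s; apply/asboolP.
case: (ex_minnP exS) => n /asboolP Sn nmin; exists n%:Z%:E; split.
  by move=> _ [m Sm <-]; rewrite lee_fin lez_nat; apply/nmin/asboolP.
by move=> u; apply; exists n.
Qed.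

Definition flat_dim (R : comNzRingType) (M : lmodType R) : \bar int :=
  infimum +oo%E [set n%:Z%:E | n in [set n | has_flat_resolution M n]].

Definition weak_gl_dim (R : comNzRingType) : \bar int :=
  supremum -oo%E [set d | exists M : lmodType R, d = flat_dim M].

(* ** Ideals and Krull dimension *)

Definition prime_chain (R : comNzRingType) (n : nat)
    (P : nat -> prime_idealr R) : Prop :=
  forall i, (i < n)%N ->
    {subset P i <= P i.+1} /\ (exists2 x, x \in P i.+1 & x \notin P i).

Definition krull_dim (R : comNzRingType) : \bar int :=
  supremum -oo%E [set n%:Z%:E | n in [set n | exists P, @prime_chain R n P]].

(* Unlike [idealr_closed], this does not exclude the unit ideal. *)
Definition ideal (R : comNzRingType) (I : {pred R}) : Prop :=
  submod_closed (I : {pred R^o}).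

Definition fin_gen_ideal (R : comNzRingType) (I : {pred R}) : Prop :=
  exists n (g : {linear 'rV[R]_n -> R^o}), forall x, x \in I <-> exists u, g u = x.

(* an exact sequence R^m -> R^n -> I -> 0 *)
Definition fin_pres_ideal (R : comNzRingType) (I : {pred R}) : Prop :=
  exists m n (h : {linear 'rV[R]_m -> 'rV[R]_n}) (g : {linear 'rV[R]_n -> R^o}),
    (forall x, x \in I <-> exists u, g u = x) /\ exact_at h g.

Definition coherent (R : comNzRingType) : Prop :=
  forall I : {pred R}, ideal I -> fin_gen_ideal I -> fin_pres_ideal I.

Definition noetherian (R : comNzRingType) : Prop :=
  forall I : {pred R}, ideal I -> fin_gen_ideal I.

Definition reduced (R : comNzRingType) : Prop :=
  forall (x : R) n, x ^+ n = 0 -> x = 0.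

Definition von_neumann_regular (R : comNzRingType) : Prop :=
  forall a : R, exists x, a = a * x * a.

(* Q(R) = R: every non-zero-divisor is a unit *)
Definition total_quotient_ring_trivial (R : comNzRingType) : Prop :=
  forall x : R, GRing.lreg x -> exists y, x * y = 1.

(* ** Local rings *)

Definition maximal_ideal (R : comNzRingType) (I : {pred R}) : Prop :=
  idealr_closed I /\
  forall J : {pred R}, idealr_closed J -> {subset I <= J} -> J =i I.

HB.mixin Record isLocalRing A of GRing.ComNzRing A := {
  max_ideal : {pred A};
  max_ideal_maximal : maximal_ideal max_ideal;
  max_ideal_uniq : forall J : {pred A}, maximal_ideal J -> J =i max_ideal
}.

#[short(type="localRingType")]
HB.structure Definition LocalRing := {A of isLocalRing A & GRing.ComNzRing A}.

HB.instance Definition _ (A : localRingType) :=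
  isIdealr.Build A (@max_ideal A) (@max_ideal_maximal A).1.

Definition residue_field (A : localRingType) := {ideal_quot (@max_ideal A)}.
HB.instance Definition _ (A : localRingType) := GRing.ComNzRing.on (residue_field A).

Definition residue (A : localRingType) (a : A) : residue_field A :=
  \pi_{ideal_quot (@max_ideal A)} a.

(* ** The ring T(A) *)

Section TRing.
Variable A : localRingType.

Lemma residueB : {morph @residue A : a b / a - b}.
Proof. by move=> a b; rewrite /residue rmorphB. Qed.

Lemma residueM : {morph @residue A : a b / a * b}.
Proof. by move=> a b; rewrite /residue rmorphM. Qed.

Definition tring_ambient := (A * (nat -> residue_field A))%type.
HB.instance Definition _ := GRing.ComNzRing.on tring_ambient.

Definition tring_set : set tring_ambient :=
  [set x | finite_set [set i | x.2 i <> residue x.1]].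

Definition tring_pred : {pred tring_ambient} :=
  fun x => `[< tring_set x >].

Fact tring_subring_closed : subring_closed tring_pred.
Proof.
split=> [|x y|x y].
- apply/asboolP; rewrite /tring_set /=; set S := (X in finite_set X).
  have -> : S = set0; last exact: finite_set0.
  by apply/seteqP; split=> i //=; rewrite /S /= /residue rmorph1.
- move=> /asboolP fx /asboolP fy; apply/asboolP.
  apply: sub_finite_set (_ : finite_set ([set i | x.2 i <> residue x.1] `|`
                                         [set i | y.2 i <> residue y.1])).
    move=> i /= xyi; apply: contrapT => /not_orP[/contrapT xi /contrapT yi].
    by apply: xyi; rewrite [RHS]residueB -xi -yi.
  by rewrite finite_setU.
- move=> /asboolP fx /asboolP fy; apply/asboolP.
  apply: sub_finite_set (_ : finite_set ([set i | x.2 i <> residue x.1] `|`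
                                         [set i | y.2 i <> residue y.1])).
    move=> i /= xyi; apply: contrapT => /not_orP[/contrapT xi /contrapT yi].
    by apply: xyi; rewrite [RHS]residueM -xi -yi.
  by rewrite finite_setU.
Qed.

HB.instance Definition _ :=
  GRing.isSubringClosed.Build _ tring_pred tring_subring_closed.

Record tring := TRing {
  tring_val :> tring_ambient;
  tring_valP : tring_val \in tring_pred }.

HB.instance Definition _ := [isSub for tring_val].
HB.instance Definition _ := [Choice of tring by <:].
HB.instance Definition _ := [SubChoice_isSubComNzRing of tring by <:].

End TRing.

(* ** Localization of an integral domain at a prime ideal *)

Section Localization.
Variables (D : idomainType) (P : prime_idealr D).

Local Notation "x %:F" := (FracField.tofrac x).

(* D_P is realized as the subring of Frac(D) of all a / s with s not in P. *)
Definition loc_pred : {pred {fraction D}} :=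
  fun x => `[< exists a s, s \notin P /\ x = a%:F / s%:F >].

Lemma notin_prime_neq0 s : s \notin P -> s%:F != 0 :> {fraction D}.
Proof. by rewrite tofrac_eq0; apply: contraNneq => ->; apply: idealr0. Qed.

Lemma notin_primeM s t : s \notin P -> t \notin P -> s * t \notin P.
Proof. by move=> sP tP; rewrite prime_idealrM negb_or sP. Qed.

Fact loc_subring_closed : subring_closed loc_pred.
Proof.
split=> [|_ _ /asboolP[a [s [sP ->]]] /asboolP[b [t [tP ->]]]
         |_ _ /asboolP[a [s [sP ->]]] /asboolP[b [t [tP ->]]]]; apply/asboolP.
- by exists 1, 1; rewrite idealr1 rmorph1 divr1.
- exists (a * t - b * s), (s * t); split; first exact: notin_primeM.
  rewrite -mulNr addf_div ?notin_prime_neq0//.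
  by rewrite rmorphB !rmorphM /= mulNr.
- exists (a * b), (s * t); split; first exact: notin_primeM.
  by rewrite !rmorphM /= mulf_div.
Qed.

HB.instance Definition _ :=
  GRing.isSubringClosed.Build _ loc_pred loc_subring_closed.

Record localization := Localization {
  loc_val :> {fraction D};
  loc_valP : loc_val \in loc_pred }.

HB.instance Definition _ := [isSub for loc_val].
HB.instance Definition _ := [Choice of localization by <:].
HB.instance Definition _ := [SubChoice_isSubComNzRing of localization by <:].

Definition loc_max_ideal : {pred localization} := fun x =>
  `[< exists a s, [/\ a \in P, s \notin P & loc_val x = a%:F / s%:F] >].

Lemma loc_max_ideal_closed : idealr_closed loc_max_ideal.
Proof.
split.
- by apply/asboolP; exists 0, 1; rewrite idealr0 idealr1 rmorph0 mul0r.
- apply/asboolP => -[a [s [aP sP]]] /=.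
  move=> /esym /divr1_eq /eqP.
  by rewrite tofrac_eq => /eqP asE; rewrite -asE aP in sP.
- move=> x y z; have /asboolP[c [u [uP xE]]] := loc_valP x.
  move=> /asboolP[a [s [aP sP yE]]] /asboolP[b [t [bP tP zE]]].
  apply/asboolP; exists (c * a * t + b * (u * s)), (u * s * t); split.
  + by rewrite rpredD//; first (rewrite mulrC !idealMr//); rewrite mulrC idealMr.
  + by rewrite !notin_primeM.
  + rewrite -[LHS]/(_ * loc_val y + loc_val z) /= xE yE zE.
    rewrite mulf_div addf_div ?mulf_neq0 ?notin_prime_neq0//.
    by rewrite rmorphD !rmorphM.
Qed.

Lemma loc_max_ideal_sub (J : {pred localization}) :
  idealr_closed J -> {subset J <= loc_max_ideal}.
Proof.
move=> [J0 J1 JD] x xJ; have /asboolP[a [s [sP xE]]] := loc_valP x.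
apply/asboolP; exists a, s; split=> //; apply: contraNT J1 => aP.
have yP : s%:F / a%:F \in loc_pred by apply/asboolP; exists s, a.
suff -> : 1 = Localization yP * x + 0 by apply: JD.
rewrite addr0; apply: val_inj; rewrite /= xE mulf_div [_ * a%:F]mulrC divff//.
by rewrite mulf_neq0 ?notin_prime_neq0.
Qed.

Lemma loc_max_ideal_maximal : maximal_ideal loc_max_ideal.
Proof.
split=> [|J Jid sub x]; first exact: loc_max_ideal_closed.
by apply/idP/idP => [|/sub//]; apply: loc_max_ideal_sub.
Qed.

Lemma loc_max_ideal_uniq (J : {pred localization}) :
  maximal_ideal J -> J =i loc_max_ideal.
Proof.
move=> [Jid Jmax] x; apply/esym/Jmax; first exact: loc_max_ideal_closed.
exact: loc_max_ideal_sub.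
Qed.

HB.instance Definition _ := isLocalRing.Build localization
  loc_max_ideal_maximal loc_max_ideal_uniq.

End Localization.

(* ** The rings A_n (poly_local) and R_n (Rring) *)

Section PolyLocal.
Variables (k : fieldType) (n : nat).

(* The ideal (x_1, ..., x_n) *)
Definition vars_ideal : {pred {mpoly k[n]}} :=
  fun p => `[< exists c : 'I_n -> {mpoly k[n]}, p = \sum_(i < n) c i * 'X_i >].

Lemma vars_ideal_const p : exists c : 'I_n -> {mpoly k[n]},
  p = \sum_(i < n) c i * 'X_i + (p.@[fun=> 0])%:MP.
Proof.
elim/mpolyind: p => [|a m p _ _ [c pE]].
  by exists (fun=> 0); rewrite meval0 mpolyC0 addr0 big1// => i; rewrite mul0r.
have [->|/eqP m0] := eqVneq m 0%MM.
  exists c; rewrite mpolyX0 mevalD mevalZ meval1 mulr1 mpolyCD addrCA -pE.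
  by rewrite -alg_mpolyC.
have [i mi] : exists i, m i != 0%N.
  apply/existsP; apply: contra_notT m0; rewrite negb_exists => /forallP m0.
  by apply/mnmP => i; rewrite mnm0E; apply/eqP; rewrite -[_ == _]negbK.
exists (fun j => c j + if j == i then a *: 'X_[m - U_(i)] else 0).
have Xm : 'X_[m] = 'X_[m - U_(i)] * 'X_i :> {mpoly k[n]}.
  rewrite -mpolyXD submK//; apply/mnm_lepP => j; rewrite mnm1E.
  by case: eqP => // <-; rewrite lt0n.
have Xm0 : ('X_[m]).@[fun=> 0] = 0 :> k.
  by rewrite mevalX (bigD1 i)//= expr0n (negPf mi) mul0r.
rewrite mevalD mevalZ Xm0 mulr0 add0r.
under eq_bigr do rewrite mulrDl.
rewrite big_split /= [X in _ + X + _](bigD1 i)//= eqxx.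
rewrite [X in _ + (_ + X) + _]big1 => [|j /negPf ->]; last by rewrite mul0r.
by rewrite addr0 -scalerAl -Xm addrAC -pE addrC.
Qed.

Lemma vars_idealP p : (p \in vars_ideal) = (p.@[fun=> 0] == 0).
Proof.
apply/asboolP/eqP => [[c ->]|p0].
  by rewrite raddf_sum big1// => i _; rewrite /= mevalM mevalXU mulr0.
by have [c] := vars_ideal_const p; rewrite p0 mpolyC0 addr0; exists c.
Qed.

Lemma vars_ideal_closed : idealr_closed vars_ideal.
Proof.
split=> [||a p q].
- by rewrite vars_idealP meval0.
- by rewrite vars_idealP meval1 oner_eq0.
- rewrite !vars_idealP => /eqP p0 /eqP q0.
  by rewrite mevalD mevalM p0 q0 mulr0 addr0.
Qed.

Lemma vars_ideal_prime : prime_idealr_closed vars_ideal.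
Proof. by move=> p q; rewrite !vars_idealP mevalM mulf_eq0. Qed.

HB.instance Definition _ := isIdealr.Build _ vars_ideal vars_ideal_closed.
HB.instance Definition _ :=
  isPrimeIdealrClosed.Build _ vars_ideal vars_ideal_prime.

Definition poly_local : localRingType := localization vars_ideal.

Definition Rring : comNzRingType := tring poly_local.

End PolyLocal.

(* Main.v *)
Require Import Defs.
From HB Require Import structures.
From mathcomp Require Import all_boot all_order all_algebra.
From mathcomp Require Import mpoly.
From mathcomp Require Import boolp classical_sets functions cardinality.
From mathcomp Require Import constructive_ereal.
From mathcomp Require Import ring zify.
Import GRing.Theory.
Set Implicit Arguments.
Unset Strict Implicit.
Unset Printing Implicit Defensive.
Local Open Scope quotient_scope.
Local Open Scope ring_scope.

(* Write R = T(A), with A = A_n. The kernel I of R -> A is generated by the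
   increasing idempotents e_N = (0, (1, ..., 1, 0, 0, ...)), each e_N R is a
   finite product of fields, and A is also a subring of R (diagonally).

   Krull dimension: a prime of R not containing I is maximal, hence a chain of
   primes of R of positive length is a chain of primes of A. Given a chain of
   length n + 1, elements of the successive differences are represented by n + 1
   polynomials in n variables. These are algebraically dependent, and inspecting
   the lexicographically smallest monomial of a relation shows that some nonzero
   constant belongs to the top prime.

   Weak global dimension, upper bound: given an R-module M, the A-module M/IM
   has the Koszul resolution of length n by modules (M/IM)[t_1, ..., t_n] over
   k[t_1, ..., t_n], relative to the sequence t_i - x_i. These are flat, and
   localizing at the origin gives flat A-modules, which are flat over R. Pulling
   back the augmentation along M -> M/IM gives a flat resolution of M, as an
   extension of a flat module by a submodule fixed by the e_N is flat.

   Weak global dimension, lower bound: let F be a flat resolution of R/m, with m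
   the maximal ideal generated by I, x_1, ..., x_n. Since x_1, ..., x_n is a
   regular sequence modulo I on each F_j, dimension shifting along
   J_i = (I, x_1, ..., x_i) gives a nonzero class in H_i(F/J_i F),
   so F_n <> 0. *)

(** * Quotient modules and submodules *)

(** In the upper bound the obstacle is that M/IM is arbitrary, so (M/IM)[t_1, ..., t_n] is in
    general not flat over its ring of coefficients. It carries two actions: R acts on the
    coefficients, which serves to form the Koszul maps t_i - x_i, and k[t_1, ..., t_n] acts through
    the variables, for which the module is free because M/IM is a vector space over k. Only the
    second action is kept by the localization, where R acts by fractions in the t_i. The
    augmentation sends t_i to x_i and thereby reconciles the two actions on M/IM. This is why the
    flatness criterion [equational] is relative to a morphism B -> R: modules live over a large ring
    of polynomials while flatness is meant over a smaller one. Flatness in the sense of tensor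
    products is reached from the criterion at the very end of the construction; the lower bound uses
    it directly, by tensoring with R/J_i. *)

Section QuotientModule.
Variables (R : comNzRingType) (V : lmodType R) (U : submodClosed V).

Let Uz : zmodClosed V := HB.pack (fun x : V => x \in U)
  (GRing.isZmodClosed.Build V (fun x : V => x \in U) (GRing.submod_closedB
    (submodClosedP U))).

Definition quotmod := Quotient.quot Uz.
HB.instance Definition _ := GRing.Zmodule.on quotmod.

Definition quotpi (x : V) : quotmod := \pi_(Quotient.quot Uz) x.

Fact quotpiD : {morph quotpi : x y / x + y}.
Proof. exact: pi_addr. Qed.

Fact quotpi_eq x y : quotpi x = quotpi y <-> x - y \in U.
Proof.
rewrite -[x - y \in U]/(x - y \in Uz) Quotient.idealrBE.
by split=> [/eqP|/eqP].
Qed.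

Fact quotpi_surj y : exists x, quotpi x = y.
Proof. by exists (repr (y : Quotient.quot Uz)); apply: reprK. Qed.

Definition quotmod_scale (a : R) (x : quotmod) : quotmod :=
  quotpi (a *: xget 0 [set y | quotpi y = x]%classic).

Fact quotpiZ a x : quotpi (a *: x) = quotmod_scale a (quotpi x).
Proof.
apply/quotpi_eq; rewrite -scalerBr; apply: GRing.rpredZ.
apply/quotpi_eq; case: xgetP => [y _ <-//|/(_ x) []//].
Qed.

Fact quotmodW (P : quotmod -> Prop) : (forall x, P (quotpi x)) -> forall x, P x.
Proof. by move=> Px x; have [y <-] := quotpi_surj x. Qed.

Fact quotmod_scaleA a b x :
  quotmod_scale a (quotmod_scale b x) = quotmod_scale (a * b) x.
Proof. by elim/quotmodW: x => x; rewrite -!quotpiZ scalerA. Qed.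

Fact quotmod_scale1 : left_id 1 quotmod_scale.
Proof. by elim/quotmodW => x; rewrite -quotpiZ scale1r. Qed.

Fact quotmod_scaleDr : right_distributive quotmod_scale +%R.
Proof.
move=> a; elim/quotmodW=> x; elim/quotmodW=> y.
by rewrite -quotpiD -!quotpiZ scalerDr quotpiD.
Qed.

Fact quotmod_scaleDl x : {morph quotmod_scale^~ x : a b / a + b}.
Proof.
elim/quotmodW: x => x a b.
by rewrite -!quotpiZ scalerDl quotpiD.
Qed.

HB.instance Definition _ := GRing.Zmodule_isLmodule.Build R quotmod
  quotmod_scaleA quotmod_scale1 quotmod_scaleDr quotmod_scaleDl.

Fact quotpi_linear : linear quotpi.
Proof. by move=> a x y; rewrite quotpiD quotpiZ. Qed.
HB.instance Definition _ := GRing.isLinear.Build R V quotmod *:%R quotpi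
  quotpi_linear.

Lemma quotpi_eq0 x : quotpi x = 0 <-> x \in U.
Proof. by rewrite -(linear0 quotpi) quotpi_eq subr0. Qed.

End QuotientModule.

Section Submodule.
Variables (R : comNzRingType) (V : lmodType R) (U : submodClosed V).

Record submodule := Submodule {
  submodule_val :> V;
  submodule_valP : submodule_val \in U }.

HB.instance Definition _ := [isSub for submodule_val].
HB.instance Definition _ := [Choice of submodule by <:].
HB.instance Definition _ := [SubChoice_isSubLmodule of submodule by <:].

End Submodule.

(** * The equational criterion for flatness *)

Section Combination.
Variables (B R : comNzRingType) (psi : {rmorphism B -> R}) (M : lmodType R).

Definition comb q (y : 'I_q -> M) (a : 'rV[B]_q) : M :=
  \sum_i psi (a 0 i) *: y i.

(** Flatness of M regarded as a B-module through [psi]: the relation has to be killed in B itself,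
    before [psi] is applied. *)
Definition equational : Prop := forall p (a : 'rV[B]_p) (m : 'I_p -> M),
  comb m a = 0 -> exists q (C : 'M[B]_(p, q)) (y : 'I_q -> M),
    a *m C = 0 /\ forall i, m i = comb y (row i C).

Lemma combZ q (y : 'I_q -> M) c a : comb y (c *: a) = psi c *: comb y a.
Proof.
rewrite /comb scaler_sumr; apply: eq_bigr => i _.
by rewrite mxE rmorphM scalerA.
Qed.

Lemma comb0 q (y : 'I_q -> M) : comb y 0 = 0.
Proof. by rewrite /comb big1// => i _; rewrite mxE rmorph0 scale0r. Qed.

Lemma combN q (y : 'I_q -> M) a : comb y (- a) = - comb y a.
Proof. by rewrite -[- a]scaleN1r combZ rmorphN rmorph1 scaleN1r. Qed.

Lemma comb_delta q (y : 'I_q -> M) i : comb y (delta_mx 0 i) = y i.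
Proof.
rewrite /comb (bigD1 i)//= mxE !eqxx rmorph1 scale1r big1 ?addr0// => j ji.
by rewrite mxE (negPf ji) andbF rmorph0 scale0r.
Qed.

Lemma comb_mulmx p q (m : 'I_p -> M) (y : 'I_q -> M) (C : 'M_(p, q)) a :
  (forall i, m i = comb y (row i C)) -> comb y (a *m C) = comb m a.
Proof.
move=> mE; rewrite /comb.
under [RHS]eq_bigr => i _ do rewrite mE scaler_sumr.
rewrite exchange_big /=; apply: eq_bigr => j _.
rewrite mxE rmorph_sum scaler_suml; apply: eq_bigr => i _.
by rewrite mxE rmorphM scalerA.
Qed.

(** Relations are killed one at a time. After the first, the others become relations [b *m C]
    between the new generators, so the induction is on the length while the list itself changes. *)
Lemma equational_seq : equational ->
  forall p (s : seq 'rV[B]_p) (m : 'I_p -> M),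
  (forall a, a \in s -> comb m a = 0) ->
  exists q (C : 'M[B]_(p, q)) (y : 'I_q -> M),
    (forall a, a \in s -> a *m C = 0) /\ forall i, m i = comb y (row i C).
Proof.
move=> eqM p s; have [k sk] := ubnP (size s).
elim: k p s sk => // k IHk p [|a s] /= sk m ms.
  exists p, 1%:M, m; split=> // i; by rewrite row1 comb_delta.
have [q [C [y [aC mE]]]] := eqM p a m (ms a (mem_head _ _)).
have ys c : c \in [seq b *m C | b <- s] -> comb y c = 0.
  by move=> /mapP[b bs ->]; rewrite (comb_mulmx _ mE) ms// inE bs orbT.
have [|q' [C' [y' [sC' yE]]]] := IHk _ _ _ y ys; first by rewrite size_map.
exists q', (C *m C'), y'; split=> [b|i].
  rewrite inE mulmxA => /predU1P[->|bs]; first by rewrite aC mul0mx.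
  by apply: sC'; apply: map_f.
by rewrite row_mul (comb_mulmx _ yE) -mE.
Qed.

Definition join q q' (y : 'I_q -> M) (y' : 'I_q' -> M) (i : 'I_(q + q')) : M :=
  match fintype.split i with inl j => y j | inr j => y' j end.

Lemma comb_join q q' (y : 'I_q -> M) (y' : 'I_q' -> M) a a' :
  comb (join y y') (row_mx a a') = comb y a + comb y' a'.
Proof.
rewrite /comb big_split_ord; congr (_ + _); apply: eq_bigr => i _ /=.
  by rewrite row_mxEl /join -[lshift _ _]/(unsplit (inl i)) unsplitK.
by rewrite row_mxEr /join -[rshift _ _]/(unsplit (inr i)) unsplitK.
Qed.

End Combination.

Section EquationalFlat.
Variables (R : comNzRingType) (M N : lmodType R).
Hypothesis eqM : equational (idfun : {rmorphism R -> R}) M.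
Local Notation comb := (@comb R R idfun M).

Definition pairs q (y : 'I_q -> M) (u : seq ('rV[R]_q * N)) : seq (M * N) :=
  [seq (comb y p.1, p.2) | p <- u].

Definition coefs q (u : seq ('rV[R]_q * N)) (i : 'I_q) : N :=
  \sum_(p <- u) p.1 0 i *: p.2.

(* For an equational module, two formal sums agree in the tensor product
   exactly when they can be expanded in common elements y_l of M so that the
   coefficients, which are elements of N, agree. *)
Definition eqtens (s t : seq (M * N)) : Prop :=
  exists q (y : 'I_q -> M) u v, [/\ s = pairs y u, t = pairs y v
    & forall i, coefs u i = coefs v i].

Definition expand q q' (C : 'M[R]_(q, q')) (u : seq ('rV[R]_q * N)) :=
  [seq (p.1 *m C, p.2) | p <- u].

Lemma coefs_cat q u v (i : 'I_q) : coefs (u ++ v) i = coefs u i + coefs v i.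
Proof. by rewrite /coefs big_cat. Qed.

Lemma coefs_expand q q' (C : 'M[R]_(q, q')) u i :
  coefs (expand C u) i = \sum_j C j i *: coefs u j.
Proof.
rewrite /coefs big_map; under [RHS]eq_bigr do rewrite scaler_sumr.
rewrite exchange_big /=; apply: eq_bigr => p _.
rewrite mxE scaler_suml; apply: eq_bigr => j _.
by rewrite scalerA mulrC.
Qed.

Lemma pairs_expand q q' (y : 'I_q -> M) (y' : 'I_q' -> M) C u :
  (forall i, y i = comb y' (row i C)) -> pairs y' (expand C u) = pairs y u.
Proof.
move=> yE; rewrite /pairs /expand -map_comp; apply: eq_map => p /=.
by rewrite (comb_mulmx _ yE).
Qed.

Lemma pairs_repr s : exists q (y : 'I_q -> M) u, s = pairs y u.
Proof.
exists (size s), (fun i => (tnth (in_tuple s) i).1).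
exists [seq (delta_mx 0 i, (tnth (in_tuple s) i).2) | i <- enum 'I_(size s)].
rewrite /pairs -map_comp -[LHS]/(tval (in_tuple s)) -[LHS]map_tnth_enum.
by apply: eq_map => i /=; rewrite comb_delta -surjective_pairing.
Qed.

Lemma map_cat_inv (T S : Type) (f : T -> S) u s t : map f u = s ++ t ->
  exists u1 u2, [/\ u = u1 ++ u2, s = map f u1 & t = map f u2].
Proof.
move=> /[dup] fE /(congr1 (take (size s))); rewrite take_size_cat// => <-.
move/(congr1 (drop (size s))): fE; rewrite drop_size_cat// => <-.
exists (take (size s) u), (drop (size s) u).
by rewrite cat_take_drop map_take map_drop.
Qed.

Lemma pairs_repr2 s t : exists q (y : 'I_q -> M) u v,
  s = pairs y u /\ t = pairs y v.
Proof.
have [q [y [w /esym/map_cat_inv[u [v [_ -> ->]]]]]] := pairs_repr (s ++ t).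
by exists q, y, u, v.
Qed.

Lemma eqtens_refl s : eqtens s s.
Proof. by have [q [y [u ->]]] := pairs_repr s; exists q, y, u, u. Qed.

Lemma eqtens_sym s t : eqtens s t -> eqtens t s.
Proof. by move=> [q [y [u [v [-> -> uv]]]]]; exists q, y, v, u; split. Qed.

(** Flatness enters here. The middle list has two expansions, over y and over y'. Their termwise
    equality gives relations between the joined generators, and passing to generators that kill
    these relations makes the two expansions identical. *)
Lemma eqtens_trans s t w : eqtens s t -> eqtens t w -> eqtens s w.
Proof.
move=> [q [y [u [v [-> -> uv]]]]] [q' [y' [v' [w' [vv' -> vw]]]]].
have sz : size v = size v' by have := congr1 size vv'; rewrite !size_map.
pose rel (p : ('rV[R]_q * N) * ('rV[R]_q' * N)) : 'rV[R]_(q + q') := row_mx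
  p.1.1 (- p.2.1).
have [|r [C [z [rC zE]]]] := @equational_seq _ _ _ _ eqM _
    [seq rel p | p <- zip v v'] (join y y').
  move=> _ /mapP[p pv ->]; rewrite comb_join combN.
  elim: v v' vv' sz pv {uv vw} => [|a v IH] [|b v']//= [ab _ vv'] [sz].
  rewrite inE => /predU1P[-> /=|]; first by rewrite ab subrr.
  exact: IH.
have yE i : y i = comb z (row i (usubmx C)).
  have := zE (lshift q' i); rewrite /join -[lshift _ _]/(unsplit (inl i)).
  by rewrite unsplitK => ->; congr comb; apply/rowP => j; rewrite !mxE.
have yE' i : y' i = comb z (row i (dsubmx C)).
  have := zE (rshift q i); rewrite /join -[rshift _ _]/(unsplit (inr i)).
  by rewrite unsplitK => ->; congr comb; apply/rowP => j; rewrite !mxE.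
exists r, z, (expand (usubmx C) u), (expand (dsubmx C) w').
rewrite (pairs_expand _ yE) (pairs_expand _ yE'); split=> // i.
suff vv : expand (usubmx C) v = expand (dsubmx C) v'.
  transitivity (coefs (expand (usubmx C) v) i).
    by rewrite !coefs_expand; under eq_bigr do rewrite uv.
  by rewrite vv !coefs_expand; under eq_bigr do rewrite vw.
have {}rC p : p \in zip v v' -> rel p *m C = 0.
  by move=> pv; apply: rC; apply: map_f.
elim: v v' vv' sz rC {uv vw} => [|a v IH] [|b v']//= [ab n vv'] [sz] rC.
rewrite (IH v')//; last by move=> p pv; apply: rC; rewrite inE pv orbT.
congr (_ :: _); rewrite n; congr pair.
have := rC _ (mem_head _ _); rewrite /rel /= -[C in LHS]vsubmxK.
by rewrite mul_row_col mulNmx => /eqP; rewrite subr_eq0 => /eqP.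
Qed.

Lemma eqtens_cat s s' t t' :
  eqtens s s' -> eqtens t t' -> eqtens (s ++ t) (s' ++ t').
Proof.
move=> [q [y [u [v [-> -> uv]]]]] [q' [y' [u' [v' [-> -> uv']]]]].
pose C : 'M[R]_(q, q + q') := row_mx 1%:M 0.
pose C' : 'M[R]_(q', q + q') := row_mx 0 1%:M.
have yE i : y i = comb (join y y') (row i C).
  by rewrite /C row_row_mx comb_join row0 comb0 addr0 row1 comb_delta.
have yE' i : y' i = comb (join y y') (row i C').
  by rewrite /C' row_row_mx comb_join row0 comb0 add0r row1 comb_delta.
exists (q + q')%N, (join y y'), (expand C u ++ expand C' u').
exists (expand C v ++ expand C' v'); split.
- by rewrite [RHS]map_cat -/(pairs _ _) (pairs_expand _ yE) -/(pairs _ _)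
    (pairs_expand _ yE').
- by rewrite [RHS]map_cat -/(pairs _ _) (pairs_expand _ yE) -/(pairs _ _)
    (pairs_expand _ yE').
- move=> i; rewrite !coefs_cat !coefs_expand.
  by congr (_ + _); apply: eq_bigr => j _; rewrite ?uv ?uv'.
Qed.

Definition scale_coefs q a (u : seq ('rV[R]_q * N)) :=
  [seq (a *: p.1, p.2) | p <- u].

Lemma coefs_scale q a u (i : 'I_q) : coefs (scale_coefs a u) i = a *: coefs u i.
Proof.
rewrite /coefs big_map scaler_sumr; apply: eq_bigr => p _.
by rewrite /= mxE scalerA.
Qed.

Lemma pairs_scale q (y : 'I_q -> M) a u :
  pairs y (scale_coefs a u) = tens_scale_seq a (pairs y u).
Proof.
by rewrite /pairs /tens_scale_seq -!map_comp; apply: eq_map => p /=;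
  rewrite combZ.
Qed.

Lemma eqtens_scale a s s' :
  eqtens s s' -> eqtens (tens_scale_seq a s) (tens_scale_seq a s').
Proof.
move=> [q [y [u [v [-> -> uv]]]]].
exists q, y, (scale_coefs a u), (scale_coefs a v).
by rewrite !pairs_scale; split=> // i; rewrite !coefs_scale uv.
Qed.

Definition eqtens_rel : rel (seq (M * N)) := fun s t => `[< eqtens s t >].

Lemma eqtens_rel_equiv : equiv_class_of eqtens_rel.
Proof.
split=> [s|s t|t s u].
- exact/asboolP/eqtens_refl.
- by apply/asboolP/asboolP; apply: eqtens_sym.
- by move=> /asboolP st /asboolP tu; apply/asboolP/(eqtens_trans st).
Qed.

Canonical eqtens_equiv := EquivRelPack eqtens_rel_equiv.
Canonical eqtens_encModRel := defaultEncModRel eqtens_rel.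

(** [tens_eq] quantifies over all targets of bilinear maps. This target is built so that its
    universal map [eqpure] identifies two formal sums only when they are related by [eqtens]. *)
Definition eqtensor := {eq_quot eqtens_rel}.
HB.instance Definition _ : EqQuotient _ eqtens_rel eqtensor :=
  EqQuotient.on eqtensor.
HB.instance Definition _ := Choice.on eqtensor.

Definition eqclass s : eqtensor := \pi s.

Lemma eqclassP s t : eqtens s t <-> eqclass s = eqclass t.
Proof.
split=> [st|/eqmodP/asboolP//].
exact/eqmodP/asboolP.
Qed.

Lemma eqclassW (Q : eqtensor -> Prop) : (forall s, Q (eqclass s)) -> forall x,
  Q x.
Proof. by move=> Qs x; rewrite -[x]reprK; apply: Qs. Qed.

Lemma repr_eqclass s : eqtens (repr (eqclass s)) s.
Proof. by apply/eqclassP; rewrite /eqclass reprK. Qed.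

Definition eqtens_add x y := eqclass (repr (x : eqtensor) ++ repr (y :
  eqtensor)).
Definition eqtens_scl a x := eqclass (tens_scale_seq a (repr (x : eqtensor))).

Lemma eqtens_addE s t : eqtens_add (eqclass s) (eqclass t) = eqclass (s ++ t).
Proof. by apply/eqclassP/eqtens_cat; apply: repr_eqclass. Qed.

Lemma eqtens_sclE a s : eqtens_scl a (eqclass s) = eqclass (tens_scale_seq a s).
Proof. by apply/eqclassP/eqtens_scale/repr_eqclass. Qed.

Fact eqtens_addA : associative eqtens_add.
Proof.
elim/eqclassW=> s; elim/eqclassW=> t; elim/eqclassW=> u.
by rewrite !eqtens_addE catA.
Qed.

Fact eqtens_addC : commutative eqtens_add.
Proof.
elim/eqclassW=> s; elim/eqclassW=> t; rewrite !eqtens_addE; apply/eqclassP.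
have [q [y [u [v [-> ->]]]]] := pairs_repr2 s t.
exists q, y, (u ++ v), (v ++ u); rewrite /pairs !map_cat; split=> // i.
by rewrite !coefs_cat addrC.
Qed.

Fact eqtens_add0 : left_id (eqclass [::]) eqtens_add.
Proof. by elim/eqclassW=> s; rewrite eqtens_addE. Qed.

Fact eqtens_addN : left_inverse (eqclass [::]) (eqtens_scl (-1)) eqtens_add.
Proof.
elim/eqclassW=> s; rewrite eqtens_sclE eqtens_addE; apply/eqclassP.
have [q [y [u ->]]] := pairs_repr s.
exists q, y, (scale_coefs (-1) u ++ u), [::].
rewrite [in RHS]/pairs map_cat -/(pairs _ _) pairs_scale; split=> // i.
by rewrite coefs_cat coefs_scale scaleN1r addNr /coefs big_nil.
Qed.

HB.instance Definition _ := GRing.isZmodule.Build eqtensor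
  eqtens_addA eqtens_addC eqtens_add0 eqtens_addN.

Fact eqtens_sclA a b x : eqtens_scl a (eqtens_scl b x) = eqtens_scl (a * b) x.
Proof.
elim/eqclassW: x => s; rewrite !eqtens_sclE; congr eqclass.
rewrite /tens_scale_seq -map_comp; apply: eq_map => p /=.
by rewrite scalerA.
Qed.

Fact eqtens_scl1 : left_id 1 eqtens_scl.
Proof.
elim/eqclassW=> s; rewrite eqtens_sclE; congr eqclass.
by rewrite /tens_scale_seq -[RHS]map_id; apply: eq_map => -[m n] /=;
  rewrite scale1r.
Qed.

Fact eqtens_sclDr : right_distributive eqtens_scl +%R.
Proof.
move=> a; elim/eqclassW=> s; elim/eqclassW=> t.
rewrite [LHS](congr1 _ (eqtens_addE s t)) !eqtens_sclE [RHS]eqtens_addE.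
by rewrite /tens_scale_seq map_cat.
Qed.

Fact eqtens_sclDl x : {morph eqtens_scl^~ x : a b / a + b}.
Proof.
elim/eqclassW: x => s a b; rewrite !eqtens_sclE [RHS]eqtens_addE.
apply/eqclassP; have [q [y [u ->]]] := pairs_repr s.
exists q, y, (scale_coefs (a + b) u), (scale_coefs a u ++ scale_coefs b u).
split; rewrite ?pairs_scale//.
  by rewrite [RHS]map_cat -!/(pairs _ _) !pairs_scale.
by move=> i; rewrite coefs_cat !coefs_scale scalerDl.
Qed.

HB.instance Definition _ := GRing.Zmodule_isLmodule.Build R eqtensor
  eqtens_sclA eqtens_scl1 eqtens_sclDr eqtens_sclDl.

Definition eqpure (m : M) (n : N) : eqtensor := eqclass [:: (m, n)].

Lemma eqpure_bilinear : bilinear_for *:%R *:%R eqpure.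
Proof.
split=> [n a m m'|m a n n'].
  rewrite -[RHS]/(eqtens_add (eqtens_scl a (eqclass [:: (m, n)]))
                             (eqclass [:: (m', n)])) eqtens_sclE eqtens_addE.
  apply/eqclassP; exists 2, (fun i => if i == 0 then m else m').
  exists [:: (\row_i if i == 0 then a else 1, n)].
  exists [:: (a *: delta_mx 0 0, n); (delta_mx 0 1, n)].
  rewrite /pairs /= combZ !comb_delta; split=> //.
    rewrite /comb 2!big_ord_recl big_ord0 !mxE /= addr0 scale1r //.
  move=> i; rewrite /coefs !big_cons !big_nil /= !mxE !addr0 -scalerDl.
  by congr (_ *: _); case: i => -[|[|//]] ?;
    rewrite /= ?mulr1 ?mulr0 ?addr0 ?add0r.
rewrite -[RHS]/(eqtens_add (eqtens_scl a (eqclass [:: (m, n)]))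
                           (eqclass [:: (m, n')])) eqtens_sclE eqtens_addE.
apply/eqclassP; exists 1, (fun=> m), [:: (1%:M, a *: n + n')].
exists [:: (a%:M, n); (1%:M, n')].
rewrite /pairs /= /comb !big_ord1 !mxE /= scale1r; split=> // i.
rewrite /coefs !big_cons !big_nil /= !ord1 !mxE /= !addr0 !scale1r.
by [].
Qed.

Lemma sum_eqpure (s : seq (M * N)) :
  \sum_(p <- s) eqpure p.1 p.2 = eqclass s.
Proof.
elim: s => [|[m n] s IHs]; first by rewrite big_nil.
by rewrite big_cons IHs [LHS]eqtens_addE.
Qed.

Lemma eqtens_of_tens_eq s t : tens_eq s t -> eqtens s t.
Proof.
by move=> /(_ _ _ eqpure_bilinear); rewrite !sum_eqpure => /eqclassP.
Qed.

End EquationalFlat.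

(** A bilinear map sends an expanded sum to the sum of the [b (y i) (coefs u i)], hence sees only
    the coefficients. *)
Lemma tens_eq_of_eqtens (R : comNzRingType) (M N : lmodType R) (s t : seq (M *
  N)) :
  eqtens s t -> tens_eq s t.
Proof.
move=> [q [y [u [v [-> -> uv]]]]] P b [bl br].
have b0l n : b 0 n = 0.
  by have /= := bl n (-1) 0 0; rewrite scaler0 addr0 scaleN1r addNr.
have b0r m : b m 0 = 0.
  by have /= := br m (-1) 0 0; rewrite scaler0 addr0 scaleN1r addNr.
have bsum w : \sum_(p <- pairs y w) b p.1 p.2 = \sum_i b (y i) (coefs w i).
  rewrite big_map /=.
  have bcomb p : b (comb idfun y p.1) p.2 = \sum_i b (y i) (p.1 0 i *: p.2).
    have bZ a m n : b (a *: m) n = a *: b m n.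
      by have /= := bl n a m 0; rewrite addr0 b0l addr0.
    rewrite /comb (big_morph (b^~ p.2) (_ : {morph b^~ p.2 : x y / x + y}) (b0l
      _)).
      apply: eq_bigr => i _; rewrite bZ /=.
      by have /= := br (y i) (p.1 0 i) p.2 0; rewrite addr0 b0r addr0.
    by move=> m m'; have /= := bl p.2 1 m m'; rewrite !scale1r.
  under eq_bigr do rewrite bcomb.
  rewrite exchange_big /=; apply: eq_bigr => i _.
  rewrite /coefs (big_morph (b (y i)) (_ : {morph b (y i) : x y / x + y}) (b0r
    _))//.
  by move=> n n'; have /= := br (y i) 1 n n'; rewrite !scale1r.
by rewrite !bsum; apply: eq_bigr => i _; rewrite uv.
Qed.

(** Expansions that witness the equality of two images leave the second components untouched, so
    these still have the form f n. Pulled back, they expand the original sums, and the coefficients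
    agree because f is injective. *)
Lemma equational_flat (R : comNzRingType) (M : lmodType R) :
  equational (idfun : {rmorphism R -> R}) M -> flat M.
Proof.
move=> eqM N N' f finj; elim/tensW=> s; elim/tensW=> t.
pose F (u : seq (M * N)) := [seq (p.1, f p.2) | p <- u].
have mapE u : tens_map f (tens_sum u) = tens_sum (F u).
  rewrite /tens_map tens_lift_sum; last exact: tens_map_bilinear.
  by rewrite tens_sumE big_map.
rewrite !mapE => /tens_sumP/(eqtens_of_tens_eq eqM) [q [y [u [v [su tv uv]]]]].
apply/tens_sumP/tens_eq_of_eqtens.
have lift_ w w' : F w = pairs y w' -> exists2 w'', w = pairs y w'' &
    w' = [seq (p.1, f p.2) | p <- w''].
  elim: w w' => [|[m n] w IH] [|[a n'] w']//=; first by exists [::].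
  move=> [-> <- /IH[w'' -> ->]].
  by exists ((a, n) :: w'').
have [u' -> u'E] := lift_ _ _ su; have [v' -> v'E] := lift_ _ _ tv.
exists q, y, u', v'; split=> // i; apply: finj.
have fE w : f (coefs w i) = coefs [seq (p.1, f p.2) | p <- w] i.
  by rewrite /coefs big_map raddf_sum; apply: eq_bigr => p _; apply: linearZ.
by rewrite !fE -u'E -v'E uv.
Qed.

Section EquationalFin.
Variables (B R : comNzRingType) (psi : {rmorphism B -> R}) (M : lmodType R).

Lemma equational_fin : equational psi M ->
  forall (I J : finType) (a : J -> I -> B) (m : I -> M),
  (forall j, \sum_i psi (a j i) *: m i = 0) ->
  exists q (C : I -> 'I_q -> B) (y : 'I_q -> M),
    (forall j l, \sum_i a j i * C i l = 0) /\
    forall i, m i = \sum_l psi (C i l) *: y l.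
Proof.
move=> eqM I J a m am.
pose ra j : 'rV[B]_#|I| := \row_i a j (enum_val i).
have [_ /mapP[j _ ->]|q [C [y [aC mE]]]] := @equational_seq _ _ _ _ eqM _
    [seq ra j | j <- enum J] (fun i => m (enum_val i)).
  rewrite -[RHS](am j) (reindex (@enum_val I predT)) /=; last first.
    exact/onW_bij/enum_val_bij.
  by apply: eq_bigr => i _; rewrite mxE.
exists q, (fun i l => C (enum_rank i) l), y; split=> [j l|i].
  have /rowP/(_ l) := aC (ra j) (map_f _ (mem_enum _ _)).
  rewrite !mxE => raC; rewrite -[RHS]raC.
  rewrite (reindex (@enum_val I predT)) /=; last exact/onW_bij/enum_val_bij.
  by apply: eq_bigr => i _; rewrite mxE enum_valK.
have := mE (enum_rank i); rewrite enum_rankK => ->.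
by apply: eq_bigr => l _; rewrite mxE.
Qed.

Lemma equationalI : (forall p (a : 'I_p -> B) (m : 'I_p -> M),
    \sum_i psi (a i) *: m i = 0 ->
    exists (I : finType) (C : 'I_p -> I -> B) (y : I -> M),
    (forall l, \sum_i a i * C i l = 0) /\
    forall i, m i = \sum_l psi (C i l) *: y l) ->
  equational psi M.
Proof.
move=> H p a m am; have [I [C [y [aC mE]]]] := H p (a 0) m am.
exists #|I|, (\matrix_(i, l) C i (enum_val l)), (fun l => y (enum_val l)).
split=> [|i].
  apply/rowP => l; rewrite !mxE -[RHS](aC (enum_val l)).
  by apply: eq_bigr => i _; rewrite mxE.
rewrite mE (reindex (@enum_val I predT)) /=; last exact/onW_bij/enum_val_bij.
by apply: eq_bigr => l _; rewrite !mxE.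
Qed.

Lemma equational_trivial : (forall x : M, x = 0) -> equational psi M.
Proof.
move=> M0; apply: equationalI => p a m _.
exists 'I_0, (fun _ _ => 0), (fun=> 0); split=> [[]//|i].
by rewrite big_ord0; apply: M0.
Qed.

End EquationalFin.

Lemma fst_sum (V W : zmodType) (I : finType) (F : I -> V * W) :
  (\sum_i F i).1 = \sum_i (F i).1.
Proof. by apply: (big_morph fst (id1 := 0)). Qed.

Lemma snd_sum (V W : zmodType) (I : finType) (F : I -> V * W) :
  (\sum_i F i).2 = \sum_i (F i).2.
Proof. by apply: (big_morph snd (id1 := 0)). Qed.

Lemma equational_prod (B R : comNzRingType) (psi : {rmorphism B -> R})
    (M N : lmodType R) :
  equational psi M -> equational psi N -> equational psi (M * N)%type.
Proof.
move=> eqM eqN; apply: equationalI => p a m am.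
have am1 : \sum_i psi (a i) *: (m i).1 = 0.
  by have := congr1 fst am; rewrite fst_sum.
have am2 : \sum_i psi (a i) *: (m i).2 = 0.
  by have := congr1 snd am; rewrite snd_sum.
have [|q [C [y [aC mE]]]] := equational_fin eqM (J := unit) (a := fun=> a) (m
  := fst \o m).
  by [].
have [|q' [C' [y' [aC' mE']]]] := equational_fin eqN (J := unit) (a := fun=> a)
  (m := snd \o m).
  by [].
exists ('I_q + 'I_q')%type.
exists (fun i l => match l with inl l => C i l | inr l => C' i l end).
exists (fun l => match l with inl l => (y l, 0) | inr l => (0, y' l) end).
split=> [[l|l]|i]; first exact: (aC tt).
  exact: (aC' tt).
rewrite big_sumType /= [LHS]surjective_pairing; congr pair => /=.
  rewrite !fst_sum [X in _ + X]big1 => [|l _].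
    by rewrite addr0; apply: mE.
  by rewrite /= scaler0.
rewrite !snd_sum [X in X + _]big1 => [|l _].
  by rewrite add0r; apply: mE'.
by rewrite /= scaler0.
Qed.

Lemma equational_comp (B' B R : comNzRingType) (theta : {rmorphism B' -> B})
    (psi : {rmorphism B -> R}) (M : lmodType R) :
  bijective theta -> equational psi M -> equational (psi \o theta) M.
Proof.
move=> [theta' thetaK theta'K] eqM; apply: equationalI => p a m am.
have [|q [C [y [aC mE]]]] :=
    equational_fin eqM (J := unit) (a := fun=> theta \o a) (m := m).
  by [].
exists 'I_q, (fun i l => theta' (C i l)), y; split=> [l|i].
  apply: (can_inj thetaK); rewrite rmorph0 rmorph_sum -[RHS](aC tt l) /=.
  by apply: eq_bigr => i _; rewrite rmorphM theta'K.
by rewrite mE; apply: eq_bigr => l _ /=; rewrite theta'K.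
Qed.

(** The matrix with entries delta_ij - u_i a_j works: the row a times it vanishes by the choice of
    u, and it fixes m because the combination of the m_j with coefficients a_j is zero. *)
Lemma equational_regular (B R : comNzRingType) (psi : {rmorphism B -> R})
    (M : lmodType R) :
  (forall p (a : 'I_p -> B), exists u : 'I_p -> B,
    forall j, (\sum_i u i * a i) * a j = a j) ->
  equational psi M.
Proof.
move=> reg; apply: equationalI => p a m am; have [u ua] := reg p a.
exists 'I_p, (fun i j => (i == j)%:R - u i * a j), m; split=> [j|i].
  under eq_bigr => i _ do rewrite mulrBr mulrA [a i * u i]mulrC.
  rewrite sumrB -mulr_suml ua (bigD1 j)//= eqxx mulr1 big1 ?addr0 ?subrr//.
  by move=> i /negPf ij; rewrite ij mulr0.
under eq_bigr => j _ do rewrite rmorphB rmorphM scalerBl -scalerA.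
rewrite sumrB -scaler_sumr am scaler0 subr0 (bigD1 i)//= eqxx rmorph1 scale1r.
rewrite big1 ?addr0// => j ji.
by rewrite eq_sym (negPf ji) rmorph0 scale0r.
Qed.

(** * Polynomial modules *)

Section PolyModule.
Variables (D : comNzRingType) (M : lmodType D).

Definition polymod_pred : {pred (nat -> M)} :=
  fun f => `[< exists n, forall i, (n <= i)%N -> f i = 0 >].

Fact polymod_zmod_closed : zmod_closed polymod_pred.
Proof.
split=> [|f g /asboolP[n fn] /asboolP[n' gn]]; apply/asboolP.
  by exists 0%N.
exists (maxn n n') => i; rewrite geq_max => /andP[ni n'i].
by rewrite -[LHS]/(f i - g i) fn// gn// subr0.
Qed.
HB.instance Definition _ :=
  GRing.isZmodClosed.Build _ polymod_pred polymod_zmod_closed.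

Record polymod := Polymod {
  polymod_val :> nat -> M;
  polymod_valP : polymod_val \in polymod_pred }.
HB.instance Definition _ := [isSub for polymod_val].
HB.instance Definition _ := [Choice of polymod by <:].
HB.instance Definition _ := [SubChoice_isSubZmodule of polymod by <:].

Implicit Types (f g : polymod) (p : {poly D}).

Lemma polymodP f g : f =1 g -> f = g.
Proof. by move=> fg; apply: val_inj; apply/funext. Qed.

Lemma polymod_bound f : exists n, forall i, (n <= i)%N -> f i = 0.
Proof. exact/asboolP/polymod_valP. Qed.

Fact polymod_scale_proof p f :
  (fun n => \sum_(j < n.+1) p`_j *: f (n - j)%N) \in polymod_pred.
Proof.
apply/asboolP; have [N fN] := polymod_bound f.
exists (N + size p)%N => i Ni; rewrite big1// => j _.
have [sj|js] := leqP (size p) j; first by rewrite nth_default// scale0r.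
rewrite fN ?scaler0// leq_subRL; last by rewrite -ltnS.
by apply: leq_trans Ni; rewrite addnC leq_add2l ltnW.
Qed.

Definition polymod_scale p f := Polymod (polymod_scale_proof p f).

Lemma polymod_scale_rev p f n :
  polymod_scale p f n = \sum_(j < n.+1) p`_(n - j)%N *: f j.
Proof.
rewrite /= (reindex_inj rev_ord_inj) /=.
by apply: eq_bigr => j _; rewrite subSS subKn// -ltnS.
Qed.

Fact polymod_scaleA p q f :
  polymod_scale p (polymod_scale q f) = polymod_scale (p * q) f.
Proof.
apply: polymodP => i; rewrite [RHS]polymod_scale_rev.
transitivity (\sum_(j < i.+1) p`_j *: polymod_scale q f (i - j)%N); first by [].
pose coef3 j k := p`_j *: (q`_(i - j - k)%N *: f k).
transitivity (\sum_(j < i.+1) \sum_(k < i.+1 | (k <= i - j)%N) coef3 j k).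
  apply: eq_bigr => j _.
  by rewrite polymod_scale_rev scaler_sumr (big_ord_narrow_leq (leq_subr _ _)).
rewrite (exchange_big_dep predT) //=; apply: eq_bigr => k _.
transitivity (\sum_(j < i.+1 | (j <= i - k)%N) coef3 j k).
  apply: eq_bigl => j; rewrite -ltnS -(ltnS j) -!subSn ?leq_ord //.
  by rewrite -subn_gt0 -(subn_gt0 j) -!subnDA addnC.
rewrite (big_ord_narrow_leq (leq_subr _ _)) coefM scaler_suml /=.
by apply: eq_bigr => j _; rewrite /coef3 -!subnDA addnC scalerA.
Qed.

Fact polymod_scale1 : left_id 1 polymod_scale.
Proof.
move=> f; apply: polymodP => i /=.
rewrite big_ord_recl coef1 eqxx scale1r subn0 big1 ?addr0// => j _.
by rewrite coef1 scale0r.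
Qed.

Fact polymod_scaleDr : right_distributive polymod_scale +%R.
Proof.
move=> p f g; apply: polymodP => i /=.
rewrite -[RHS]/(_ i + _ i) /= -big_split /=; apply: eq_bigr => j _.
by rewrite -scalerDr.
Qed.

Fact polymod_scaleDl f : {morph polymod_scale^~ f : p q / p + q}.
Proof.
move=> p q; apply: polymodP => i /=.
rewrite -[RHS]/(_ i + _ i) /= -big_split /=; apply: eq_bigr => j _.
by rewrite coefD scalerDl.
Qed.

HB.instance Definition _ := GRing.Zmodule_isLmodule.Build {poly D} polymod
  polymod_scaleA polymod_scale1 polymod_scaleDr polymod_scaleDl.

Lemma polymodD f g i : (f + g) i = f i + g i. Proof. by []. Qed.
Lemma polymodZ p f i : (p *: f) i = \sum_(j < i.+1) p`_j *: f (i - j)%N.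
Proof. by []. Qed.

Fact polymod_const_proof c : (fun n => if n is 0%N then c else 0) \in
  polymod_pred.
Proof. by apply/asboolP; exists 1%N => -[]. Qed.

Definition polymodC c : polymod := Polymod (polymod_const_proof c).

Lemma polymodZ_rev p f i : (p *: f) i = \sum_(j < i.+1) p`_(i - j) *: f j.
Proof. exact: polymod_scale_rev. Qed.

Lemma polymodZC p c i : (p *: polymodC c) i = p`_i *: c.
Proof.
rewrite polymodZ_rev big_ord_recl subn0 big1 ?addr0// => j _.
by rewrite scaler0.
Qed.

Lemma polymodCZ a f i : (a%:P *: f) i = a *: f i.
Proof.
rewrite polymodZ big_ord_recl coefC eqxx subn0 big1 ?addr0// => j _.
by rewrite coefC scale0r.
Qed.

Lemma polymodXZ f i : ('X *: f) i = if i is j.+1 then f j else 0.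
Proof.
rewrite polymodZ; case: i => [|i]; first by rewrite big_ord1 coefX scale0r.
rewrite !big_ord_recl !coefX scale0r add0r scale1r subSS subn0.
by rewrite big1 ?addr0// => j _; rewrite coefX scale0r.
Qed.

Lemma polymod_ind (P : polymod -> Prop) :
  P 0 -> (forall f c, P f -> P ('X *: f + polymodC c)) -> forall f, P f.
Proof.
move=> P0 PS f; have [n] := polymod_bound f.
elim: n f => [|n IHn] f fn.
  by have -> : f = 0; [apply: polymodP => i; apply: fn|].
have gP : (fun i => f i.+1) \in polymod_pred.
  by apply/asboolP; exists n => i ni; apply: fn.
have -> : f = 'X *: Polymod gP + polymodC (f 0%N).
  apply: polymodP => i; rewrite polymodD polymodXZ.
  by case: i => [|i] /=; rewrite ?add0r ?addr0.
by apply/PS/IHn => i ni; apply: fn.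
Qed.

Section Evaluation.
Variable x : D.

(** Some bound on the support, not the exact degree; by [polymod_evalE] the evaluation does not
    depend on it. *)
Definition polymod_size f := sval (cid (polymod_bound f)).

Lemma polymod_sizeP f i : (polymod_size f <= i)%N -> f i = 0.
Proof. by rewrite /polymod_size; case: cid => n fn /=; apply: fn. Qed.

Definition polymod_eval f : M := \sum_(i < polymod_size f) x ^+ i *: f i.

Lemma polymod_evalE f n : (forall i, (n <= i)%N -> f i = 0) ->
  polymod_eval f = \sum_(i < n) x ^+ i *: f i.
Proof.
move=> fn; pose N := (n + polymod_size f)%N.
have widen k : (k <= N)%N -> (forall i, (k <= i)%N -> f i = 0) ->
    \sum_(i < k) x ^+ i *: f i = \sum_(i < N) x ^+ i *: f i.
  move=> kN fk; rewrite (big_ord_widen _ (fun i => x ^+ i *: f i) kN)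
    [RHS](bigID (fun i : 'I_N => (i < k)%N)).
  rewrite /= [X in _ = _ + X]big1 ?addr0// => i.
  by rewrite -leqNgt => ki; rewrite fk// scaler0.
rewrite [RHS]widen ?leq_addr// /polymod_eval widen ?leq_addl// => i.
exact: polymod_sizeP.
Qed.

Lemma polymod_evalD f g : polymod_eval (f + g) = polymod_eval f + polymod_eval
  g.
Proof.
pose N := (polymod_size f + polymod_size g)%N.
have fN i : (N <= i)%N -> f i = 0.
  by move=> Ni; apply: polymod_sizeP; apply: leq_trans Ni; apply: leq_addr.
have gN i : (N <= i)%N -> g i = 0.
  by move=> Ni; apply: polymod_sizeP; apply: leq_trans Ni; apply: leq_addl.
rewrite (polymod_evalE fN) (polymod_evalE gN) (polymod_evalE (n := N)).
  by rewrite -big_split; apply: eq_bigr => i _; rewrite polymodD scalerDr.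
by move=> i Ni; rewrite polymodD fN// gN// addr0.
Qed.

Lemma polymod_evalC c : polymod_eval (polymodC c) = c.
Proof.
rewrite (polymod_evalE (n := 1)); last by case.
by rewrite big_ord1 expr0 scale1r.
Qed.

Lemma polymod_evalXZ f : polymod_eval ('X *: f) = x *: polymod_eval f.
Proof.
rewrite (polymod_evalE (n := (polymod_size f).+1)); last first.
  by case=> // i fi; rewrite polymodXZ polymod_sizeP.
rewrite big_ord_recl polymodXZ scaler0 add0r /polymod_eval scaler_sumr.
by apply: eq_bigr => i _; rewrite polymodXZ /= exprS scalerA.
Qed.

Lemma polymod_evalCZ a f : polymod_eval (a%:P *: f) = a *: polymod_eval f.
Proof.
rewrite (polymod_evalE (n := polymod_size f)); last first.
  by move=> i fi; rewrite polymodCZ polymod_sizeP ?scaler0.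
rewrite /polymod_eval scaler_sumr; apply: eq_bigr => i _.
by rewrite polymodCZ !scalerA mulrC.
Qed.

Lemma polymod_evalZ p f : polymod_eval (p *: f) = p.[x] *: polymod_eval f.
Proof.
elim/poly_ind: p f => [|p c IHp] f.
  rewrite horner0 !scale0r -[RHS](polymod_evalC 0); congr polymod_eval.
  by apply: polymodP => -[].
rewrite scalerDl polymod_evalD polymod_evalCZ -scalerA IHp polymod_evalXZ.
by rewrite scalerA -scalerDl hornerMXaddC.
Qed.

Lemma polymod_division f : exists g,
  f = ('X - x%:P) *: g + polymodC (polymod_eval f).
Proof.
suff [g [c fE]] : exists g c, f = ('X - x%:P) *: g + polymodC c.
  exists g; rewrite {1}fE; congr (_ + polymodC _).
  by rewrite fE polymod_evalD polymod_evalZ polymod_evalC hornerXsubC subrr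
    scale0r add0r.
elim/polymod_ind: f => [|f c [g [s ->]]].
  by exists 0, 0; rewrite scaler0 add0r; apply: polymodP => -[].
(* Horner's scheme: 'X s = ('X - x) s + x s. *)
exists ('X *: g + polymodC s), (x *: s + c).
have -> : polymodC (x *: s + c) = x%:P *: polymodC s + polymodC c.
  apply: polymodP => i; rewrite polymodD polymodCZ.
  by case: i => [|i] /=; rewrite ?scaler0 ?addr0.
rewrite !scalerDr !scalerA ['X * _]mulrC -!addrA; congr (_ + _).
by rewrite !addrA -scalerDl subrK.
Qed.

Lemma polymod_eval_eq0 f :
  polymod_eval f = 0 <-> exists g, ('X - x%:P) *: g = f.
Proof.
split=> [f0|[g <-]].
  have [g fE] := polymod_division f; exists g; rewrite [RHS]fE f0.
  have -> : polymodC 0 = 0 by apply: polymodP => -[].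
  by rewrite addr0.
by rewrite polymod_evalZ hornerXsubC subrr scale0r.
Qed.

(** The equation reads f_j = x f_(j+1), so each coefficient is a power of x times a coefficient
    beyond the support. *)
Lemma polymod_XsubC_inj f : ('X - x%:P) *: f = 0 -> f = 0.
Proof.
rewrite scalerBl => /eqP; rewrite subr_eq0 => /eqP f0; apply: polymodP => i.
have fS j : f j = x *: f j.+1.
  by have := congr1 (fun h : polymod => h j.+1) f0; rewrite polymodXZ polymodCZ.
have fE n : f i = x ^+ n *: f (i + n)%N.
  elim: n => [|n IHn]; first by rewrite scale1r addn0.
  by rewrite IHn fS scalerA -exprSr addnS.
by rewrite (fE (polymod_size f)) polymod_sizeP ?scaler0// leq_addl.
Qed.

End Evaluation.
End PolyModule.

(** A relation over B[t] is a finite family of relations over B between all the coefficients of the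
    m_i, one for each power of t. They are killed simultaneously, and the generators found in M are
    used as constant polynomials. *)
Lemma equational_polymod (B D : comNzRingType) (psi : {rmorphism B -> D})
    (M : lmodType D) :
  equational psi M -> equational (map_poly psi) (polymod M).
Proof.
move=> eqM; apply: equationalI => p a m am.
pose N := \max_(i < p) polymod_size (m i); pose K := \max_(i < p) size (a i).
have mN i k : (N <= k)%N -> m i k = 0.
  by move=> Nk; apply: polymod_sizeP; apply: leq_trans Nk;
    apply: (leq_bigmax (F := fun i => polymod_size (m i))).
have aK i k : (K <= k)%N -> (a i)`_k = 0.
  by move=> Kk; apply: nth_default; apply: leq_trans Kk;
    apply: (leq_bigmax (F := fun i => size (a i))).
pose rel (n : nat) (ik : 'I_p * 'I_N) : B :=
  if (ik.2 <= n)%N then (a ik.1)`_(n - ik.2) else 0.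
have [n|q [C [y [rC mE]]]] := equational_fin eqM (J := 'I_(N + K))
    (a := fun n => rel n) (m := fun ik => m ik.1 ik.2).
  rewrite -[RHS](congr1 (fun h : polymod M => h n) am).
  have -> : (\sum_i map_poly psi (a i) *: m i) n =
            \sum_i (map_poly psi (a i) *: m i) n.
    by apply: (big_morph (fun h : polymod M => h n) (id1 := 0)).
  rewrite -(pair_bigA _ (fun i (k : 'I_N) => psi (rel n (i, k)) *: m i k)).
  apply: eq_bigr => i _; rewrite polymodZ_rev /rel /=.
  (* The sums over k < N and over k <= n are compared by extending both with zeros to k < N +
     n.+1. *)
  pose F k := psi (if (k <= n)%N then (a i)`_(n - k) else 0) *: m i k.
  rewrite [LHS](_ : _ = \sum_(k < N + n.+1) F k); last first.
    rewrite big_split_ord /= [X in _ + X]big1 ?addr0// => k _.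
    by rewrite /F mN ?scaler0// leq_addr.
  rewrite [RHS](_ : _ = \sum_(k < n.+1) F k); last first.
    by apply: eq_bigr => k _; rewrite /F -ltnS ltn_ord coef_map.
  rewrite addnC big_split_ord /= [X in _ + X]big1 ?addr0// => k _.
  by rewrite /F leqNgt ltnS leq_addr /= rmorph0 scale0r.
exists 'I_q, (fun i l => \poly_(k < N) (if insub k is Some k' then C (i, k') l
  else 0)).
exists (fun l => polymodC (y l)).
have CE i l (k : 'I_N) : (\poly_(k < N)
    (if insub k is Some k' then C (i, k') l else 0))`_k = C (i, k) l.
  by rewrite coef_poly ltn_ord valK.
split=> [l|i]; last first.
  apply: polymodP => k.
  have -> : (\sum_l map_poly psi (\poly_(k < N)
      (if insub k is Some k' then C (i, k') l else 0)) *: polymodC (y l)) k =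
      \sum_l (map_poly psi (\poly_(k < N)
      (if insub k is Some k' then C (i, k') l else 0)) *: polymodC (y l)) k.
    by apply: (big_morph (fun h : polymod M => h k) (id1 := 0)).
  have [Nk|kN] := leqP N k.
    rewrite mN// big1// => l _.
    by rewrite polymodZC coef_map coef_poly ltnNge Nk /= rmorph0 scale0r.
  rewrite (mE (i, Ordinal kN)); apply: eq_bigr => l _.
  by rewrite polymodZC coef_map -(CE i l (Ordinal kN)).
apply/polyP => n; rewrite coef0 coef_sum.
transitivity (\sum_ik rel n ik * C ik l); last first.
  have [nNK|NKn] := ltnP n (N + K); first exact: (rC (Ordinal nNK)).
  apply: big1 => -[i k] _; rewrite /rel /=; case: ifP => _; rewrite ?mul0r//.
  rewrite aK ?mul0r// leq_subRL; last first.
    by apply: leq_trans NKn; apply/ltnW/ltn_addr.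
  by apply: leq_trans NKn; rewrite leq_add2r ltnW.
rewrite [RHS](_ : _ = \sum_(i < p) \sum_(k < N) rel n (i, k) * C (i, k) l);
  last by rewrite pair_bigA; apply: eq_bigr => -[].
apply: eq_bigr => i _; rewrite coefMr.
pose F k := (if (k <= n)%N then (a i)`_(n - k) else 0) *
  (if insub k is Some k' then C (i, k') l else 0).
rewrite [RHS](_ : _ = \sum_(k < N + n.+1) F k); last first.
  rewrite big_split_ord /= [X in _ + X]big1 ?addr0 => [|k _].
    by apply: eq_bigr => j _; rewrite /F valK.
  by rewrite /F insubF ?mulr0// ltnNge leq_addr.
rewrite [LHS](_ : _ = \sum_(k < n.+1) F k); last first.
  apply: eq_bigr => k _; rewrite /F -ltnS ltn_ord coef_poly; case: ifP => // kN.
  by rewrite insubF.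
rewrite [in RHS]addnC big_split_ord /= [X in _ = _ + X]big1 ?addr0// => k _.
by rewrite /F leqNgt ltnS leq_addr /= mul0r.
Qed.

(** * Koszul resolutions *)

Section SkewLinear.
Variables (E D : comNzRingType) (ev : {rmorphism E -> D}).
Variables (F : lmodType E) (M : lmodType D).

Definition skew_linear (f : F -> M) : Prop :=
  forall a x y, f (a *: x + y) = ev a *: f x + f y.

Variable f : F -> M.
Hypothesis fsl : skew_linear f.

Lemma skew_linear0 : f 0 = 0.
Proof.
by have := fsl (-1) 0 0; rewrite scaler0 addr0 rmorphN1 scaleN1r addNr.
Qed.

Lemma skew_linearD x y : f (x + y) = f x + f y.
Proof. by have := fsl 1 x y; rewrite rmorph1 !scale1r. Qed.

Lemma skew_linearZ a x : f (a *: x) = ev a *: f x.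
Proof. by have := fsl a x 0; rewrite !addr0 skew_linear0 addr0. Qed.

Lemma skew_linearN x : f (- x) = - f x.
Proof. by rewrite -scaleN1r skew_linearZ rmorphN1 scaleN1r. Qed.

End SkewLinear.

(* 0 -> F_n -> ... -> F_0 -> M -> 0 is a complex of E-modules, where E acts on
   the D-module M through [ev]. *)
Definition resolution (E D : comNzRingType) (ev : {rmorphism E -> D})
    (P : lmodType E -> Prop) (M : lmodType D) (n : nat) : Prop :=
  exists (F : nat -> lmodType E) (d : forall i, {linear F i.+1 -> F i})
         (eps : F 0%N -> M),
    [/\ forall i, P (F i),
        forall i, (n < i)%N -> forall x : F i, x = 0,
        skew_linear ev eps /\ (forall y, exists x, eps x = y),
        forall x, eps x = 0 <-> exists z, d 0%N z = x
      & forall i, exact_at (d i.+1) (d i)].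

Section Cone.
Variables (E D1 D : comNzRingType) (ev : {rmorphism E -> D1}).
Variables (h : {rmorphism D1 -> D}) (P : lmodType E -> Prop).
Hypothesis Pprod : forall F G : lmodType E, P F -> P G -> P (F * G)%type.

Section Differential.
Variables (F : nat -> lmodType E) (d : forall i, {linear F i.+1 -> F i}) (r :
  E).

(** The mapping cone of multiplication by r on F; the sign in [cone_d] makes consecutive maps
    compose to zero. *)
Definition cone i : lmodType E :=
  if i is j.+1 then (F j.+1 * F j)%type else F 0%N.

Definition cone_d i : cone i.+1 -> cone i :=
  match i return cone i.+1 -> cone i with
  | 0 => fun p => d 0%N p.1 + r *: p.2
  | j.+1 => fun p => (d j.+1 p.1 + r *: p.2, - d j p.2)
  end.

Fact cone_d_linear i : linear (@cone_d i).
Proof.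
have lin1 j a (p q : (F j.+1 * F j)%type) :
    d j (a *: p + q).1 + r *: (a *: p + q).2 =
    a *: (d j p.1 + r *: p.2) + (d j q.1 + r *: q.2).
  by rewrite /= linearP !scalerDr !scalerA [r * a]mulrC addrACA.
case: i => [|i] a p q; first exact: lin1.
congr pair; first exact: lin1.
by rewrite /= linearP opprD scalerN.
Qed.
HB.instance Definition _ i := GRing.isLinear.Build E (cone i.+1) (cone i) *:%R
  (@cone_d i) (@cone_d_linear i).

End Differential.

(** The cone has the homology of the two-term complex N -> N given by r, whose cokernel is M.
    Injectivity of r on N gives exactness in degree 1; in higher degrees exactness comes from that
    of F. *)
Lemma resolution_cone (N : lmodType D1) (M : lmodType D) (sigma : N -> M) r n :
  skew_linear h sigma -> (forall y, exists x, sigma x = y) ->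
  (forall x : N, ev r *: x = 0 -> x = 0) ->
  (forall x, sigma x = 0 <-> exists y, ev r *: y = x) ->
  resolution ev P N n -> resolution (h \o ev) P M n.+1.
Proof.
move=> sl ssurj rinj sker [F [d [eps [PF F0 [esl esurj] eker ex]]]].
have dL i x y : d i (x + r *: y) = d i x + r *: d i y.
  by rewrite linearD; congr (_ + _); apply: linearZ.
have dd i x : d i (d i.+1 x) = 0 by apply/ex; exists x.
have ed x : eps (d 0%N x) = 0 by apply/eker; exists x.
exists (cone F), (fun i => @cone_d F d r i), (sigma \o eps); split.
- by case=> [|i] /=; [apply: PF|apply: Pprod].
- by case=> // i; rewrite ltnS => ni [x y]; congr pair; apply: F0 => //;
  apply: ltnW.
- split=> [a x y|y]; first by rewrite /= esl sl.
  by have [x <-] := ssurj y; have [z <-] := esurj x; exists z.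
- move=> x; split=> [/sker[y]|[[a b] <-]].
    have [b <- rb] := esurj y.
    have /eker[a ab] : eps (x - r *: b) = 0.
      by rewrite (skew_linearD esl) (skew_linearN esl) (skew_linearZ esl) rb
        subrr.
    by exists (a, b); rewrite /= ab subrK.
  apply/sker; exists (eps b).
  by rewrite /= (skew_linearD esl) ed add0r (skew_linearZ esl).
- case=> [|i] [a b]; split=> /=.
  + move=> ab0; have /rinj : ev r *: eps b = 0.
      rewrite -(skew_linearZ esl) -[RHS](skew_linear0 esl) -ab0 (skew_linearD
        esl).
      by rewrite ed add0r.
    move=> /eker[c cb]; have /ex[z za] : d 0%N (a + r *: c) = 0.
      by rewrite dL cb.
    by exists (z, - c); congr pair; rewrite /= ?za ?scalerN ?addrK// linearN
      opprK.
  + by move=> [[z c] [<- <-]]; rewrite dL dd add0r scalerN subrr.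
  + move=> [ab0 /eqP]; rewrite oppr_eq0 => /eqP/ex[c cb].
    have /ex[z za] : d i.+1 (a + r *: c) = 0 by rewrite dL cb.
    by exists (z, - c); congr pair; rewrite /= ?za ?scalerN ?addrK// linearN
      opprK.
  + move=> [[z c] [<- <-]]; rewrite dL dd add0r scalerN subrr.
    by rewrite linearN dd oppr0 oppr0.
Qed.

End Cone.

Lemma mpoly_rmorph_eq (n : nat) (k E : comNzRingType)
    (f g : {rmorphism {mpoly k[n]} -> E}) :
  (forall c, f c%:MP = g c%:MP) -> (forall i, f 'X_i = g 'X_i) -> f =1 g.
Proof.
move=> fgC fgX p; rewrite (mpolyE p) !rmorph_sum; apply: eq_bigr => m _.
rewrite -mul_mpolyC !rmorphM /= fgC mpolyXE_id !rmorph_prod; congr (_ * _).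
by apply: eq_bigr => i _; rewrite !rmorphXn /= fgX.
Qed.

Section Muni.
Variables (n : nat) (k : comNzRingType).

Lemma muniX_widen (i : 'I_n) :
  muni ('X_(widen_ord (leqnSn n) i) : {mpoly k[n.+1]}) = ('X_i)%:P.
Proof.
rewrite /muni mmapX mmap1U; case: splitP => [j|j] /= ij.
  by congr ('X__)%:P; apply: val_inj.
by have := ltn_ord i; rewrite ij ltnNge leq_addr.
Qed.

Lemma muniX_max : muni ('X_ord_max : {mpoly k[n.+1]}) = 'X.
Proof.
rewrite /muni mmapX mmap1U; case: splitP => // j /= jn.
by have := ltn_ord j; rewrite -jn ltnn.
Qed.

Lemma mwidenXU (i : 'I_n) :
  mwiden ('X_i : {mpoly k[n]}) = 'X_(widen_ord (leqnSn n) i).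
Proof. by rewrite mwidenX mnmwiden1. Qed.

Lemma muni_bij : bijective (@muni n k).
Proof.
have [g gC gX] : exists2 g : {rmorphism {poly {mpoly k[n]}} -> {mpoly k[n.+1]}},
    forall c, g c%:P = mwiden c & g 'X = 'X_ord_max.
  exists (horner_eval ('X_ord_max : {mpoly k[n.+1]}) \o map_poly (@mwiden n k)).
    by move=> c; rewrite /= /horner_eval map_polyC hornerC.
  by rewrite /= /horner_eval map_polyX hornerX.
exists g.
  apply: (@mpoly_rmorph_eq _ _ _ (g \o @muni n k) idfun) => [c|i] /=.
    by rewrite muniC gC mwidenC.
  have [j ->|->] := unliftP ord_max i; last by rewrite muniX_max gX.
  have -> : lift ord_max j = widen_ord (leqnSn n) j.
    by apply: val_inj; rewrite /= /bump leqNgt ltn_ord.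
  by rewrite muniX_widen gC mwidenXU.
move=> p; elim/poly_ind: p => [|p c IHp]; first by rewrite !rmorph0.
rewrite !rmorphD !rmorphM /= IHp gX muniX_max gC; congr (_ + _).
apply: (@mpoly_rmorph_eq _ _ _ (@muni n k \o @mwiden n k) polyC) => [a|i] /=.
  by rewrite mwidenC muniC.
by rewrite mwidenXU muniX_widen.
Qed.

End Muni.

(** Polynomials in no variables are constants, so inverting one nonzero a_i serves every j. Hence
    every module is equational over k, which starts the Koszul construction. *)
Lemma mpoly0_regular (k : fieldType) p (a : 'I_p -> {mpoly k[0]}) :
  exists u : 'I_p -> {mpoly k[0]}, forall j, (\sum_i u i * a i) * a j = a j.
Proof.
have [/existsP[i ai]|/existsPn a0] := boolP [exists i, a i != 0]; last first.
  by exists (fun=> 0) => j; have /negPn/eqP -> := a0 j; rewrite mulr0.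
exists (fun j => if j == i then (((a i)@_0)^-1)%:MP else 0) => j.
have aE : a i = ((a i)@_0)%:MP.
  apply/mpolyP => m; rewrite mcoeffC; have -> : m = 0%MM by apply/mnmP => -[].
  by rewrite eqxx mulr1.
have ai0 : (a i)@_0 != 0 by apply: contra ai => /eqP ai0;
  rewrite aE ai0 mpolyC0.
rewrite (bigD1 i)//= eqxx big1 ?addr0 => [|l /negPf ->]; last by rewrite mul0r.
by rewrite {2}aE -mpolyCM mulVf// mpolyC1 mul1r.
Qed.

(* One variable at a time, 0 -> M[t] -> M[t] -> M -> 0 is exact, where the first
   map is the multiplication by t - x. *)
Lemma koszul_resolution (k : comNzRingType) (m i N : nat) (D : comNzRingType)
    (psi : {rmorphism {mpoly k[i]} -> D}) (M : lmodType D) (x : nat -> D) :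
  (i + m)%N = N -> equational psi M ->
  exists (E : comNzRingType) (ev : {rmorphism E -> D})
    (psi' : {rmorphism {mpoly k[N]} -> E}),
  [/\ resolution ev (equational psi') M m,
      forall a, exists b, ev b = a,
      forall c, ev (psi' c%:MP) = psi c%:MP,
      forall (l : 'I_N) (l' : 'I_i), l = l' :> nat -> ev (psi' 'X_l) = psi 'X_l'
    & forall l : 'I_N, (i <= l)%N -> ev (psi' 'X_l) = x l].
Proof.
elim: m i D psi M x => [|m IHm] i D psi M x.
  rewrite addn0 => <- eqM; exists D, idfun, psi; split=> //; last first.
  - by move=> l; rewrite leqNgt ltn_ord.
  - by move=> l l' /val_inj ->.
  - by move=> a; exists a.
  pose F (j : nat) : lmodType D := if j is _.+1 then 'rV[D]_0 else M.
  exists F, (fun j => \0 : {linear F j.+1 -> F j}), id; split.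
  + case=> // j; apply: equational_trivial => y.
    exact: thinmx0.
  + by case=> // j _ y; apply: thinmx0.
  + by split=> // y; exists y.
  + move=> y; split=> [->|[z <-]//].
    by exists 0.
  + move=> j y; split=> [_|_]; last by rewrite (thinmx0 y).
    by exists 0; rewrite (thinmx0 y); apply: thinmx0.
rewrite addnS -addSn => iN eqM.
(* The last of the i + 1 variables becomes the t of D[t]; the others act on coefficients through
   [psi]. *)
pose psi1 : {rmorphism {mpoly k[i.+1]} -> {poly D}} := map_poly psi \o @muni i
  k.
have eqM1 : equational psi1 (polymod M).
  by apply: equational_comp; [apply: muni_bij|apply: equational_polymod].
have [E [ev [psi' [res evs evC evX evx]]]] :=
  IHm i.+1 {poly D} psi1 (polymod M) (fun l => (x l)%:P) iN eqM1.
exists E, (horner_eval (x i) \o ev), psi'.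
have hC a : horner_eval (x i) a%:P = a by rewrite /horner_eval hornerC.
split.
(* The resolution of M[t] consists of E-modules, so t - x_i is lifted along [ev] before its cone is
   formed. This is the reason for carrying the surjectivity of [ev] through the induction. *)
- have [r rE] := evs ('X - (x i)%:P).
  apply: (@resolution_cone _ _ _ ev (horner_eval (x i)) _ _ (polymod M) M
    (polymod_eval (x i)) r) => //.
  + exact: equational_prod.
  + by move=> p f g; rewrite polymod_evalD polymod_evalZ.
  + by move=> y; exists (polymodC y); rewrite polymod_evalC.
  + by move=> f; rewrite rE; apply: polymod_XsubC_inj.
  + by move=> f; rewrite rE; apply: polymod_eval_eq0.
- by move=> a; have [b bE] := evs a%:P; exists b; rewrite /= bE.
- by move=> c; rewrite /= evC /psi1 /= muniC map_polyC.
- move=> l l' ll'; rewrite /= (evX _ (widen_ord (leqnSn i) l'))//.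
  by rewrite /psi1 /= muniX_widen map_polyC.
- move=> l; rewrite leq_eqVlt => /predU1P[il|il]; last by rewrite /= evx.
  rewrite /= (evX _ ord_max) ?il// /psi1 /= muniX_max map_polyX.
  by rewrite /horner_eval hornerX -il.
Qed.

(** * Modules of fractions *)

(* The localization at T of modules over an S-algebra E, as R-modules: by
   [fracE], an element of R acts, through [pi], as a fraction with denominator
   in T. *)
Section ModuleFractions.
Variables (S R A E : comNzRingType) (T : {pred S}).
Variables (iota : {rmorphism S -> A}) (pi : {rmorphism R -> A}).
Variables (psi : {rmorphism S -> E}).
Hypotheses (T1 : 1 \in T) (TM : forall s t, s \in T -> t \in T -> s * t \in T).
Hypothesis iota_inj : injective iota.
Hypothesis fracE : forall r, exists a t, t \in T /\ iota t * pi r = iota a.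

Definition denom := {s : S | s \in T}.
Definition Denom a (aT : a \in T) : denom := exist (fun s => s \in T) a aT.
Lemma denomP (s : denom) : sval s \in T. Proof. by case: s. Qed.
Definition denom1 : denom := Denom T1.
Definition denomM (s t : denom) : denom :=
  Denom (TM (svalP s) (svalP t)).

Section Construction.
Variable F : lmodType E.
Implicit Types (f g : F) (s t u : denom).

Definition act (a : S) f := psi a *: f.

Lemma actA a b f : act a (act b f) = act (a * b) f.
Proof. by rewrite /act scalerA rmorphM. Qed.
Lemma actDr a f g : act a (f + g) = act a f + act a g.
Proof. exact: scalerDr. Qed.
Lemma actDl a b f : act (a + b) f = act a f + act b f.
Proof. by rewrite /act rmorphD scalerDl. Qed.
Lemma act_r0 a : act a 0 = 0. Proof. exact: scaler0. Qed.
Lemma actN a f : act a (- f) = - act a f.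
Proof. exact: scalerN. Qed.

Definition frac_eq (x y : F * denom) : Prop :=
  exists u, act (sval u * sval y.2) x.1 = act (sval u * sval x.2) y.1.

Definition frac_rel : rel (F * denom) := fun x y => `[< frac_eq x y >].

Lemma frac_rel_equiv : equiv_class_of frac_rel.
Proof.
split=> [x|x y|y x z].
- by apply/asboolP; exists denom1.
- by apply/asboolP/asboolP => -[u xy]; exists u.
- move=> /asboolP[u xy] /asboolP[v yz]; apply/asboolP.
  exists (denomM (denomM u v) (y.2)) => /=.
  have -> : sval u * sval v * sval y.2 * sval z.2 =
            (sval v * sval z.2) * (sval u * sval y.2) by ring.
  rewrite -[in LHS]actA xy actA [_ * (sval u * _)]mulrC -[in LHS]actA yz actA;
    congr act.
  ring.
Qed.

Canonical frac_equiv := EquivRelPack frac_rel_equiv.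
Canonical frac_encModRel := defaultEncModRel frac_rel.

(* The scalar action of R depends on [fracE] and [iota_inj], so the type has to
   mention them. *)
Definition modfrac := let _ := (iota_inj, fracE) in {eq_quot frac_rel}.
HB.instance Definition _ : EqQuotient _ frac_rel modfrac :=
  EqQuotient.on modfrac.
HB.instance Definition _ := Choice.on modfrac.

Definition mfrac f s : modfrac := let p := (f, s) in \pi p.

Lemma mfracP f s g t : mfrac f s = mfrac g t <->
  exists u, act (sval u * sval t) f = act (sval u * sval s) g.
Proof.
split=> [/eqmodP/asboolP//|st].
exact/eqmodP/asboolP.
Qed.

Lemma mfracW (Q : modfrac -> Prop) : (forall f s, Q (mfrac f s)) -> forall x, Q
  x.
Proof. by move=> Qs x; rewrite -[x]reprK; case: (repr x). Qed.

Lemma mfrac_surj x : exists f s, x = mfrac f s.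
Proof. by elim/mfracW: x => f s; exists f, s. Qed.

Lemma mfrac_act u f s : mfrac (act (sval u) f) (denomM u s) = mfrac f s.
Proof.
by apply/mfracP; exists denom1; rewrite actA /=; congr act; ring.
Qed.

Lemma denomMC s t : denomM s t = denomM t s.
Proof. by apply: val_inj; rewrite /= mulrC. Qed.

Lemma denomMA s t u : denomM s (denomM t u) = denomM (denomM s t) u.
Proof. by apply: val_inj; rewrite /= mulrA. Qed.

Lemma mfrac_act_r u f s : mfrac (act (sval u) f) (denomM s u) = mfrac f s.
Proof. by rewrite denomMC mfrac_act. Qed.

Lemma mfrac_common (x y : modfrac) :
  exists f g s, x = mfrac f s /\ y = mfrac g s.
Proof.
elim/mfracW: x => f s; elim/mfracW: y => g t.
exists (act (sval t) f), (act (sval s) g), (denomM s t).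
by rewrite mfrac_act mfrac_act_r.
Qed.

Definition mfrac_add (x y : modfrac) : modfrac :=
  let p := repr x in let q : F * denom := repr y in
  mfrac (act (sval q.2) p.1 + act (sval p.2) q.1) (denomM p.2 q.2).

Definition mfrac_opp (x : modfrac) : modfrac :=
  let p := repr x in mfrac (- p.1) p.2.

Definition num (r : R) : S := sval (cid (fracE r)).
Fact den_subproof (r : R) : exists t : S, t \in T /\ iota t * pi r = iota (num
  r).
Proof. by rewrite /num; case: cid. Qed.
Definition den (r : R) : denom :=
  Denom (svalP (cid (den_subproof r))).1.
Lemma denE r : iota (sval (den r)) * pi r = iota (num r).
Proof. by rewrite /den; case: cid => t []. Qed.

Definition mfrac_scale (r : R) (x : modfrac) : modfrac :=
  let p := repr x in mfrac (act (num r) p.1) (denomM (den r) p.2).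

Lemma repr_mfrac f s : exists u,
  act (sval u * sval s) (repr (mfrac f s)).1 =
  act (sval u * sval (repr (mfrac f s)).2) f.
Proof. by apply/mfracP; rewrite -[RHS]reprK; case: (repr (mfrac f s)). Qed.

Lemma mfrac_addE f g s : mfrac_add (mfrac f s) (mfrac g s) = mfrac (f + g) s.
Proof.
have [u fu] := repr_mfrac f s; have [v gv] := repr_mfrac g s.
rewrite /mfrac_add; move: (repr _) fu => -[f' s'] /= fu.
move: (repr _) gv => -[g' t'] /= gv.
apply/mfracP; exists (denomM u v); rewrite !actDr !actA /=; congr (_ + _).
  rewrite (_ : _ * sval t' = sval v * sval t' * (sval u * sval s));
    last by ring.
  by rewrite -[in LHS]actA fu actA; congr act; ring.
rewrite (_ : _ * sval s' = sval u * sval s' * (sval v * sval s)); last by ring.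
by rewrite -[in LHS]actA gv actA; congr act; ring.
Qed.

Lemma mfrac_oppE f s : mfrac_opp (mfrac f s) = mfrac (- f) s.
Proof.
have [u fu] := repr_mfrac f s.
rewrite /mfrac_opp; move: (repr _) fu => -[f' s'] /= fu.
by apply/mfracP; exists u; rewrite !actN fu.
Qed.

(** The choice made in [num] and [den] is immaterial: two fractions for the same [pi r] satisfy the
    cross-multiplied identity in S, because [iota] is injective. *)
Lemma mfrac_scaleE r a t f s : iota (sval t) * pi r = iota a ->
  mfrac_scale r (mfrac f s) = mfrac (act a f) (denomM t s).
Proof.
move=> ra; have [u fu] := repr_mfrac f s.
rewrite /mfrac_scale; move: (repr _) fu => -[f' s'] /= fu.
have E1 : num r * sval t = a * sval (den r).
  by apply: iota_inj; rewrite !rmorphM -denE -ra; ring.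
apply/mfracP; exists u; rewrite !actA /=.
rewrite (_ : _ * num r = num r * sval t * (sval u * sval s)); last by ring.
by rewrite -[in LHS]actA fu actA E1; congr act; ring.
Qed.

Fact mfrac_addA : associative mfrac_add.
Proof.
move=> x y z; elim/mfracW: z => h t; have [f [g [s [-> ->]]]] := mfrac_common x
  y.
rewrite -(mfrac_act s h) -(mfrac_act t f) -(mfrac_act t g) (denomMC s).
by rewrite !mfrac_addE addrA.
Qed.

Fact mfrac_addC : commutative mfrac_add.
Proof.
by move=> x y; have [f [g [s [-> ->]]]] := mfrac_common x y;
  rewrite !mfrac_addE addrC. Qed.

Lemma mfrac_num0 s t : mfrac 0 s = mfrac 0 t.
Proof. by apply/mfracP; exists denom1; rewrite !act_r0. Qed.

Fact mfrac_add0 : left_id (mfrac 0 denom1) mfrac_add.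
Proof. by elim/mfracW => f s; rewrite (mfrac_num0 _ s) mfrac_addE add0r. Qed.

Fact mfrac_addN : left_inverse (mfrac 0 denom1) mfrac_opp mfrac_add.
Proof.
by elim/mfracW => f s; rewrite mfrac_oppE mfrac_addE addNr; apply: mfrac_num0.
Qed.

HB.instance Definition _ := GRing.isZmodule.Build modfrac
  mfrac_addA mfrac_addC mfrac_add0 mfrac_addN.

Fact mfrac_scaleA r r' x : mfrac_scale r (mfrac_scale r' x) = mfrac_scale (r *
  r') x.
Proof.
elim/mfracW: x => f s; have [a [t0 [tT ra]]] := fracE r.
have [a' [t0' [tT' ra']]] := fracE r'.
pose t := Denom tT.
pose t' := Denom tT'.
rewrite (mfrac_scaleE (t := t') _ _ ra') (mfrac_scaleE (t := t) _ _ ra).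
rewrite (mfrac_scaleE (t := denomM t t') (a := a * a')); last first.
  by rewrite /= !rmorphM -ra -ra'; ring.
by rewrite actA denomMA.
Qed.

Fact mfrac_scale1 : left_id 1 mfrac_scale.
Proof.
elim/mfracW => f s; rewrite (mfrac_scaleE (t := denom1) (a := 1)).
  exact: (mfrac_act denom1).
by rewrite !rmorph1 mulr1.
Qed.

Fact mfrac_scaleDr : right_distributive mfrac_scale +%R.
Proof.
move=> r x y; have [f [g [s [-> ->]]]] := mfrac_common x y;
  rewrite [X in mfrac_scale _ X]mfrac_addE.
have [a [t0 [tT ra]]] := fracE r.
pose t := Denom tT.
rewrite !(mfrac_scaleE (t := t) _ _ ra) [RHS]mfrac_addE.
by rewrite actDr.
Qed.

Fact mfrac_scaleDl x : {morph mfrac_scale^~ x : r r' / r + r'}.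
Proof.
elim/mfracW: x => f s r r'; have [a [t0 [tT ra]]] := fracE r.
have [a' [t0' [tT' ra']]] := fracE r'.
pose t := Denom tT.
pose t' := Denom tT'.
rewrite (mfrac_scaleE (t := t') _ _ ra') (mfrac_scaleE (t := t) _ _ ra).
rewrite (mfrac_scaleE (t := denomM t t') (a := sval t' * a + sval t * a')).
  rewrite -(mfrac_act t' (act a f)) -(mfrac_act t (act a' f)).
  rewrite [denomM t (denomM _ _)]denomMA [denomM t' (denomM _ _)]denomMA.
  by rewrite (denomMC t') [RHS]mfrac_addE !actA actDl.
by rewrite rmorphD !rmorphM rmorphD /= !rmorphM -ra -ra' /=; ring.
Qed.

HB.instance Definition _ := GRing.Zmodule_isLmodule.Build R modfrac
  mfrac_scaleA mfrac_scale1 mfrac_scaleDr mfrac_scaleDl.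

Lemma mfracD f g s : mfrac (f + g) s = mfrac f s + mfrac g s.
Proof. by rewrite [RHS]mfrac_addE. Qed.

Lemma mfrac0 s : mfrac 0 s = 0.
Proof. exact: mfrac_num0. Qed.

Lemma mfrac_sum (I : finType) (f : I -> F) s :
  mfrac (\sum_i f i) s = \sum_i mfrac (f i) s.
Proof. by apply: (big_morph (mfrac^~ s)); [move=> x y;
  apply: mfracD|apply: mfrac0]. Qed.

Lemma mfracZ r a t f s : iota (sval t) * pi r = iota a ->
  r *: mfrac f s = mfrac (act a f) (denomM t s).
Proof. exact: mfrac_scaleE. Qed.

Lemma mfracZ1 r a f s : pi r = iota a -> r *: mfrac f s = mfrac (act a f) s.
Proof.
move=> ra; rewrite (mfracZ (t := denom1) (a := a));
  last by rewrite rmorph1 mul1r.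
by congr mfrac; apply: val_inj; rewrite /= mul1r.
Qed.

Lemma mfrac_eq0 f s : mfrac f s = 0 <-> exists u : denom, act (sval u) f = 0.
Proof.
rewrite -(mfrac0 s) mfracP; split=> -[u uf].
  by exists (denomM u s); rewrite uf act_r0.
by exists u; rewrite act_r0 mulrC -actA uf act_r0.
Qed.

End Construction.

Section Map.
Variables (F G : lmodType E) (d : {linear F -> G}).

Definition modfrac_map (x : modfrac F) : modfrac G :=
  let p := repr x in mfrac (d p.1) p.2.

Lemma act_linear a f : d (act a f) = act a (d f).
Proof. exact: linearZ. Qed.

Lemma modfrac_mapE f s : modfrac_map (mfrac f s) = mfrac (d f) s.
Proof.
have [u fu] := repr_mfrac f s.
rewrite /modfrac_map; move: (repr _) fu => -[f' s'] /= fu.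
by apply/mfracP; exists u; rewrite -!act_linear fu.
Qed.

Fact modfrac_map_linear : linear modfrac_map.
Proof.
move=> r x y; have [f [g [s [-> ->]]]] := mfrac_common x y.
have [a [t0 [tT ra]]] := fracE r.
pose t := Denom tT.
rewrite (mfracZ (t := t) _ _ ra) -(mfrac_act t g) -mfracD !modfrac_mapE.
by rewrite linearD !act_linear mfracD mfrac_act (mfracZ (t := t) _ _ ra).
Qed.
HB.instance Definition _ := GRing.isLinear.Build R (modfrac F) (modfrac G) *:%R
  modfrac_map modfrac_map_linear.

End Map.

Lemma modfrac_exact (F G H : lmodType E) (d : {linear F -> G}) (d' : {linear G
  -> H}) :
  exact_at d d' -> exact_at (modfrac_map d) (modfrac_map d').
Proof.
move=> ex y; split=> [|[x <-]].
  elim/mfracW: y => g s; rewrite modfrac_mapE => /mfrac_eq0[u].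
  rewrite -act_linear => /ex[f fu].
  by exists (mfrac f (denomM u s)); rewrite modfrac_mapE fu mfrac_act.
elim/mfracW: x => f s; rewrite !modfrac_mapE.
by have -> : d' (d f) = 0; [apply/ex; exists f|apply: mfrac0].
Qed.

Section Augmentation.
Variables (ev : {rmorphism E -> R}) (F : lmodType E) (M : lmodType R).
Variable eps : F -> M.
Hypothesis eps_sl : skew_linear ev eps.
Hypothesis ev_psi : forall a, pi (ev (psi a)) = iota a.
Hypothesis denV : forall t, t \in T -> exists r, iota t * pi r = 1.
Hypothesis pi0M : forall r (m : M), pi r = 0 -> r *: m = 0.

Let rho a := ev (psi a).
Let inv (t : denom) : R := sval (cid (denV (svalP t))).

Lemma eps_act a f : eps (act a f) = rho a *: eps f.
Proof. exact: skew_linearZ. Qed.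

(** [inv t] inverts the denominator only modulo the kernel of [pi], and this kernel kills M. *)
Lemma rhoMV (t : denom) (m : M) : rho (sval t) *: (inv t *: m) = m.
Proof.
apply/eqP; rewrite -subr_eq0 -{2}(scale1r m) scalerA -scalerBl; apply/eqP/pi0M.
rewrite rmorphB rmorphM rmorph1 ev_psi /inv; case: cid => r /= ->.
by rewrite subrr.
Qed.

Lemma rho_inj (t : denom) (m m' : M) :
  rho (sval t) *: m = rho (sval t) *: m' -> m = m'.
Proof.
by move=> mm; rewrite -(rhoMV t m) -(rhoMV t m') !scalerA ![_ * inv t]mulrC
  -!scalerA mm.
Qed.

Definition modfrac_eps (x : modfrac F) : M :=
  let p := repr x in inv p.2 *: eps p.1.

Lemma modfrac_epsE f s : rho (sval s) *: modfrac_eps (mfrac f s) = eps f.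
Proof.
have [u fu] := repr_mfrac f s.
rewrite /modfrac_eps; move: (repr _) fu => -[f' s'] /= fu.
apply: (rho_inj (t := denomM u s')) => /=.
have : eps (act (sval u * sval s) f') = eps (act (sval u * sval s') f) by
  rewrite fu.
rewrite !eps_act => <-.
have rhoC m : rho (sval u * sval s') *: (rho (sval s) *: m) =
              rho (sval u * sval s) *: (rho (sval s') *: m).
  by rewrite !scalerA /rho -!rmorphM; congr (ev (psi _) *: _); ring.
by rewrite rhoC rhoMV.
Qed.

Fact modfrac_eps_linear : linear modfrac_eps.
Proof.
move=> r x y; have [f [g [s [-> ->]]]] := mfrac_common x y.
have [a [t0 [tT ra]]] := fracE r.
pose t := Denom tT.
apply: (rho_inj (t := denomM t s)).
rewrite (mfracZ (t := t) _ _ ra) -{1}(mfrac_act t g) -mfracD modfrac_epsE.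
rewrite (skew_linearD eps_sl) !eps_act -!(modfrac_epsE _ s) scalerDr !scalerA.
have rhoM b c : rho (b * c) = rho b * rho c by rewrite /rho !rmorphM.
rewrite rhoM /=; congr (_ + _).
apply/eqP; rewrite -subr_eq0 -scalerBl; apply/eqP/pi0M.
by rewrite rmorphB !rmorphM /= !ev_psi -ra /=; ring.
Qed.
#[local] HB.instance Definition _ := GRing.isLinear.Build R (modfrac F) M *:%R
  modfrac_eps modfrac_eps_linear.

Lemma modfrac_eps_surj :
  (forall y, exists x, eps x = y) -> forall y, exists x, modfrac_eps x = y.
Proof.
move=> es y; have [f <-] := es y; exists (mfrac f denom1).
by rewrite -[RHS](modfrac_epsE f denom1) /rho /= !rmorph1 scale1r.
Qed.

Lemma modfrac_eps_exact (G : lmodType E) (d : {linear G -> F}) :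
  (forall x, eps x = 0 <-> exists z, d z = x) -> exact_at (modfrac_map d)
    modfrac_eps.
Proof.
move=> ex y; split=> [|[x <-]].
  elim/mfracW: y => g s g0; have /ex[f fg] : eps g = 0.
    by rewrite -(modfrac_epsE g s) g0 scaler0.
  by exists (mfrac f s); rewrite modfrac_mapE fg.
elim/mfracW: x => f s; rewrite modfrac_mapE; apply: (rho_inj (t := s)).
by rewrite modfrac_epsE scaler0; apply/ex; exists f.
Qed.

Lemma modfrac_augmentation : exists g : {linear modfrac F -> M},
  ((forall y, exists x, eps x = y) -> forall y, exists x, g x = y) /\
  forall (G : lmodType E) (d : {linear G -> F}),
    (forall x, eps x = 0 <-> exists z, d z = x) -> exact_at (modfrac_map d) g.
Proof.
exists modfrac_eps; split; first exact: modfrac_eps_surj.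
exact: modfrac_eps_exact.
Qed.

End Augmentation.
End ModuleFractions.

(** * Flatness modulo an ideal generated by idempotents *)

Section ModfracEquational.
Variables (S R A E : comNzRingType) (T : {pred S}).
Variables (iota : {rmorphism S -> A}) (pi : {rmorphism R -> A}).
Variables (psi : {rmorphism S -> E}).
Hypotheses (T1 : 1 \in T) (TM : forall s t, s \in T -> t \in T -> s * t \in T).
Hypothesis iota_inj : injective iota.
Hypothesis fracE : forall r, exists a t, t \in T /\ iota t * pi r = iota a.
Hypothesis denV : forall t, t \in T -> exists r, iota t * pi r = 1.
Hypothesis pi_lift : forall a, exists r, pi r = iota a.
Variable F : lmodType E.
Local Notation modfrac := (modfrac psi T1 TM iota_inj fracE F).
Local Notation mfrac := (@mfrac _ _ _ _ _ _ _ psi T1 TM iota_inj fracE F).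

Lemma prod_denom (I : finType) (P : pred I) (s : I -> S) :
  (forall i, s i \in T) -> \prod_(i | P i) s i \in T.
Proof. by move=> sT; apply: (big_ind (fun a => a \in T)) => //. Qed.

Lemma mfrac_common_denom p (m : 'I_p -> modfrac) :
  exists f s, forall i, m i = mfrac (f i) s.
Proof.
have mE i : exists fs : F * denom T, m i = mfrac fs.1 fs.2.
  by case: (mfrac_surj (m i)) => f [s ->]; exists (f, s).
have [fs {}mE] := choice mE.
pose s i : S := sval (fs i).2.
have sT i : s i \in T := denomP _.
exists (fun i => act psi (\prod_(j | j != i) s j) (fs i).1).
exists (Denom (prod_denom predT sT)) => i.
rewrite mE -(mfrac_act _ _ _ _ _ (Denom (prod_denom (fun j => j != i) sT))).
congr mfrac; apply: val_inj; rewrite /= mulrC [RHS](bigD1 i)//=.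
Qed.

Lemma frac_common_denom p (r : 'I_p -> R) :
  exists (a : 'I_p -> S) (t : denom T), forall i, iota (sval t) * pi (r i) =
    iota (a i).
Proof.
have rE i : exists x : S * denom T, iota (sval x.2) * pi (r i) = iota x.1.
  by have [a [t [tT rE]]] := fracE (r i); exists (a, Denom tT).
have [x {}rE] := choice rE.
pose s i : S := sval (x i).2.
have sT i : s i \in T := denomP _.
exists (fun i => \prod_(j | j != i) s j * (x i).1).
exists (Denom (prod_denom predT sT)) => i.
by rewrite /= (bigD1 i)//= !rmorphM -rE /s; ring.
Qed.

(** Clearing denominators turns the relation into one over S in F, where the hypothesis applies. The
    resulting C kills r only modulo the kernel of [pi]: this is flatness over A, and
    [equational_modulo] supplies what is missing over R. *)
Lemma modfrac_equational : equational psi F ->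
  forall p (r : 'I_p -> R) (m : 'I_p -> modfrac), \sum_i r i *: m i = 0 ->
  exists q (C : 'I_p -> 'I_q -> R) (y : 'I_q -> modfrac),
    (forall l, pi (\sum_i r i * C i l) = 0) /\
    forall i, m i = \sum_l C i l *: y l.
Proof.
move=> eqF p r m rm0; have [f [s mE]] := mfrac_common_denom m.
have [a [t rE]] := frac_common_denom r.
have /mfrac_eq0[u] : mfrac (\sum_i act psi (a i) (f i)) (denomM TM t s) = 0.
  rewrite mfrac_sum -[RHS]rm0; apply: eq_bigr => i _.
  by rewrite mE (mfracZ _ _ _ _ _ _ _ (rE i)).
have actE : act psi (sval u) (\sum_i act psi (a i) (f i)) =
            \sum_i psi (sval u * a i) *: f i.
  rewrite /act scaler_sumr; apply: eq_bigr => i _.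
  by rewrite scalerA rmorphM.
rewrite actE => uaf.
have [|q [C [y [uaC fE]]]] := equational_fin eqF (J := unit)
    (a := fun _ i => sval u * a i) (m := f); first by [].
have [lift liftE] := choice pi_lift.
exists q, (fun i l => lift (C i l)), (fun l => mfrac (y l) s); split=> [l|i].
  (* The relation was multiplied by the denominator u t, which becomes a unit in A and can be
     cancelled. *)
  have [v vE] := denV (denomP (denomM TM u t)).
  rewrite -[LHS]mul1r -vE [_ * pi v]mulrC -mulrA rmorph_sum mulr_sumr.
  rewrite (_ : \sum_i _ = iota (\sum_i sval u * a i * C i l)).
    by rewrite (uaC tt) rmorph0 mulr0.
  rewrite rmorph_sum; apply: eq_bigr => i _.
  by rewrite /= !rmorphM liftE -rE; ring.
rewrite mE fE mfrac_sum; apply: eq_bigr => l _.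
by rewrite (mfracZ1 _ _ _ _ _ _ _ (liftE _)).
Qed.

End ModfracEquational.

Section FlatModulo.
Variables (R : comNzRingType) (e : nat -> R).

(* When the e_n are increasing idempotents generating the ideal I, [null r] is
   r \in I and [null_mod m] is m \in I M. *)
Definition null (r : R) : Prop :=
  exists N, forall n, (N <= n)%N -> e n * r = r.
Definition null_mod (M : lmodType R) (m : M) : Prop :=
  exists N, forall n, (N <= n)%N -> e n *: m = m.

(* On e_n R, the ideal generated by the r_j is generated by an idempotent. *)
Hypothesis regular_e : forall n p (r : 'I_p -> R), exists u : 'I_p -> R,
  forall j, (\sum_i u i * r i) * (r j * e n) = r j * e n.

Lemma eventually_fin (I : finType) (P : I -> nat -> Prop) :
  (forall i, exists N, forall n, (N <= n)%N -> P i n) ->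
  exists N, forall n, (N <= n)%N -> forall i, P i n.
Proof.
move=> PN; have [N {}PN] := choice PN; exists (\max_i N i) => n nN i.
by apply: PN; apply: leq_trans nN; apply: leq_bigmax.
Qed.

(* A relation is split by 1 - e_n and e_n for n large: the first part is trivial
   by assumption, the second because e_n R is von Neumann regular. *)
Lemma equational_modulo (P : lmodType R) :
  (forall p (r : 'I_p -> R) (m : 'I_p -> P), \sum_i r i *: m i = 0 ->
   exists q (C : 'I_p -> 'I_q -> R) (y : 'I_q -> P),
     (forall l, null (\sum_i r i * C i l)) /\
     forall i, null_mod (m i - \sum_l C i l *: y l)) ->
  equational (idfun : {rmorphism R -> R}) P.
Proof.
move=> H; apply: equationalI => p r m rm0.
have [q [C [y [/eventually_fin[N1 rC] /eventually_fin[N2 mE]]]]] := H p r m rm0.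
pose n := maxn N1 N2; have {}rC := rC n (leq_maxl _ _).
have {}mE := mE n (leq_maxr _ _); have [u uE] := regular_e n r.
(* The first block is C cut down by 1 - e_n; the second is the matrix of [equational_regular] cut
   down by e_n, with the m_j themselves as generators. *)
exists ('I_q + 'I_p)%type.
exists (fun i x => match x with
  | inl l => (1 - e n) * C i l
  | inr j => e n * ((i == j)%:R - u i * r j)
  end).
exists (fun x => match x with inl l => y l | inr j => m j end).
split=> [[l|j]|i].
- under eq_bigr => i _ do rewrite mulrCA.
  by rewrite -mulr_sumr mulrBl mul1r rC subrr.
- under eq_bigr => i _ do rewrite mulrCA mulrBr.
  rewrite -mulr_sumr sumrB [X in X - _](bigD1 j)//= eqxx mulr1 big1 => [|i
    /negPf ij].
    rewrite addr0 mulrBr mulrC -uE -[X in _ - X]mulrC [in X in _ - X]mulr_suml.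
    apply/eqP; rewrite subr_eq0 mulr_suml; apply/eqP; apply: eq_bigr => i _.
    ring.
  by rewrite ij mulr0.
- rewrite big_sumType /=.
  under eq_bigr do rewrite -scalerA.
  rewrite -scaler_sumr scalerBl scale1r.
  under [X in _ + X]eq_bigr => j _ do rewrite -scalerA scalerBl -scalerA.
  rewrite -scaler_sumr sumrB -scaler_sumr rm0 scaler0 subr0.
  rewrite (bigD1 i)//= eqxx scale1r [\sum_(j < p | _) _]big1 ?addr0 => [|j ji];
    last first.
    by rewrite eq_sym (negPf ji) scale0r.
  rewrite -addrA [- _ + _]addrC -scalerBr mE.
  by rewrite addrC subrK.
Qed.

Section NullSubmodule.
Variable M : lmodType R.

Definition null_pred : {pred M} := fun m => `[< null_mod m >].

Fact null_submod_closed : submod_closed null_pred.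
Proof.
split=> [|a m m' /asboolP[N mN] /asboolP[N' mN']]; apply/asboolP.
  by exists 0%N => n _; rewrite scaler0.
exists (maxn N N') => n; rewrite geq_max => /andP[Nn N'n].
by rewrite scalerDr mN'// scalerA mulrC -scalerA mN.
Qed.
HB.instance Definition _ := GRing.isSubmodClosed.Build R M null_pred
  null_submod_closed.

End NullSubmodule.

End FlatModulo.

(** * Existence of short flat resolutions *)

Section Pullback.
Variables (R : comNzRingType) (V W Q : lmodType R).
Variables (f : {linear V -> Q}) (g : {linear W -> Q}).

Definition pullback_pred : {pred (V * W)} := fun x => f x.1 == g x.2.

Fact pullback_submod_closed : submod_closed pullback_pred.
Proof.
split=> [|a x y /eqP xe /eqP ye]; rewrite unfold_in /pullback_pred /=.
  by rewrite !linear0.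
by rewrite !linearP xe ye.
Qed.
HB.instance Definition _ := GRing.isSubmodClosed.Build R (V * W)%type
  pullback_pred pullback_submod_closed.

Definition pullback := submodule pullback_pred.

Lemma pullback_sub x y : f x = g y -> (x, y) \in pullback_pred.
Proof. by move=> fg; apply/eqP. Qed.

Definition pullback_fst (x : pullback) : V := (val x).1.
Definition pullback_snd (x : pullback) : W := (val x).2.

Fact pullback_fst_linear : linear pullback_fst. Proof. by []. Qed.
HB.instance Definition _ := GRing.isLinear.Build R pullback V *:%R
  pullback_fst pullback_fst_linear.

Fact pullback_snd_linear : linear pullback_snd. Proof. by []. Qed.
HB.instance Definition _ := GRing.isLinear.Build R pullback W *:%R
  pullback_snd pullback_snd_linear.

Lemma pullbackP (x : pullback) : f (pullback_fst x) = g (pullback_snd x).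
Proof. exact/eqP/(submodule_valP x). Qed.

Lemma pullback_eq x y :
  pullback_fst x = pullback_fst y -> pullback_snd x = pullback_snd y -> x = y.
Proof.
move=> xy1 xy2; apply: val_inj.
by rewrite [LHS]surjective_pairing [RHS]surjective_pairing; congr pair.
Qed.

End Pullback.

Section UpperBound.
Variables (k : comNzRingType) (n : nat) (R A : comNzRingType).
Local Notation S := {mpoly k[n]}.
Variables (T : {pred S}) (iota : {rmorphism S -> A}) (pi : {rmorphism R -> A}).
Variables (e : nat -> R) (psi : {rmorphism {mpoly k[0]} -> R}) (x : nat -> R).
Hypotheses (T1 : 1 \in T) (TM : forall s t, s \in T -> t \in T -> s * t \in T).
Hypothesis iota_inj : injective iota.
Hypothesis fracE : forall r, exists a t, t \in T /\ iota t * pi r = iota a.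
Hypothesis denV : forall t, t \in T -> exists r, iota t * pi r = 1.
Hypothesis pi0 : forall r, pi r = 0 -> null e r.
Hypothesis piC : forall c, pi (psi c%:MP) = iota c%:MP.
Hypothesis piX : forall i : 'I_n, pi (x i) = iota 'X_i.
Hypothesis regular_e : forall N p (r : 'I_p -> R), exists u : 'I_p -> R,
  forall j, (\sum_i u i * r i) * (r j * e N) = r j * e N.
Hypothesis base_equational : forall M : lmodType R, equational psi M.

Theorem has_flat_resolution_upper (M : lmodType R) : has_flat_resolution M n.
Proof.
pose U := null_pred e (M := M).
pose q : {linear M -> quotmod U} := @quotpi R M U.
have q0 m : q m = 0 <-> null_mod e m.
  by rewrite quotpi_eq0; split=> [/asboolP|/asboolP].
have qsurj m : exists m', q m' = m by apply: quotpi_surj.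
have pi0M r (m : quotmod U) : pi r = 0 -> r *: m = 0.
  move=> /pi0[N rN]; have [m' <-] := qsurj m.
  rewrite -linearZ; apply/q0; exists N => i Ni.
  by rewrite scalerA rN.
have [E [ev [psi' [[F [d [eps [PF F0 [esl esurj] eker ex]]]] evs evC _ evX]]]]
  :=
  @koszul_resolution k n 0 n R psi _ x (add0n n) (@base_equational (quotmod U)).
have ev_psi a : pi (ev (psi' a)) = iota a.
  apply: (@mpoly_rmorph_eq _ _ _ (pi \o (ev \o psi')) iota) => [c|i] /=.
    by rewrite evC piC.
  by rewrite evX.
have lift a : exists r, pi r = iota a by exists (ev (psi' a)).
pose L i := modfrac psi' T1 TM iota_inj fracE (F i).
pose dL i : {linear L i.+1 -> L i} := @modfrac_map _ _ _ _ _ _ _ _ T1 TM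
  iota_inj fracE _ _ (d i).
have [g [gsurj gker]] :=
  @modfrac_augmentation _ _ _ _ _ _ _ _ T1 TM iota_inj fracE _ _ _ _ esl ev_psi
    denV pi0M.
have {}gsurj := gsurj esurj; have {}gker : exact_at (dL 0%N) g := gker _ _ eker.
have exL i : exact_at (dL i.+1) (dL i) by apply: modfrac_exact; apply: ex.
have eqL i := @modfrac_equational _ _ _ _ _ _ _ _ T1 TM iota_inj fracE denV
  lift _ (PF i).
(* P maps onto M, and the kernel of this map is the kernel of g, so the resolution of M/IM can be
   kept unchanged from degree 1 on. *)
pose P := pullback g q.
have d0P y : (dL 0%N y, 0) \in pullback_pred g q.
  by apply: pullback_sub; rewrite linear0; apply/gker; exists y.
pose d0 y : P := Submodule (d0P y).
have d0_linear : linear d0.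
  move=> a y z; apply: val_inj; congr pair; first exact: (linearP (dL 0%N)).
  by rewrite /= scaler0 addr0.
pose d0L : {linear L 1%N -> P} := HB.pack d0 (GRing.isLinear.Build _ _ _ _ d0
  d0_linear).
pose fstP : {linear P -> L 0%N} := @pullback_fst _ _ _ _ g q.
pose epsP : {linear P -> M} := @pullback_snd _ _ _ _ g q.
(* The kernel of P -> L_0 is a copy of IM, on which e_j is the identity eventually. *)
have nullP w : fstP w = 0 -> null_mod e w.
  move=> w1; have := pullbackP w; rewrite -[pullback_fst w]/(fstP w) w1 linear0.
  move=> /esym/q0[N wN]; exists N => j Nj; apply: pullback_eq; last exact: wN.
  transitivity (e j *: fstP w); first by [].
  by rewrite w1 scaler0.
pose G i : lmodType R := if i is j.+1 then L j.+1 else P.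
pose dG i : {linear G i.+1 -> G i} :=
  match i return {linear G i.+1 -> G i} with 0 => d0L | j.+1 => dL j.+1 end.
exists G, dG, epsP; split.
- case=> [|i]; apply/equational_flat/(equational_modulo (e := e)) => // p r m
  rm0.
    (* Flatness of P: the relation is solved in L_0 and the generators are lifted to P. The error
       lies in the kernel of P -> L_0, which [equational_modulo] tolerates. *)
    have rm0' : \sum_i r i *: fstP (m i) = 0.
      rewrite -[RHS](linear0 fstP) -rm0 raddf_sum; apply: eq_bigr => i _.
      exact/esym/linearZ.
    have [s [C [y [rC mE]]]] := eqL _ _ _ _ rm0'.
    have /choice[z yz] l : exists z : P, fstP z = y l.
      have [w wE] := qsurj (g (y l)).
      by exists (Submodule (pullback_sub (esym wE))).
    exists s, C, z; split=> [l|i]; first exact: pi0.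
    apply: nullP; rewrite linearB raddf_sum mE; apply/eqP; rewrite subr_eq0.
    by apply/eqP/eq_bigr => l _; rewrite -yz; apply/esym/linearZ.
  have [s [C [y [rC mE]]]] := eqL _ _ _ _ rm0.
  exists s, C, y; split=> [l|i']; first exact: pi0.
  by exists 0%N => j _; rewrite mE subrr scaler0.
- case=> // i ni y; have [f [s ->]] := mfrac_surj y.
  by rewrite (F0 i.+1 ni f); apply: mfrac0.
- move=> m; have [y yE] := gsurj (q m).
  by exists (Submodule (pullback_sub yE)).
- move=> y; split=> [y0|[z <-]//].
  have := pullbackP y; rewrite -[pullback_snd y]/(epsP y) y0 linear0.
  by move=> /gker[z zE]; exists z; apply: pullback_eq.
- case=> [|i] y; last exact: exL.
  split=> [y0|[z <-]].
    by apply/exL; have := congr1 fstP y0.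
  by apply: pullback_eq => //; apply/exL; exists z.
Qed.
End UpperBound.

(** * Non-existence of shorter flat resolutions *)

Section PureTensor.
Variables (R : comNzRingType) (M N : lmodType R).
Implicit Types (m : M) (x : N).

Lemma pure_tensor0l x : pure_tensor (0 : M) x = 0.
Proof.
have /= := (pure_tensor_bilinear M N).1 x (-1) 0 0.
by rewrite scaler0 addr0 scaleN1r addNr.
Qed.

Lemma pure_tensor0r m : pure_tensor m (0 : N) = 0.
Proof.
have /= := (pure_tensor_bilinear M N).2 m (-1) 0 0.
by rewrite scaler0 addr0 scaleN1r addNr.
Qed.

Lemma pure_tensorZ a m x : pure_tensor (a *: m) x = pure_tensor m (a *: x).
Proof.
have /= := (pure_tensor_bilinear M N).1 x a m 0.
rewrite addr0 pure_tensor0l addr0 => ->.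
have /= := (pure_tensor_bilinear M N).2 m a x 0.
by rewrite addr0 pure_tensor0r addr0 => ->.
Qed.

Lemma pure_tensorDl m m' x :
  pure_tensor (m + m') x = pure_tensor m x + pure_tensor m' x.
Proof.
by have /= := (pure_tensor_bilinear M N).1 x 1 m m'; rewrite !scale1r.
Qed.

End PureTensor.

Section LowerBound.
Variables (R : comNzRingType) (e : nat -> R) (xi : nat -> R) (n : nat).
Hypothesis eE : forall N m, (N <= m)%N -> e m * e N = e N.

(* [koszul_sub i F] is I F + x_1 F + ... + x_i F, for I generated by the e_N. *)
Fixpoint koszul_sub i (F : lmodType R) (f : F) : Prop :=
  if i is j.+1 then exists g u, koszul_sub j u /\ f = xi j *: g + u
  else null_mod e f.

Lemma koszul_sub0 i (F : lmodType R) : koszul_sub i (0 : F).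
Proof.
elim: i => [|i IHi] /=; first by exists 0%N => m _; rewrite scaler0.
by exists 0, 0; rewrite scaler0 addr0.
Qed.

Lemma koszul_subP i (F : lmodType R) a (f g : F) :
  koszul_sub i f -> koszul_sub i g -> koszul_sub i (a *: f + g).
Proof.
elim: i f g => [|i IHi] f g /=.
  move=> [N fN] [N' gN]; exists (maxn N N') => m;
    rewrite geq_max => /andP[Nm N'm].
  by rewrite scalerDr gN// scalerA mulrC -scalerA fN.
move=> [f' [u [fu ->]]] [g' [v [gv ->]]]; exists (a *: f' + g'), (a *: u + v).
split; first exact: IHi.
by rewrite !scalerDr !scalerA [xi i * a]mulrC addrACA.
Qed.

Lemma koszul_subD i (F : lmodType R) (f g : F) :
  koszul_sub i f -> koszul_sub i g -> koszul_sub i (f + g).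
Proof. by move=> fi gi; rewrite -[f]scale1r; apply: koszul_subP. Qed.

Lemma koszul_subZ i (F : lmodType R) a (f : F) :
  koszul_sub i f -> koszul_sub i (a *: f).
Proof. by move=> fi; rewrite -[_ *: f]addr0; apply: koszul_subP => //;
  apply: koszul_sub0. Qed.

Lemma koszul_subN i (F : lmodType R) (f : F) : koszul_sub i f -> koszul_sub i
  (- f).
Proof. by rewrite -scaleN1r; apply: koszul_subZ. Qed.

Lemma koszul_sub_map i (F G : lmodType R) (d : {linear F -> G}) f :
  koszul_sub i f -> koszul_sub i (d f).
Proof.
elim: i f => [|i IHi] f /=.
  by move=> [N fN]; exists N => m Nm; rewrite -linearZ /= fN.
move=> [g [u [ui ->]]]; exists (d g), (d u); split; first exact: IHi.
by rewrite linearD linearZ.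
Qed.

Lemma koszul_sub_scale i (F : lmodType R) (r : R^o) (f : F) :
  koszul_sub i r -> koszul_sub i (r *: f).
Proof.
elim: i r => [|i IHi] r /=.
  move=> [N rN]; exists N => m Nm.
  by rewrite scalerA; congr (_ *: _); apply: rN.
move=> [g [u [ui ->]]]; exists (g *: f), (u *: f); split; first exact: IHi.
by rewrite scalerDl scalerA.
Qed.

Lemma koszul_sub_leq i j (F : lmodType R) (f : F) :
  (i <= j)%N -> koszul_sub i f -> koszul_sub j f.
Proof.
move=> /subnK <-; elim: (j - i)%N => // l IHl fi; exists 0, f.
by rewrite scaler0 add0r; split=> //; apply: IHl.
Qed.

Lemma koszul_sub_xi i j (F : lmodType R) (f : F) :
  (i < j)%N -> koszul_sub j (xi i *: f).
Proof.
move=> ij; apply: (koszul_sub_leq ij); exists f, 0.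
by rewrite addr0; split=> //; apply: koszul_sub0.
Qed.

Definition koszul_pred i (F : lmodType R) : {pred F} := fun f => `[< koszul_sub
  i f >].

Fact koszul_submod_closed i F : submod_closed (@koszul_pred i F).
Proof.
split=> [|a f g /asboolP fi /asboolP gi]; apply/asboolP.
  exact: koszul_sub0.
exact: koszul_subP.
Qed.
HB.instance Definition _ i F := GRing.isSubmodClosed.Build R F (@koszul_pred i
  F)
  (@koszul_submod_closed i F).

Definition koszul_quot i (F : lmodType R) : lmodType R :=
  quotmod (@koszul_pred i F).

Lemma koszul_quot_eq0 i (F : lmodType R) (f : F) :
  quotpi (@koszul_pred i F) f = 0 <-> koszul_sub i f.
Proof. by rewrite quotpi_eq0; split=> [/asboolP|/asboolP]. Qed.

Hypothesis xi_regular : forall i (r : R^o), (i < n)%N ->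
  koszul_sub i (xi i *: r) -> koszul_sub i r.

(** * Multiplication by x_i on F/J_i F, for F flat (N is R/J_i and Q is F/J_i F) *)

Section TensorQuotient.
Variables (i : nat) (F N Q : lmodType R).
Variables (cls : {linear R^o -> N}) (clsF : {linear F -> Q}).
Hypotheses (cls_surj : forall c, exists r, cls r = c).
Hypothesis cls_eq0 : forall r, cls r = 0 <-> koszul_sub i r.
Hypothesis clsF_eq0 : forall f, clsF f = 0 <-> koszul_sub i f.

Lemma pure_koszul_sub j (f : F) (c : N) :
  (j <= i)%N -> koszul_sub j f -> pure_tensor f c = 0.
Proof.
have [r <-] := cls_surj c.
elim: j f => [|j IHj] f ji /=.
  move=> [m /(_ m (leqnn m)) <-]; rewrite pure_tensorZ -linearZ /=.
  suff -> : cls (e m *: r) = 0 by rewrite pure_tensor0r.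
  apply/cls_eq0; apply: (koszul_sub_leq (leq0n i)); exists m => l ml.
  by rewrite scalerA eE.
move=> [g [u [uj ->]]]; rewrite pure_tensorDl (IHj u (ltnW ji) uj) addr0.
rewrite pure_tensorZ -linearZ /=.
suff -> : cls (xi j *: r) = 0 by rewrite pure_tensor0r.
exact/cls_eq0/koszul_sub_xi.
Qed.

(** The bilinear map (x, c) -> c x from F and R/J_i to F/J_i F detects the class of f. Together with
    [pure_koszul_sub] this replaces the isomorphism of the tensor product with F/J_i F. *)
Lemma pure_koszul_quot (f : F) : pure_tensor f (cls 1) = 0 -> koszul_sub i f.
Proof.
move=> f0; apply/clsF_eq0; have [rep repE] := choice cls_surj.
pose b (x : F) (c : N) : Q := clsF (rep c *: x).
have bE x r : b x (cls r) = clsF (r *: x).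
  apply/eqP; rewrite /b -subr_eq0 -linearB -scalerBl; apply/eqP/clsF_eq0.
  by apply: koszul_sub_scale; apply/cls_eq0; rewrite linearB /= repE subrr.
have bb : bilinear_for *:%R *:%R b.
  split=> [c a x y|x a c c'].
    by rewrite /b scalerDr linearD scalerA mulrC -scalerA linearZ.
  have [r <-] := cls_surj c; have [r' <-] := cls_surj c'.
  rewrite -linearP !bE scalerDl linearD -linearZ /=.
  by rewrite scalerA.
have := congr1 (tens_lift b) f0; rewrite tens_lift_pure// bE scale1r => ->.
by rewrite -[0]/(@tens_sum R F N [::]) tens_lift_sum// big_nil.
Qed.

(** Multiplication by x_i is injective on R/J_i, and flatness of F preserves this after
    tensoring. *)
Lemma flat_mul_regular (f : F) :
  (i < n)%N -> flat F -> koszul_sub i (xi i *: f) -> koszul_sub i f.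
Proof.
move=> iltn Fflat xf; apply: pure_koszul_quot.
have hl : linear (fun c : N => xi i *: c).
  by move=> a x y; rewrite scalerDr !scalerA mulrC.
pose h : {linear N -> N} := HB.pack (fun c : N => xi i *: c)
  (GRing.isLinear.Build _ _ _ _ _ hl).
have hinj : injective h.
  move=> x y /= xy; apply/eqP; rewrite -subr_eq0; apply/eqP.
  have xy0 : xi i *: (x - y) = 0 by rewrite scalerBr xy subrr.
  have [r rE] := cls_surj (x - y); rewrite -rE; apply/cls_eq0.
  by apply: xi_regular => //; apply/cls_eq0; rewrite linearZ /= rE.
have hpure x : tens_map h (pure_tensor f x) = pure_tensor f (xi i *: x).
  by rewrite /tens_map tens_lift_pure//; apply: tens_map_bilinear.
apply: (Fflat _ _ h hinj); rewrite hpure -pure_tensorZ.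
rewrite (pure_koszul_sub _ (leqnn i) xf) -(pure_tensor0r N f).
by rewrite hpure scaler0.
Qed.

End TensorQuotient.

Lemma flat_xi_regular i (F : lmodType R) (f : F) :
  (i < n)%N -> flat F -> koszul_sub i (xi i *: f) -> koszul_sub i f.
Proof.
apply: (@flat_mul_regular i F _ _ (quotpi (@koszul_pred i R^o))
  (quotpi (@koszul_pred i F))).
- exact: quotpi_surj.
- exact: koszul_quot_eq0.
- exact: koszul_quot_eq0.
Qed.

(** * Homology of a flat resolution modulo J_i *)

Section Chain.
Variables (F : nat -> lmodType R) (d : forall j, {linear F j.+1 -> F j}).
Hypothesis Fflat : forall j, flat (F j).
Hypothesis dex : forall j, exact_at (d j.+1) (d j).

(** The vanishing of H_(j+1)(F/J_i F) for j >= i, by the long exact sequence of x_i written out on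
    elements. For i = 0 an idempotent e_N splits off the part of f that is not a cycle. For the
    step, df = x_i g + u and ddf = 0 force dg into J_i F by regularity; induction writes g as a
    boundary dh modulo J_i F, and then applies again to f - x_i h. *)
Lemma koszul_homology_eq0 i j (f : F j.+1) : (i <= n)%N -> (i <= j)%N ->
  koszul_sub i (d j f) -> exists w h, koszul_sub i w /\ f = w + d j.+1 h.
Proof.
have dd l (y : F l.+2) : d l (d l.+1 y) = 0 by apply/dex; exists y.
elim: i j f => [|i IHi] j f iN ij.
  move=> [N dN]; have /dex[h hE] : d j (f - e N *: f) = 0.
    by rewrite linearB linearZ /= dN ?subrr.
  exists (e N *: f), h; split; last by rewrite hE addrC subrK.
  by exists N => m Nm; rewrite scalerA eE.
move=> [g [u [ui dE]]]; case: j f ij g u ui dE => // j f ij g u ui dE.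
have /(flat_xi_regular iN (@Fflat _)) dg : koszul_sub i (xi i *: d j g).
  have : d j (xi i *: g + u) = 0 by rewrite -dE dd.
  rewrite linearD linearZ /= => /eqP; rewrite addr_eq0 => /eqP ->.
  exact/koszul_subN/koszul_sub_map.
have [w [h [wi gE]]] := IHi _ _ (ltnW iN) ij dg.
have dfh : koszul_sub i (d j.+1 (f - xi i *: h)).
  rewrite linearB linearZ /= dE gE scalerDr addrAC addrK.
  exact: koszul_subP.
have [w' [h' [wi' fE]]] := IHi _ _ (ltnW iN) (leqW ij) dfh.
exists (xi i *: h + w'), h'; split; first by exists h, w'.
by rewrite -addrA -fE addrC subrK.
Qed.

(** Starting from a preimage of 1 in R/J_n, the class of degree i + 1 is obtained by inverting the
    connecting map: x_i f is a boundary dh modulo J_i F, and h is the new class. That every x_l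
    kills the class is part of the induction because the next step needs it for x_(i+1). *)
Lemma koszul_homology_neq0 (eps : F 0%N -> koszul_quot n R^o) i :
  skew_linear idfun eps -> (forall y, exists x, eps x = y) ->
  exact_at (d 0%N) eps -> ~ koszul_sub n (1 : R^o) -> (i <= n)%N ->
  exists f : F i, (~ exists w h, koszul_sub i w /\ f = w + d i h) /\
    forall l, (l < n)%N -> exists w h, koszul_sub i w /\ xi l *: f = w + d i h.
Proof.
move=> epsl epss eps0 n1; elim: i => [_|i IHi iN].
  pose one := quotpi (@koszul_pred n R^o) 1.
  have [f fE] := epss one; exists f; split.
    move=> [w [h [[N wN] fwh]]]; apply: n1; apply/koszul_quot_eq0.
    rewrite -/one -fE fwh (skew_linearD epsl).
    rewrite (_ : eps (d 0%N h) = 0) ?addr0; last by apply/eps0; exists h.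
    rewrite -(wN N (leqnn N)) (skew_linearZ epsl).
    have [r <-] := quotpi_surj (eps w); rewrite -linearZ; apply/koszul_quot_eq0.
    apply: (koszul_sub_leq (leq0n n)); exists N => m Nm.
    by rewrite scalerA eE.
  move=> l ln; have /eps0[h hE] : eps (xi l *: f) = 0.
    rewrite (skew_linearZ epsl) fE -linearZ; apply/koszul_quot_eq0.
    exact: koszul_sub_xi.
  by exists 0, h; rewrite add0r hE; split=> //; apply: koszul_sub0.
have [f [fN fl]] := IHi (ltnW iN).
have [w [h [wi fE]]] := fl i iN; exists h; split.
  (* If h = x_i p + q + dr with q in J_i F, then x_i (f - dp) lies in J_i F, so regularity puts f in
     J_i F + dF, a contradiction. *)
  move=> [_ [r [[p [q [qi ->]]] hE]]]; apply: fN.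
  have dd : d i (d i.+1 r) = 0 by apply/dex; exists r.
  have := flat_xi_regular iN (@Fflat i) (f := f - d i p).
  have -> : xi i *: (f - d i p) = w + d i q.
    have dE : d i h = xi i *: d i p + d i q.
      by rewrite hE !linearD linearZ /= dd addr0.
    by rewrite scalerBr fE dE addrCA addrAC subrr add0r.
  move=> /(_ (koszul_subD wi (koszul_sub_map _ qi))) fp.
  by exists (f - d i p), p; rewrite subrK.
move=> l ln; have [w' [h' [wi' fE']]] := fl l ln.
(* Since dh and dh' are x_i f and x_l f modulo J_i F, the element x_l h - x_i h' is a cycle modulo
   J_i F, in a degree where the homology vanishes. *)
have /(koszul_homology_eq0 (ltnW iN) (leqnn i))[w'' [h'' [wi'' hE]]] :
    koszul_sub i (d i (xi l *: h - xi i *: h')).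
  have -> : d i (xi l *: h - xi i *: h') = xi i *: w' - xi l *: w.
    rewrite linearB !linearZ /=.
    have -> : d i h = xi i *: f - w by rewrite fE addrC addKr.
    have -> : d i h' = xi l *: f - w' by rewrite fE' addrC addKr.
    rewrite !(scalerN, scalerDr) !scalerA [xi l * _]mulrC opprD opprK.
    by rewrite addrACA subrr add0r addrC.
  by apply: koszul_subD; [|apply: koszul_subN]; apply: koszul_subZ.
exists (xi i *: h' + w''), h''; split; first by exists h', w''.
by rewrite -addrA -hE addrC subrK.
Qed.

End Chain.

Theorem has_flat_resolution_lower m : ~ koszul_sub n (1 : R^o) ->
  has_flat_resolution (koszul_quot n R^o) m -> (n <= m)%N.
Proof.
move=> n1 [F [d [eps [Fflat F0 epss eps0 dex]]]]; rewrite leqNgt;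
  apply/negP => mn.
have epsl : skew_linear idfun eps by move=> a x y; rewrite linearP.
have [f [fN _]] := koszul_homology_neq0 Fflat dex epsl epss eps0 n1 (leqnn n).
by apply: fN; exists 0, 0; rewrite linear0 addr0; split;
  [apply: koszul_sub0|apply: F0].
Qed.

End LowerBound.

(** * Algebraic dependence along chains of primes *)

Lemma kernel_neq0 (k : fieldType) (p q : nat) (M : 'M[k]_(p, q)) :
  (q < p)%N -> exists2 v : 'rV[k]_p, v != 0 & v *m M = 0.
Proof.
move=> qp; have : kermx M != 0.
  rewrite kermx_eq0 /row_free; apply: contraL qp => /eqP <-.
  by rewrite -leqNgt rank_leq_col.
by move=> /rowV0Pn[v /sub_kermxP vM v0]; exists v.
Qed.

Lemma msize_prod_leq (k : fieldType) (n p : nat) (f : 'I_p -> {mpoly k[n]}) d :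
  (forall i, msize (f i) <= d.+1)%N -> (msize (\prod_i f i) <= (p * d).+1)%N.
Proof.
elim: p f => [|p IHp] f fd; first by rewrite big_ord0 msize1.
rewrite big_ord_recl.
have [->|f0] := eqVneq (f ord0) 0; first by rewrite mul0r msize0.
have [->|g0] := eqVneq (\prod_(i < p) f (lift ord0 i)) 0.
  by rewrite mulr0 msize0.
rewrite msizeM// mulSn; have := fd ord0.
have : (msize (\prod_(i < p) f (lift ord0 i)) <= (p * d).+1)%N.
  by apply: (IHp (f \o lift ord0)) => i; apply: fd.
by move: (msize _) (msize _) (p * d)%N; lia.
Qed.

Lemma msize_exp_leq (k : fieldType) (n : nat) (f : {mpoly k[n]}) d m :
  (msize f <= d.+1)%N -> (msize (f ^+ m) <= (m * d).+1)%N.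
Proof.
move=> fd; rewrite -[X in _ ^+ X](card_ord m) -prodr_const.
exact: msize_prod_leq.
Qed.

Lemma alg_dep (k : fieldType) (n : nat) (y : n.+1.-tuple {mpoly k[n]}) :
  exists2 Q : {mpoly k[n.+1]}, Q != 0 & Q \mPo y = 0.
Proof.
pose d := (\max_(i < n.+1) msize (tnth y i)).
have yd i : (msize (tnth y i) <= d.+1)%N.
  by apply/leqW; apply: (leq_bigmax (F := fun i => msize (tnth y i))).
(* Counting: products of the y_i with exponents below D have degree at most (n + 1)(D - 1)d < c D =
   K, so they lie in a space with K^n = c^n D^n monomials. There are D^(n+1) products, and D = c^n +
   1 makes this larger. *)
pose c := (n.+1 * d).+1; pose D := (c ^ n).+1.
pose K := (c * D)%N.
pose X := {ffun 'I_n.+1 -> 'I_D}; pose Z := {ffun 'I_n -> 'I_K}.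
pose mon (m : X) : 'X_{1..n.+1} := [multinom (m i : nat) | i < n.+1].
pose monZ (z : Z) : 'X_{1..n} := [multinom (z i : nat) | i < n].
pose pr (m : X) := \prod_(i < n.+1) tnth y i ^+ m i.
have prE m : 'X_[mon m] \mPo y = pr m.
  by rewrite comp_mpolyX; apply: eq_bigr => i _; rewrite mnmE.
have prK m : (msize (pr m) <= K)%N.
  have : (msize (pr m) <= (n.+1 * (D.-1 * d)).+1)%N.
    apply: msize_prod_leq => i; apply: leq_trans (msize_exp_leq _ (yd i)) _.
    by rewrite ltnS leq_mul2r; apply/orP; right; rewrite -ltnS ltn_ord.
  by move=> /leq_trans; apply; rewrite /K /D /c /=; nia.
pose M : 'M[k]_(#|{: X}|, #|{: Z}|) :=
  \matrix_(a, b) (pr (enum_val a))@_(monZ (enum_val b)).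
have [|v v0 vM] := @kernel_neq0 _ _ _ M.
  rewrite !card_ffun !card_ord /K expnMn expnS.
  by rewrite ltn_pmul2r ?expn_gt0.
have mon_inj : injective mon.
  move=> m m' mm; apply/ffunP => i; apply: val_inj.
  by have := congr1 (fun z : 'X_{1..n.+1} => z i) mm; rewrite !mnmE.
exists (\sum_a v 0 a *: 'X_[mon (enum_val a)]).
  apply: contra v0 => /eqP Q0; apply/eqP/rowP => a; rewrite mxE.
  have := congr1 (mcoeff (mon (enum_val a))) Q0; rewrite mcoeff0 raddf_sum /=.
  rewrite (bigD1 a)//= mcoeffZ mcoeffX eqxx mulr1 big1 ?addr0// => b ba.
  rewrite mcoeffZ mcoeffX (inj_eq mon_inj) (inj_eq enum_val_inj) (negPf ba).
  by rewrite mulr0.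
rewrite raddf_sum /=; under eq_bigr => a _ do rewrite linearZ /= prE.
apply/mpolyP => z; rewrite mcoeff0 raddf_sum /=.
under eq_bigr => a _ do rewrite mcoeffZ.
(* A monomial with an exponent at least K exceeds the degree of every product, so its coefficient is
   zero. *)
have [zK|/forallPn[i zi]] := boolP [forall i, (z i < K)%N]; last first.
  apply: big1 => a _; rewrite memN_msupp_eq0 ?mulr0//; apply: msize_mdeg_ge.
  apply: leq_trans (prK _) _; move: zi; rewrite -leqNgt => /leq_trans; apply.
  by rewrite mdegE (bigD1 i)//= leq_addr.
pose z' : Z := [ffun i => Ordinal (forallP zK i)].
have /rowP/(_ (enum_rank z')) := vM; rewrite !mxE => vMz; rewrite -[RHS]vMz.
apply: eq_bigr => a _; rewrite mxE enum_rankK; congr (_ * mcoeff _ _).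
by apply/mnmP => i; rewrite mnmE ffunE.
Qed.

(** The lowest nonzero coefficient is the one found. Powers of the variable are divided out because
    P is prime and y is not in P; what remains is a constant term plus a multiple of y, and both the
    value and y lie in P'. *)
Lemma horner_chain (D : idomainType) (B : comNzRingType) (psi : {rmorphism D ->
  B})
    (P P' : prime_idealr B) (y : B) (q : {poly D}) :
  {subset P <= P'} -> y \in P' -> y \notin P -> q != 0 ->
  (map_poly psi q).[y] \in P -> exists2 j, q`_j != 0 & psi q`_j \in P'.
Proof.
move=> PP' yP' yP; elim/poly_ind: q => [|q c IHq]; first by rewrite eqxx.
have [-> |c0 _] := eqVneq c 0.
  rewrite addr0 mulf_eq0 polyX_eq0 orbF rmorphM /= map_polyX hornerMX => q0.
  rewrite prime_idealrM (negPf yP) orbF => /IHq[]// j qj jP.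
  by exists j.+1; rewrite coefMX.
rewrite rmorphD rmorphM /= map_polyX map_polyC /= hornerMXaddC => /PP' vP.
exists 0%N; rewrite coefD coefMX coefC eqxx add0r//.
have -> : psi c = ((map_poly psi q).[y] * y + psi c) - (map_poly psi q).[y] * y.
  by rewrite addrC addKr.
by rewrite rpredB// idealMr.
Qed.

(* Algebraic independence along a chain of primes: this replaces the
   transcendence degree in the bound on the Krull dimension. *)
Lemma prime_chain_alg_indep (k : fieldType) (N : nat) (B : comNzRingType)
    (phi : {rmorphism {mpoly k[N]} -> B}) (P : nat -> prime_idealr B) (Q :
      {mpoly k[N]}) :
  (forall j, (j < N)%N -> {subset P j <= P j.+1}) ->
  (forall j : 'I_N, phi 'X_j \in P (N - j)%N /\ phi 'X_j \notin P (N - j).-1) ->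
  Q != 0 -> phi Q \notin P 0%N.
Proof.
elim: N phi P Q => [|N IHN] phi P Q Pinc yP Q0.
  apply/negP => QP; have QE : Q = (Q@_0)%:MP.
    apply/mpolyP => m; rewrite mcoeffC; have -> : m = 0%MM by apply/mnmP => -[].
    by rewrite eqxx mulr1.
  have c0 : Q@_0 != 0 by apply: contra Q0 => /eqP c0; rewrite QE c0 mpolyC0.
  have := idealr1 (P 0%N); rewrite -(rmorph1 phi) -mpolyC1 -(mulVf c0) mpolyCM.
  by rewrite rmorphM idealMr// -QE.
apply/negP; pose phi' : {rmorphism {mpoly k[N]} -> B} := phi \o @mwiden N k.
have phiE : phi Q = (map_poly phi' (muni Q)).[phi 'X_ord_max].
  apply: (@mpoly_rmorph_eq _ _ _ phi
    (horner_eval (phi 'X_ord_max) \o (map_poly phi' \o @muni N k))) => [c|i] /=.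
    by rewrite muniC map_polyC /horner_eval hornerC /= mwidenC.
  have [j ->|->] := unliftP ord_max i; last first.
    by rewrite muniX_max map_polyX /horner_eval hornerX.
  have -> : lift ord_max j = widen_ord (leqnSn N) j.
    by apply: val_inj; rewrite /= /bump leqNgt ltn_ord.
  by rewrite muniX_widen map_polyC /horner_eval hornerC /= mwidenXU.
(* The variables are numbered downwards along the chain because [muni] isolates the last one, whose
   image lies in P_1 but not in P_0. A nonzero coefficient of Q then lands in P_1, and the induction
   continues with the chain starting there. *)
have [/= yP1 yP0] := yP ord_max; rewrite subSn// subnn in yP1 yP0.
have q0 : muni Q != 0.
  by rewrite -(inj_eq (bij_inj (@muni_bij N k))) rmorph0 in Q0.
rewrite phiE => /(horner_chain (Pinc 0%N isT) yP1 yP0 q0)[j qj].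
apply/negP; apply: (IHN phi' (fun j => P j.+1)) => // [i iN|i].
  exact: Pinc.
rewrite /= mwidenXU; have := yP (widen_ord (leqnSn N) i);
  rewrite /= subSn 1?ltnW//=.
by rewrite prednK// subn_gt0.
Qed.

(** * Weak global and Krull dimensions *)

Section Extrema.
Variables (disp : Order.disp_t) (V : orderType disp).
Implicit Types (A : set V).

Lemma supremum_max (x0 x : V) A : A x -> ubound A x -> supremum x0 A = x.
Proof.
move=> Ax ux; have sx : supremums A x by split=> // y; apply.
rewrite /supremum; case: ifPn => [/eqP A0|_]; first by move: Ax; rewrite A0.
by case: xgetP => [y _ sy|/(_ x) []//]; apply: is_subset1_supremums sy sx.
Qed.

Lemma infimum_min (x0 x : V) A : A x -> lbound A x -> infimum x0 A = x.
Proof.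
move=> Ax lx; have sx : infimums A x by split=> // y; apply.
rewrite /infimum; case: ifPn => [/eqP A0|_]; first by move: Ax; rewrite A0.
by case: xgetP => [y _ sy|/(_ x) []//]; apply: is_subset1_infimums sy sx.
Qed.

End Extrema.

Section WeakGlDim.
Variable R : comNzRingType.

Lemma flat_dim_leq (M : lmodType R) n :
  has_flat_resolution M n -> (flat_dim M <= n%:Z%:E)%E.
Proof.
move=> Mn; apply: le_infimum_Nmem; last by exists n.
by apply: infimums_bar_int; exists n.
Qed.

Lemma flat_dim_eq (M : lmodType R) n : has_flat_resolution M n ->
  (forall m, has_flat_resolution M m -> (n <= m)%N) -> flat_dim M = n%:Z%:E.
Proof.
move=> Mn nmin; apply: infimum_min; first by exists n.
by move=> _ [m Mm <-]; rewrite lee_fin lez_nat nmin.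
Qed.

Lemma weak_gl_dim_eq n : (forall M : lmodType R, has_flat_resolution M n) ->
  (exists M : lmodType R, forall m, has_flat_resolution M m -> (n <= m)%N) ->
  weak_gl_dim R = n%:Z%:E.
Proof.
move=> resn [M Mn]; apply: supremum_max; first by exists M;
  rewrite (@flat_dim_eq M n).
by move=> _ [N ->]; apply: flat_dim_leq.
Qed.

Lemma krull_dim_eq n : (exists P, @prime_chain R n P) ->
  (forall m P, @prime_chain R m P -> (m <= n)%N) -> krull_dim R = n%:Z%:E.
Proof.
move=> Pn nmax; apply: supremum_max; first by exists n.
by move=> _ [m [P Pm] <-]; rewrite lee_fin lez_nat (nmax _ _ Pm).
Qed.

End WeakGlDim.

(** * Setting the first variables to zero *)

Section Substitution.
Variables (k : fieldType) (n : nat).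
Local Notation S := {mpoly k[n]}.

Fact subst0_subproof i : {f : {rmorphism S -> S} | forall c, f c%:MP = c%:MP
  & forall j : 'I_n, f 'X_j = if (j < i)%N then 0 else 'X_j}.
Proof.
exists (comp_mpoly [tuple (if (j < i)%N then 0 else 'X_j : S) | j < n]).
  by move=> c; apply: comp_mpolyC.
by move=> j; rewrite /= comp_mpolyXU -tnth_nth tnth_mktuple.
Qed.

(* The kernel of [subst0 i] is (x_1, ..., x_i). It is extracted from an opaque
   proof because unification would otherwise unfold [comp_mpoly]. *)
Definition subst0 i : {rmorphism S -> S} := s2val (subst0_subproof i).

Lemma subst0C i c : subst0 i c%:MP = c%:MP.
Proof. exact: (s2valP (subst0_subproof i)). Qed.

Lemma subst0X i (j : 'I_n) : subst0 i 'X_j = if (j < i)%N then 0 else 'X_j.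
Proof. exact: (s2valP' (subst0_subproof i)). Qed.

Lemma subst0Xm i m :
  subst0 i 'X_[m] = \prod_(j < n) (if (j < i)%N then 0 else 'X_j) ^+ m j.
Proof.
rewrite mpolyXE_id (rmorph_prod (subst0 i)); apply: eq_bigr => j _.
by rewrite (rmorphXn (subst0 i)) /= subst0X.
Qed.

Lemma subst0D i p q : subst0 i (p + q) = subst0 i p + subst0 i q.
Proof. exact: rmorphD. Qed.

Lemma subst0M i p q : subst0 i (p * q) = subst0 i p * subst0 i q.
Proof. exact: rmorphM. Qed.

Lemma subst0_r0 i : subst0 i 0 = 0.
Proof. exact: rmorph0. Qed.

Lemma subst0_0 p : subst0 0%N p = p.
Proof.
apply: (@mpoly_rmorph_eq _ _ _ (subst0 0%N) idfun) => [c|j] /=.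
  exact: subst0C.
exact: subst0X.
Qed.

Lemma subst0_comp i j p : subst0 i (subst0 j p) = subst0 (maxn i j) p.
Proof.
apply: (@mpoly_rmorph_eq _ _ _ (subst0 i \o subst0 j) (subst0 _)) => [c|l] /=.
  by rewrite (subst0C j c) (subst0C i c) (subst0C (maxn i j) c).
rewrite (subst0X j l) (subst0X (maxn i j) l) leq_max.
by case: (ltnP l j) => _; rewrite ?orbT ?subst0_r0// orbF (subst0X i l).
Qed.

Lemma meval0_subst0 i p : (subst0 i p).@[fun=> 0] = p.@[fun=> 0].
Proof.
apply: (@mpoly_rmorph_eq _ _ _ (meval (fun=> 0) \o subst0 i) (meval (fun=> 0)))
  => [c|l] /=; first by rewrite (subst0C i c).
by rewrite (subst0X i l); case: ifP => _; rewrite ?meval0 ?mevalXU.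
Qed.

(** The two substitutions differ only on monomials containing X_i. Hence a polynomial killed by
    [subst0 i.+1] is a multiple of X_i plus one killed by [subst0 i], as [koszul_subE] requires. *)
Lemma subst0S_division (i : 'I_n) p :
  exists g, subst0 i p = 'X_i * g + subst0 i.+1 p.
Proof.
elim/mpolyind: p => [|c m p _ _ [g gE]].
  by exists 0; rewrite mulr0 add0r (subst0_r0 i) (subst0_r0 i.+1).
suff [h hE] : exists h, subst0 i (c *: 'X_[m]) = 'X_i * h + subst0 i.+1 (c *:
  'X_[m]).
  by exists (h + g); rewrite (subst0D i _ p) (subst0D i.+1 _ p) hE gE mulrDr
    addrACA.
have [mi|mi] := posnP (m i).
  exists 0; rewrite mulr0 add0r -mul_mpolyC (subst0M i) (subst0M i.+1).
  rewrite (subst0C i c) (subst0C i.+1 c) (subst0Xm i m) (subst0Xm i.+1 m).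
  congr (_ * _); apply: eq_bigr => j _.
  have [->|ji] := eqVneq j i; first by rewrite mi !expr0.
  by rewrite ltnS [in RHS]leq_eqVlt (negPf (ji : j != i :> nat)).
have -> : 'X_[m] = 'X_i * 'X_[m - U_(i)] :> S.
  rewrite -mpolyXD addmC submK//; apply/mnm_lepP => j; rewrite mnm1E.
  by case: eqP => // <-.
exists (c *: subst0 i 'X_[m - U_(i)]).
have E j : subst0 j (c *: ('X_i * 'X_[m - U_(i)])) =
    (if (i < j)%N then 0 else 'X_i) * (c *: subst0 j 'X_[m - U_(i)]).
  rewrite -[c *: _]mul_mpolyC (subst0M j) (subst0C j c) (subst0M j) (subst0X j
    i).
  by rewrite mulrCA mul_mpolyC.
by rewrite (E i) (E i.+1) ltnn ltnSn mul0r addr0.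
Qed.

End Substitution.

(** * Both dimensions, from the retraction of R onto A and the idempotents e_N *)

Section RegularSystem.
Variables (k : fieldType) (n : nat) (R A : comNzRingType).
Local Notation S := {mpoly k[n]}.
Variables (iota : {rmorphism S -> A}) (pi : {rmorphism R -> A}).
Variables (sigma : {rmorphism A -> R}) (e : nat -> R).

(* The complement of (x_1, ..., x_n). *)
Definition origin_units : {pred S} := fun p => p.@[fun=> 0] != 0.
Local Notation T := origin_units.
Local Notation subst0 := (@subst0 k n).

Hypothesis iota_inj : injective iota.
Hypothesis fracE : forall a, exists p t, t \in T /\ iota t * a = iota p.
Hypothesis denV : forall t, t \in T -> exists a, iota t * a = 1.
Hypothesis sigmaK : cancel sigma pi.
Hypothesis pi_null : forall r, pi r = 0 -> null e r.
Hypothesis pi_e : forall N, pi (e N) = 0.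
Hypothesis eE : forall N m, (N <= m)%N -> e m * e N = e N.
Hypothesis regular_e : forall N p (r : 'I_p -> R), exists u : 'I_p -> R,
  forall j, (\sum_i u i * r i) * (r j * e N) = r j * e N.

Lemma origin_units1 : 1 \in T.
Proof. by rewrite unfold_in /T meval1 oner_neq0. Qed.

Lemma origin_unitsM s t : s \in T -> t \in T -> s * t \in T.
Proof. by rewrite !unfold_in /T mevalM mulf_eq0 negb_or => -> ->. Qed.

Lemma subst0_neq0 i t : t \in T -> subst0 i t != 0.
Proof.
rewrite unfold_in /T -(meval0_subst0 i); apply: contra => /eqP ->.
by rewrite meval0.
Qed.

Let rho (p : S) : R := sigma (iota p).

Let pi_rho p : pi (rho p) = iota p.
Proof. exact: sigmaK. Qed.

(* The inverse image in R of the ideal generated by x_1, ..., x_i in A. *)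
Definition chain_pred i : {pred R} := fun r => `[< exists a t,
  [/\ t \in T, iota t * pi r = iota a & subst0 i a = 0] >].

(** Any fraction representing [pi r] decides membership: numerators of two fractions agree up to
    denominators, which stay nonzero under [subst0] since it preserves constant terms. *)
Lemma chain_predP i r a t : t \in T -> iota t * pi r = iota a ->
  (r \in chain_pred i) = (subst0 i a == 0).
Proof.
move=> tT ra; apply/asboolP/eqP => [[a' [t' [tT' ra' a'0]]]|a0];
  last by exists a, t.
have at' : a * t' = a' * t.
  by apply: iota_inj; rewrite !rmorphM -ra -ra'; ring.
have : subst0 i a * subst0 i t' = 0 by rewrite -subst0M at' subst0M a'0 mul0r.
by move=> /eqP; rewrite mulf_eq0 (negPf (subst0_neq0 i tT')) orbF => /eqP.
Qed.

Lemma chain_pred_rho i p : (rho p \in chain_pred i) = (subst0 i p == 0).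
Proof.
by apply: (chain_predP i origin_units1); rewrite pi_rho rmorph1 mul1r.
Qed.

Lemma chain_pred_closed i : idealr_closed (chain_pred i).
Proof.
have pi_fracE r := fracE (pi r).
split.
- rewrite (@chain_predP i 0 0 1) ?origin_units1 ?subst0_r0//.
  by rewrite !rmorph0 mulr0.
- rewrite (@chain_predP i 1 1 1) ?origin_units1 ?rmorph1 ?mul1r ?oner_eq0//.
move=> r x y xP yP; have [a [t [tT ra]]] := pi_fracE r.
have [b [s [sT xb]]] := pi_fracE x; have [c [u [uT yc]]] := pi_fracE y.
move: xP yP; rewrite (chain_predP i sT xb) (chain_predP i uT yc) => /eqP b0
  /eqP c0.
rewrite (@chain_predP i _ (u * (a * b) + t * s * c) (t * s * u)).
- by rewrite subst0D !subst0M b0 c0 !mulr0 addr0.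
- by do !apply: origin_unitsM.
- rewrite !rmorphD !rmorphM /= -ra -xb -yc; ring.
Qed.

Lemma chain_pred_prime i : prime_idealr_closed (chain_pred i).
Proof.
move=> x y; have [b [s [sT xb]]] := fracE (pi x).
have [c [u [uT yc]]] := fracE (pi y).
rewrite (chain_predP i sT xb) (chain_predP i uT yc).
rewrite (@chain_predP i _ (b * c) (s * u)) ?origin_unitsM//.
  by rewrite subst0M mulf_eq0.
by rewrite !rmorphM -xb -yc; ring.
Qed.

HB.instance Definition _ i := isIdealr.Build R (chain_pred i)
  (chain_pred_closed i).
HB.instance Definition _ i := isPrimeIdealrClosed.Build R (chain_pred i)
  (@chain_pred_prime i).

Definition chain_prime i : prime_idealr R := chain_pred i.

Lemma chain_prime_chain : prime_chain n chain_prime.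
Proof.
move=> i iltn; split=> [r|].
  have [a [t [tT ra]]] := fracE (pi r).
  rewrite !(chain_predP _ tT ra) => /eqP a0.
  by rewrite -(maxn_idPl (leqnSn i)) -subst0_comp a0 subst0_r0.
exists (rho 'X_(Ordinal iltn)); rewrite chain_pred_rho subst0X /= ?ltnSn
  ?eqxx//.
by rewrite ltnn -msize_poly_eq0 msizeX.
Qed.

Section KrullUpper.
Variables (m : nat) (P : nat -> prime_idealr R).
Hypotheses (chainP : prime_chain m P) (m0 : (0 < m)%N).

Lemma prime_chain_subset i j : (i <= j <= m)%N -> {subset P i <= P j}.
Proof.
move=> /andP[/subnK <-]; elim: (j - i)%N => [|l IHl] lm x xP; first by [].
by apply: (chainP lm).1; apply: IHl xP; apply: ltnW.
Qed.

(* If e_N is not in P_0 then e_N R is von Neumann regular modulo P_0, so that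
   P_0 is maximal. *)
Lemma prime_chain_e N : e N \in P 0%N.
Proof.
apply/negPn/negP => eP; have [P01 [x xP1 xP0]] := chainP m0.
have [u] := regular_e N (fun _ : 'I_1 => x); move=> /(_ ord0); rewrite big_ord1.
set c := u ord0 => cx.
have : (1 - c * x) * (x * e N) \in P 0%N by rewrite mulrBl mul1r cx subrr
  idealr0.
rewrite !prime_idealrM (negPf xP0) (negPf eP) !orbF => /P01 cP.
have := idealr1 (P 1%N); rewrite -[X in X \in _](subrK (c * x)).
by rewrite rpredD// idealMr.
Qed.

Lemma prime_chain_null i r : (i <= m)%N -> pi r = 0 -> r \in P i.
Proof.
move=> im /pi_null[N rN]; rewrite -(rN N (leqnn N)) mulrC idealMr//.
by apply: (@prime_chain_subset 0%N); [rewrite im|apply: prime_chain_e].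
Qed.

Lemma prime_chain_num i r p t : (i <= m)%N -> t \in T -> iota t * pi r = iota p
  ->
  (r \in P i) = (rho p \in P i).
Proof.
move=> im tT rp; have [a ta] := denV tT.
have nullP x : pi x = 0 -> x \in P i by apply: prime_chain_null.
apply/idP/idP => [rP|pP].
  rewrite -[rho p](subrK (rho t * r)) rpredD ?idealMr//.
  by apply: nullP; rewrite rmorphB rmorphM !pi_rho rp subrr.
rewrite -[r](subrK (sigma a * rho p)) rpredD ?idealMr//.
apply: nullP; rewrite rmorphB rmorphM pi_rho -rp sigmaK mulrA [a * _]mulrC ta.
by rewrite mul1r subrr.
Qed.

Lemma prime_chain_leq : (m <= n)%N.
Proof.
rewrite leqNgt; apply/negP => nm.
have /choice[x xP] (i : 'I_n.+1) : exists p : S,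
    rho p \in P i.+1 /\ rho p \notin P i.
  have im : (i < m)%N by apply: leq_trans (ltn_ord i) nm.
  have [_ [r rP rP']] := chainP im; have [p [t [tT rp]]] := fracE (pi r).
  by exists p; rewrite -!(prime_chain_num _ tT rp)// ltnW.
(* Reversed, to match the downward numbering of variables in [prime_chain_alg_indep]. *)
pose y : n.+1.-tuple S := [tuple x (rev_ord i) | i < n.+1].
have [Q Q0 Qy] := alg_dep y.
pose phi : {rmorphism {mpoly k[n.+1]} -> R} := sigma \o (iota \o comp_mpoly y).
have := @prime_chain_alg_indep k n.+1 R phi P Q _ _ Q0.
rewrite {3}/phi /= Qy !rmorph0 idealr0 => H; apply: (notF (H _ _)) => [j jn|j].
  exact: (chainP (leq_trans jn nm)).1.
rewrite /phi /= comp_mpolyXU -tnth_nth tnth_mktuple -/(rho _).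
have [] := xP (rev_ord j); rewrite /= !subSS.
by rewrite subSn ?ltn_ord// -ltnS.
Qed.

End KrullUpper.

Theorem krull_dim_regular : krull_dim R = n%:Z%:E.
Proof.
apply: krull_dim_eq; first by exists chain_prime; apply: chain_prime_chain.
(* Length 0 is separate: a single prime need not contain I, whereas P_0 in a longer chain is not
   maximal and does. *)
by move=> [//|m] P mP; apply: prime_chain_leq mP _.
Qed.

(** The Koszul lemmas index sequences by nat; from n on, the value 0 is a mere default. *)
Definition param (j : nat) : R := if insub j is Some j' then rho 'X_j' else 0.

Lemma paramE (j : 'I_n) : param j = rho 'X_j.
Proof. by rewrite /param valK. Qed.

(** Identifies J_i with a prime ideal, so that regularity of the sequence reduces to x_(i+1) not
    being in J_i, and properness of J_n to 1 not being in a prime. *)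
Lemma koszul_subE i (r : R^o) : (i <= n)%N ->
  koszul_sub e param i r <-> (r : R) \in chain_prime i.
Proof.
elim: i r => [|i IHi] r iltn /=.
  have [a [t [tT ra]]] := fracE (pi r).
  have -> : ((r : R) \in chain_pred 0) = (a == 0).
    by rewrite (chain_predP _ tT ra) subst0_0.
  split=> [[N rN]|/eqP a0].
    rewrite -(inj_eq iota_inj) -ra -(rN N (leqnn N)).
    by rewrite [pi _]rmorphM pi_e mul0r mulr0 rmorph0.
  apply: pi_null; have [b tb] := denV tT.
  by rewrite -[LHS]mul1r -tb mulrAC ra a0 rmorph0 mul0r.
have parE : param i = rho 'X_(Ordinal iltn) := paramE (Ordinal iltn).
split=> [[g [u [/(IHi u (ltnW iltn)) ui ->]]]|].
  rewrite rpredD//; last exact: (chain_prime_chain iltn).1.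
  rewrite [_ *: _]mulrC idealMr// parE chain_pred_rho subst0X /= ltnSn//.
have [a [t [tT ra]]] := fracE (pi r).
rewrite (chain_predP _ tT ra) => /eqP ai.
have [b bE] := subst0S_division (Ordinal iltn) a; rewrite /= ai addr0 in bE.
have [c tc] := denV tT.
(* With c the inverse of the denominator t, the coefficient of the new parameter is b/t; the
   remainder has numerator a - [subst0 i a], which [subst0 i] kills. *)
exists (sigma (c * iota b)), (r - param i * sigma (c * iota b)).
split; last by rewrite [_ *: _]/(_ * _) addrC subrK.
apply/(IHi _ (ltnW iltn)).
rewrite (@chain_predP i _ (a - subst0 i a) t tT).
  rewrite [subst0 i (_ - _)]rmorphB /= subst0_comp maxnn subrr eqxx//.
rewrite bE !rmorphB !rmorphM /= !sigmaK parE pi_rho -ra mulrBr.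
by congr (_ - _); rewrite -[in RHS](mul1r (iota b)) -tc; ring.
Qed.

Theorem weak_gl_dim_regular : weak_gl_dim R = n%:Z%:E.
Proof.
apply: weak_gl_dim_eq => [M|].
  pose base : {rmorphism {mpoly k[0]} -> S} := comp_mpoly [tuple].
  apply: (@has_flat_resolution_upper k n R A T iota pi e (sigma \o (iota \o
    base)) param).
  - exact: origin_units1.
  - exact: origin_unitsM.
  - exact: iota_inj.
  - by move=> r; apply: fracE.
  - by move=> t /denV[a ta]; exists (sigma a); rewrite sigmaK.
  - exact: pi_null.
  - by move=> c; rewrite /= sigmaK comp_mpolyC.
  - by move=> i; rewrite paramE pi_rho.
  - exact: regular_e.
  - by move=> N; apply: equational_regular => p a; apply: mpoly0_regular.
exists (koszul_quot e param n R^o) => m.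
apply: (has_flat_resolution_lower eE) => [i r iltn|].
  rewrite !koszul_subE ?(ltnW iltn)//.
  rewrite [_ *: r]/(_ * _) prime_idealrM => /orP[|//].
  rewrite (paramE (Ordinal iltn)) chain_pred_rho subst0X /= ltnn.
  by rewrite -msize_poly_eq0 msizeX.
by rewrite koszul_subE// idealr1.
Qed.

End RegularSystem.

(** * The ring T(A) *)

Lemma row_sum_linear (R : comNzRingType) (M : lmodType R) n
    (g : {linear 'rV[R]_n -> M}) u :
  g u = \sum_j u 0 j *: g (delta_mx 0 j).
Proof.
by rewrite {1}[u]row_sum_delta linear_sum; apply: eq_bigr => j _;
  apply: linearZ.
Qed.

(** * Finitely generated ideals of von Neumann regular rings *)

Section VonNeumannRegular.
Variable R : comNzRingType.
Hypothesis vnr : von_neumann_regular R.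

Lemma von_neumann_regular_fin p (a : 'I_p -> R) :
  exists u : 'I_p -> R, forall j, (\sum_i u i * a i) * a j = a j.
Proof.
elim: p a => [|p IHp] a; first by exists (fun=> 0) => -[].
have [u uE] := IHp (a \o lift ord0); set eps := \sum_i _ in uE.
have [x xE] := vnr (a ord0 * (1 - eps)).
(* With w = a_0 (1 - eps) and w = w x w, the new sum is 1 - (1 - eps)(1 - w x). The factor 1 - eps
   kills the later a_j, and (1 - eps)(1 - w x) a_0 = w - w x w = 0. *)
exists (fun i => if unlift ord0 i is Some j then u j else (1 - eps) ^+ 2 * x)
  => j.
rewrite big_ord_recl unlift_none.
under eq_bigr => i _ do rewrite liftK.
rewrite -/eps mulrDl; have [i ->|->] := unliftP ord0 j.
  rewrite [eps * _](uE i) (_ : _ * a (lift ord0 i) =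
    (1 - eps) * x * a ord0 * (a (lift ord0 i) - eps * a (lift ord0 i)));
      last by ring.
  by rewrite [eps * _](uE i) subrr mulr0 add0r.
rewrite (_ : _ * a ord0 = a ord0 * (1 - eps) * x * (a ord0 * (1 - eps)));
  last by ring.
by rewrite -xE; ring.
Qed.

(** I is generated by an idempotent eps, so R -> R -> I given by 1 - eps and eps is a
    presentation. *)
Lemma von_neumann_regular_coherent : coherent R.
Proof.
move=> I _ [n [g gE]]; pose a j : R := g (delta_mx 0 j).
have [u uE] := von_neumann_regular_fin a; set eps := \sum_i _ in uE.
have eps_idem : eps * eps = eps.
  transitivity (\sum_i eps * (u i * a i)); first by rewrite -mulr_sumr.
  by apply: eq_bigr => i _; rewrite mulrCA uE.
have h_linear : linear (fun v : 'rV[R]_1 => (1 - eps) *: v).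
  by move=> c v w; rewrite scalerDr !scalerA mulrC.
pose h : {linear 'rV[R]_1 -> 'rV[R]_1} := HB.pack (fun v : 'rV[R]_1 => (1 -
  eps) *: v)
  (GRing.isLinear.Build _ _ _ _ _ h_linear).
have g_linear : linear (fun v : 'rV[R]_1 => eps * v 0 0 : R^o).
  by move=> c v w; rewrite !mxE mulrDr mulrCA.
pose g' : {linear 'rV[R]_1 -> R^o} := HB.pack (fun v : 'rV[R]_1 => eps * v 0 0
  : R^o)
  (GRing.isLinear.Build _ _ _ _ _ g_linear).
exists 1%N, 1%N, h, g'; split=> [x|v].
  split=> [/gE[v <-]|[v <-]].
    exists (const_mx (g v)); rewrite /= mxE row_sum_linear mulr_sumr.
    by apply: eq_bigr => j _; rewrite [_ *: _]/(_ * _) mulrCA uE.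
  apply/gE; exists (v 0 0 *: \sum_j u j *: delta_mx 0 j).
  rewrite linearZ linear_sum /= [LHS]mulrC; congr (_ * _).
  by apply: eq_bigr => j _; rewrite linearZ.
split=> [/= v0|[w <-]]; last first.
  by rewrite /= mxE mulrA mulrBr mulr1 eps_idem subrr mul0r.
exists v; apply/rowP => i; rewrite ord1 /= mxE mulrBl mul1r.
by rewrite [X in _ - X]v0 subr0.
Qed.

End VonNeumannRegular.

Section TRingFacts.
Variable A : localRingType.
Local Notation K := (residue_field A).
Local Notation R := (tring A).
Local Notation m := (@max_ideal A).

Lemma residue_eq0 (a : A) : residue a = 0 <-> a \in m.
Proof.
rewrite -[in X in _ <-> X](subr0 a) Quotient.idealrBE.
have -> : (0 : K) = residue (0 : A) by rewrite /residue rmorph0.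
by split=> [/eqP|/eqP].
Qed.

Lemma residue_surj (x : K) : exists a, residue a = x.
Proof. by exists (repr x); apply: reprK. Qed.

Lemma residueV (x : K) : x != 0 -> exists y, x * y = 1.
Proof.
have [a <-] := residue_surj x => /eqP/residue_eq0 aM.
have [mid mmax] := @max_ideal_maximal A; have [m0 m1 mD] := mid.
pose J : {pred A} := fun x => `[< exists b c, c \in m /\ x = a * b + c >].
have aJ : a \in J by apply/asboolP; exists 1, 0; rewrite mulr1 addr0.
have mJ : {subset m <= J}.
  by move=> c cM; apply/asboolP; exists 0, c; rewrite mulr0 add0r.
have [/asboolP[b [c [cM /esym abc]]]|J1] := boolP (1 \in J).
  exists (residue b); rewrite -residueM.
  have -> : (1 : K) = residue (1 : A) by rewrite /residue rmorph1.
  rewrite -abc; apply/eqP; rewrite -Quotient.idealrBE.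
  by rewrite opprD addrA subrr add0r rpredN.
case: aM; rewrite -(mmax J) //.
split=> //; first exact: mJ.
move=> r y z /asboolP[b [c [cM ->]]] /asboolP[b' [c' [cM' ->]]]; apply/asboolP.
exists (r * b + b'), (r * c + c'); split; first exact: mD.
by ring.
Qed.

Lemma residue_field_domain (x y : K) : x * y = 0 -> x != 0 -> y = 0.
Proof.
move=> xy /residueV[z xz]; rewrite -[y]mul1r -xz mulrAC xy mul0r //.
Qed.

Definition tring_base (r : R) : A := (tring_val r).1.
Definition tring_coord i (r : R) : K := (tring_val r).2 i.

Fact tring_base_zmod_morphism : zmod_morphism tring_base. Proof. by []. Qed.
Fact tring_base_monoid_morphism : monoid_morphism tring_base. Proof. by []. Qed.
HB.instance Definition _ := GRing.isZmodMorphism.Build R A tring_base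
  tring_base_zmod_morphism.
HB.instance Definition _ := GRing.isMonoidMorphism.Build R A tring_base
  tring_base_monoid_morphism.

Fact tring_coord_zmod_morphism i : zmod_morphism (tring_coord i). Proof. by [].
  Qed.
Fact tring_coord_monoid_morphism i : monoid_morphism (tring_coord i). Proof. by
  []. Qed.
HB.instance Definition _ i := GRing.isZmodMorphism.Build R K (tring_coord i)
  (tring_coord_zmod_morphism i).
HB.instance Definition _ i := GRing.isMonoidMorphism.Build R K (tring_coord i)
  (tring_coord_monoid_morphism i).

Lemma tring_eq (r s : R) : tring_base r = tring_base s ->
  (forall i, tring_coord i r = tring_coord i s) -> r = s.
Proof.
move=> rs1 rs2; apply: val_inj; rewrite [LHS]surjective_pairing.
rewrite [RHS]surjective_pairing; congr pair; first exact: rs1.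
by apply/funext.
Qed.

Lemma finite_nat_bound (X : set nat) :
  finite_set X <-> exists N, forall i, X i -> (i < N)%N.
Proof.
split=> [/finite_seqP[s ->]|[N XN]].
  exists (\max_(i <- s) i).+1 => i /= si; rewrite ltnS.
  exact: (@leq_bigmax_seq _ s xpredT id i).
exact: sub_finite_set XN (finite_II N).
Qed.

Lemma tring_tail (r : R) :
  exists N, forall i, (N <= i)%N -> tring_coord i r = residue (tring_base r).
Proof.
have /asboolP/finite_nat_bound[N rN] := tring_valP r; exists N => i Ni.
by apply: contrapT => /rN; rewrite ltnNge Ni.
Qed.

Lemma tring_mk (a : A) (c : nat -> K) :
  (exists N, forall i, (N <= i)%N -> c i = residue a) ->
  exists r : R, tring_base r = a /\ forall i, tring_coord i r = c i.
Proof.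
move=> [N cN]; have rP : (a, c) \in @tring_pred A.
  apply/asboolP/finite_nat_bound; exists N => i /= ca.
  by rewrite ltnNge; apply/negP => /cN.
by exists (TRing rP).
Qed.

Fact tring_diag_proof a : (a, fun=> residue a) \in @tring_pred A.
Proof. by apply/asboolP/finite_nat_bound; exists 0%N. Qed.
Definition tring_diag a : R := TRing (tring_diag_proof a).

Fact tring_diag_zmod_morphism : zmod_morphism tring_diag.
Proof. by move=> a b; apply: tring_eq => // i; apply: residueB. Qed.
Fact tring_diag_monoid_morphism : monoid_morphism tring_diag.
Proof.
split=> [|a b]; apply: tring_eq => // i; last exact: residueM.
by rewrite /tring_diag /tring_coord /= /residue rmorph1.
Qed.
HB.instance Definition _ := GRing.isZmodMorphism.Build A R tring_diag
  tring_diag_zmod_morphism.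
HB.instance Definition _ := GRing.isMonoidMorphism.Build A R tring_diag
  tring_diag_monoid_morphism.

Lemma tring_diagK : cancel tring_diag tring_base. Proof. by []. Qed.

Fact tring_idem_proof N :
  (0, fun i => if (i < N)%N then 1 else 0) \in @tring_pred A.
Proof.
apply/asboolP/finite_nat_bound; exists N => i /=.
by case: ltnP => // _; rewrite /residue rmorph0.
Qed.
Definition tring_idem N : R := TRing (tring_idem_proof N).

Lemma tring_idem_coord N i : tring_coord i (tring_idem N) = if (i < N)%N then 1
  else 0.
Proof. by []. Qed.

Lemma tring_idemM N N' : (N <= N')%N -> tring_idem N' * tring_idem N =
  tring_idem N.
Proof.
move=> NN'; apply: tring_eq => [|i]; rewrite rmorphM ?mulr0//=
  !tring_idem_coord.
by case: (ltnP i N) => iN; rewrite ?mulr0// (leq_trans iN NN') mulr1.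
Qed.

Lemma tring_null r : tring_base r = 0 -> null tring_idem r.
Proof.
move=> r0; have [N rN] := tring_tail r; exists N => j Nj.
apply: tring_eq => [|i]; rewrite rmorphM; first by rewrite /= r0 mulr0.
rewrite /= tring_idem_coord; case: ltnP => ij; rewrite ?mul1r// mul0r rN.
  by rewrite r0 /residue rmorph0.
exact: leq_trans Nj ij.
Qed.

(** The value 0 at 0 matters: it makes x [residue_inv x] x = x hold for all x, as von Neumann
    regularity requires. *)
Definition residue_inv (x : K) : K :=
  if pselect (x != 0) is left x0 then sval (cid (residueV x0)) else 0.

Lemma residue_invP (x : K) : x != 0 -> x * residue_inv x = 1.
Proof. by move=> x0; rewrite /residue_inv; case: pselect => // y;
  case: cid. Qed.

Lemma residue_inv0 : residue_inv 0 = 0.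
Proof.
by rewrite /residue_inv; case: pselect => // x0; case: (negP x0); apply: eqxx.
Qed.

(** At each coordinate below N one nonzero r_i is selected and inverted, so the sum of the u_i r_i
    is the indicator of the coordinates where some r_i is nonzero. *)
Lemma tring_regular N p (r : 'I_p -> R) : exists u : 'I_p -> R,
  forall j, (\sum_i u i * r i) * (r j * tring_idem N) = r j * tring_idem N.
Proof.
pose c i q : K := if [pick l | tring_coord q (r l) != 0] == Some i then
  residue_inv (tring_coord q (r i)) else 0.
have cP i : exists u : R, tring_base u = 0 /\
    forall q, tring_coord q u = if (q < N)%N then c i q else 0.
  by apply: tring_mk; exists N => q; rewrite leqNgt => /negPf ->;
    rewrite /residue rmorph0.
have [u uE] := choice cP; exists u => j; apply: tring_eq => [|q].
  by rewrite !rmorphM /= !mulr0.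
rewrite !rmorphM /= tring_idem_coord; case: ltnP => qN; last by rewrite !mulr0.
rewrite !mulr1 rmorph_sum /=.
have -> : \sum_i tring_coord q (u i * r i) = \sum_i c i q * tring_coord q (r i).
  by apply: eq_bigr => i _; rewrite rmorphM /= (uE i).2 qN.
rewrite /c; case: pickP => [i ri|r0]; last first.
  by have /negPn/eqP -> := negbT (r0 j); rewrite mulr0.
rewrite (bigD1 i)//= eqxx big1 ?addr0 => [|l li]; last first.
  by rewrite (inj_eq Some_inj) eq_sym (negPf li) mul0r.
by rewrite [residue_inv _ * _]mulrC residue_invP// mul1r.
Qed.

(** This prevents the kernel of R -> A from being finitely generated: a coordinate N where all
    generators vanish is 1 in [tring_idem N.+1]. Both negative results rest on it. *)
Lemma tring_ker_bound p (y : 'I_p -> R) : (forall j, tring_base (y j) = 0) ->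
  exists N, forall j, tring_coord N (y j) = 0.
Proof.
move=> y0; have /eventually_fin[N yN] : forall j, exists N, forall i, (N <=
  i)%N ->
    tring_coord i (y j) = 0.
  move=> j; have [N yN] := tring_tail (y j); exists N => i /yN ->.
  by rewrite y0 /residue rmorph0.
by exists N => j; apply: yN.
Qed.

Hypothesis A_unit : forall a, a \notin m -> exists b, a * b = 1.

(** A vanishing coordinate would give an annihilating idempotent supported there. So all coordinates
    are nonzero, and since the tail repeats the residue of the base, the base is a unit; the
    inverses fit together into an element of R. *)
Lemma tring_total_quotient : total_quotient_ring_trivial R.
Proof.
move=> x xreg.
have regE y : x * y = 0 -> y = 0 by move=> xy; apply: xreg; rewrite mulr0.
have c0 i : tring_coord i x != 0.
  apply/negP => /eqP xi; pose d := tring_idem i.+1 - tring_idem i.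
  have dE j : tring_coord j d = if j == i then 1 else 0.
    rewrite rmorphB /= !tring_idem_coord ltnS.
    by case: ltngtP => _; rewrite ?subrr ?subr0.
  have /regE/(congr1 (tring_coord i)) : x * d = 0.
    apply: tring_eq => [|j].
      have d0 : tring_base d = 0 by rewrite [LHS]rmorphB /= subrr.
      by rewrite rmorphM /= d0 mulr0.
    by rewrite rmorphM /= dE rmorph0; case: eqP => [->|_];
      rewrite ?xi ?mul0r ?mulr0.
  by rewrite dE eqxx rmorph0 => /eqP; rewrite oner_eq0.
have [N xN] := tring_tail x.
have /A_unit[b xb] : tring_base x \notin m.
  by apply/negP => /residue_eq0 x0; have := c0 N; rewrite xN// x0 eqxx.
have [|y [yb yc]] := @tring_mk b (fun i => residue_inv (tring_coord i x)).
  exists N => i Ni; have := residue_invP (c0 i); rewrite xN// => xv.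
  have xb1 : residue (tring_base x) * residue b = 1.
    by rewrite -residueM xb /residue rmorph1.
  by rewrite -[LHS]mulr1 -xb1 mulrA [_ * residue (tring_base x)]mulrC xv mul1r.
exists y; apply: tring_eq => [|i]; rewrite rmorphM rmorph1 /=.
  by rewrite yb xb.
by rewrite yc residue_invP.
Qed.

Lemma tring_reduced : (forall (a : A) l, a ^+ l = 0 -> a = 0) -> reduced R.
Proof.
move=> A_red x l xl; apply: tring_eq => [|i]; rewrite rmorph0.
  by apply: (A_red _ l); rewrite -rmorphXn xl rmorph0.
have : tring_coord i x ^+ l = 0 by rewrite -rmorphXn xl rmorph0.
elim: l {xl} => [/eqP|l IHl]; first by rewrite expr0 oner_eq0.
rewrite exprS; have [//|x0] := eqVneq (tring_coord i x) 0.
by move=> /residue_field_domain/(_ x0)/IHl.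
Qed.

Lemma tring_not_noetherian : ~ noetherian R.
Proof.
pose I : {pred R} := fun r => tring_base r == 0.
have Iideal : ideal I.
  split=> [|a x y /eqP x0 /eqP y0]; apply/eqP; first exact: rmorph0.
  by rewrite -[LHS]/(tring_base (a * x + y)) rmorphD rmorphM /= x0 y0 mulr0
    addr0.
move=> /(_ I Iideal)[p [g gE]].
have [|N gN] := @tring_ker_bound p (fun j => g (delta_mx 0 j)).
  by move=> j; apply/eqP/gE; exists (delta_mx 0 j).
have /gE[u ue] : tring_idem N.+1 \in I by apply/eqP.
have := tring_idem_coord N.+1 N; rewrite ltnSn -ue row_sum_linear rmorph_sum /=.
rewrite big1 => [/eqP|j _]; first by rewrite eq_sym oner_eq0.
by rewrite [LHS]rmorphM /= gN mulr0.
Qed.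

(** The principal ideal generated by the diagonal image [xi] of x is not finitely presented: its
    annihilator is the kernel of R -> A, since x is regular in A and zero in every coordinate. *)
Lemma tring_not_coherent (x : A) :
  x \in m -> (forall a, x * a = 0 -> a = 0) -> ~ coherent R.
Proof.
move=> /residue_eq0 xM xreg; pose xi := tring_diag x.
have xi_null r : r * xi = 0 <-> tring_base r = 0.
  split=> [rx|r0].
    by apply: xreg; rewrite mulrC -[x]/(tring_base xi) -rmorphM rx rmorph0.
  apply: tring_eq => [|i]; rewrite rmorphM rmorph0 /=.
    by rewrite r0 mul0r.
  by rewrite [X in _ * X]xM mulr0.
pose I : {pred R} := fun r => `[< exists a, r = a * xi >].
have Iideal : ideal I.
  split=> [|a r s /asboolP[b ->] /asboolP[c ->]]; apply/asboolP.
    by exists 0; rewrite mul0r.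
  by exists (a * b + c); rewrite mulrDl -mulrA.
have g_linear : linear (fun v : 'rV[R]_1 => v 0 0 * xi : R^o).
  by move=> c v w; rewrite !mxE mulrDl -mulrA.
pose g0 : {linear 'rV[R]_1 -> R^o} := HB.pack (fun v : 'rV[R]_1 => v 0 0 * xi :
  R^o)
  (GRing.isLinear.Build _ _ _ _ _ g_linear).
move=> /(_ I Iideal)[|p [q [h [g [gE gex]]]]].
  exists 1%N, g0 => r; split=> [/asboolP[a ->]|[v <-]].
    by exists (const_mx a); rewrite /= mxE.
  by apply/asboolP; exists (v 0 0).
have /choice[s sE] j : exists s, g (delta_mx 0 j) = s * xi.
  by apply/asboolP/gE; exists (delta_mx 0 j).
pose phi (v : 'rV[R]_q) := \sum_j v 0 j * s j.
have gphi v : g v = phi v * xi.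
  rewrite row_sum_linear mulr_suml; apply: eq_bigr => j _.
  by rewrite sE [_ *: _]mulrA.
have /gE[u0 u0E] : xi \in I by apply/asboolP; exists 1; rewrite mul1r.
(* A presentation may use other generators than [xi]. As in Schanuel's lemma, the annihilator of
   [xi] is generated by the images of the relations under [phi] together with the defect 1 -
   [phi u0]. *)
pose y (j : 'I_p.+1) := if unlift ord0 j is Some l then phi (h (delta_mx 0 l))
  else 1 - phi u0.
have [|N yN] := @tring_ker_bound _ y.
  move=> j; apply/xi_null; rewrite /y; case: unliftP => [l _|_].
    by rewrite -gphi; apply/gex; exists (delta_mx 0 l).
  by rewrite mulrBl mul1r -gphi u0E subrr.
pose e := tring_idem N.+1.
(* e annihilates [xi], so e u0 comes from R^p and e is a combination of the y_j. These vanish at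
   coordinate N, where e is 1. *)
have /gex[w wE] : g (e *: u0) = 0.
  by rewrite linearZ /= u0E; apply/xi_null.
have phiZ : phi (e *: u0) = e * phi u0.
  by rewrite /phi mulr_sumr; apply: eq_bigr => j _; rewrite mxE mulrA.
have phih : phi (h w) = \sum_l w 0 l * phi (h (delta_mx 0 l)).
  rewrite row_sum_linear /phi; under eq_bigr => j _ do rewrite summxE mulr_suml.
  rewrite exchange_big /=; apply: eq_bigr => l _; rewrite mulr_sumr.
  by apply: eq_bigr => j _; rewrite mxE mulrA.
have eE : e = \sum_l w 0 l * phi (h (delta_mx 0 l)) + e * (1 - phi u0).
  by rewrite -phih wE phiZ mulrBr mulr1 addrC subrK.
have := tring_idem_coord N.+1 N; rewrite ltnSn -/e eE rmorphD rmorph_sum /=.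
rewrite big1 => [|l _]; last first.
  by rewrite rmorphM /=; have := yN (lift ord0 l); rewrite /y liftK => ->;
    rewrite mulr0.
rewrite add0r rmorphM /=; have := yN ord0; rewrite /y unlift_none => ->.
by rewrite mulr0 => /eqP; rewrite eq_sym oner_eq0.
Qed.

Lemma tring_von_neumann_regular : (forall a, a \in m -> a = 0) ->
  von_neumann_regular R.
Proof.
move=> m0 r; have invE (x : K) : x * residue_inv x * x = x.
  have [->|x0] := eqVneq x 0; first by rewrite mulr0.
  by rewrite residue_invP// mul1r.
have [N rN] := tring_tail r.
(* The quasi-inverse of the base must reduce to the one used on the tail coordinates, including when
   the base is zero. *)
have [b [rb bE]] : exists b, tring_base r = tring_base r * b * tring_base r /\
    residue b = residue_inv (residue (tring_base r)).
  have [aM|/[dup] aM /A_unit[b ab]] := boolP (tring_base r \in m).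
    exists 0; rewrite (m0 _ aM) !mulr0 /residue rmorph0.
    by rewrite -/(residue _) residue_inv0.
  exists b; rewrite ab mul1r; split=> //.
  have r0 : residue (tring_base r) != 0.
    by apply: contra aM => /eqP/residue_eq0.
  rewrite -[LHS]mulr1 -(residue_invP r0) mulrA -residueM [b * _]mulrC ab.
  by rewrite [X in X * _](_ : _ = 1) ?mul1r// /residue rmorph1.
have [|y [yb yc]] := @tring_mk b (fun i => residue_inv (tring_coord i r)).
  by exists N => i Ni; rewrite rN// bE.
exists y; apply: tring_eq => [|i]; rewrite !rmorphM /=.
  by rewrite yb.
by rewrite yc invE.
Qed.

End TRingFacts.

(** * Localizations *)

Section LocalizationFacts.
Variables (D : idomainType) (P : prime_idealr D).
Local Notation A := (localization P).
Local Notation "x %:F" := (FracField.tofrac x).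

Fact loc_frac_proof a : a%:F \in loc_pred P.
Proof. by apply/asboolP; exists a, 1; rewrite idealr1 rmorph1 divr1. Qed.
Definition loc_frac a : A := Localization (loc_frac_proof a).

Fact loc_frac_zmod_morphism : zmod_morphism loc_frac.
Proof. by move=> a b; apply: val_inj; apply: rmorphB. Qed.
Fact loc_frac_monoid_morphism : monoid_morphism loc_frac.
Proof. by split=> [|a b]; apply: val_inj; [apply: rmorph1|apply: rmorphM]. Qed.
HB.instance Definition _ := GRing.isZmodMorphism.Build D A loc_frac
  loc_frac_zmod_morphism.
HB.instance Definition _ := GRing.isMonoidMorphism.Build D A loc_frac
  loc_frac_monoid_morphism.

Lemma loc_frac_inj : injective loc_frac.
Proof.
move=> a b /(congr1 val) /= /eqP; rewrite tofrac_eq => /eqP //.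
Qed.

Lemma loc_fracE (x : A) : exists a s, s \notin P /\ loc_frac s * x = loc_frac a.
Proof.
have /asboolP[a [s [sP xE]]] := loc_valP x; exists a, s; split=> //.
by apply: val_inj; rewrite /= xE mulrCA divff ?mulr1// (notin_prime_neq0 sP).
Qed.

Lemma loc_fracV s : s \notin P -> exists x, loc_frac s * x = 1.
Proof.
move=> sP; have xP : 1%:F / s%:F \in loc_pred P by apply/asboolP; exists 1, s.
exists (Localization xP); apply: val_inj; rewrite /= rmorph1 mul1r divff//.
exact: (notin_prime_neq0 sP).
Qed.

Lemma loc_unit (x : A) : x \notin @max_ideal A -> exists y, x * y = 1.
Proof.
move=> xM; have [a [s [sP xE]]] := loc_fracE x.
have aP : a \notin P.
  apply: contra xM => aP; apply/asboolP; exists a, s; split=> //.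
  have /(congr1 val) /= <- := xE.
  by rewrite mulrAC divff ?mul1r// (notin_prime_neq0 sP).
have [y ya] := loc_fracV aP; exists (loc_frac s * y).
by rewrite mulrCA mulrA xE.
Qed.

Lemma loc_max_idealP (x : A) : x \in @max_ideal A ->
  exists a s, [/\ a \in P, s \notin P & loc_frac s * x = loc_frac a].
Proof.
move=> /asboolP[a [s [aP sP xE]]]; exists a, s; split=> //.
by apply: val_inj; rewrite /= xE mulrCA divff ?mulr1// (notin_prime_neq0 sP).
Qed.

Lemma loc_frac_max a : a \in P -> loc_frac a \in @max_ideal A.
Proof.
by move=> aP; apply/asboolP; exists a, 1; rewrite idealr1 rmorph1 divr1.
Qed.

Lemma loc_mulf_eq0 (x y : A) : x * y = 0 -> x = 0 \/ y = 0.
Proof.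
move=> /(congr1 val) /= /eqP; rewrite mulf_eq0 => /orP[] /eqP xy0; [left|right];
  exact: val_inj.
Qed.

End LocalizationFacts.

Theorem corollary1p2 (k : fieldType) :
  (forall n : nat,
     [/\ total_quotient_ring_trivial (Rring k n),
         weak_gl_dim (Rring k n) = n%:Z%:E
       & krull_dim (Rring k n) = n%:Z%:E]) /\
  (forall n : nat, reduced (Rring k n) /\ ~ noetherian (Rring k n)) /\
  (forall n : nat, (1 <= n)%N -> ~ coherent (Rring k n)) /\
  (coherent (Rring k 0) /\ von_neumann_regular (Rring k 0)).
Proof.
have unitA n (a : poly_local k n) : a \notin @max_ideal (poly_local k n) ->
    exists b, a * b = 1 by apply: loc_unit.
have TE n (s : {mpoly k[n]}) : (s \in @origin_units k n) = (s \notin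
  @vars_ideal k n).
  by rewrite vars_idealP.
pose iota n : {rmorphism {mpoly k[n]} -> poly_local k n} := @loc_frac _
  (@vars_ideal k n).
have fracE n (a : poly_local k n) :
    exists p t, t \in @origin_units k n /\ iota n t * a = iota n p.
  by have [p [t [tT E]]] := loc_fracE a; exists p, t; rewrite TE.
have denV n t : t \in @origin_units k n -> exists a, iota n t * a = 1.
  by rewrite TE; apply: loc_fracV.
have vnr0 : von_neumann_regular (Rring k 0).
  apply: tring_von_neumann_regular; first exact: unitA.
  move=> a /loc_max_idealP[p [t [/asboolP[c ->] tP]]].
  (* With no variables the ideal at the origin is zero, so A_0 is a field. *)
  rewrite big_ord0 rmorph0 => /loc_mulf_eq0[/(congr1 val)/eqP|//].
  by rewrite /= (negPf (notin_prime_neq0 tP)).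
split; [move=> n; split|split; [move=> n; split|split; [|split]]].
- exact/tring_total_quotient/unitA.
- apply: (@weak_gl_dim_regular k n _ _ (iota n) (@tring_base _) (@tring_diag _)
  (@tring_idem _)).
  + exact: loc_frac_inj.
  + exact: fracE.
  + exact: denV.
  + exact: tring_diagK.
  + exact: tring_null.
  + by [].
  + exact: tring_idemM.
  + exact: tring_regular.
- apply: (@krull_dim_regular k n _ _ (iota n) (@tring_base _) (@tring_diag _)
  (@tring_idem _)).
  + exact: loc_frac_inj.
  + exact: fracE.
  + exact: denV.
  + exact: tring_diagK.
  + exact: tring_null.
  + exact: tring_regular.
- apply: tring_reduced => a l; elim: l => [|l IHl].
    by rewrite expr0 => /eqP; rewrite oner_eq0.
  by rewrite exprS => /loc_mulf_eq0[|/IHl].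
- exact: tring_not_noetherian.
- case=> // n _; apply: (@tring_not_coherent _ (iota n.+1 'X_ord0)).
    apply: loc_frac_max; rewrite vars_idealP mevalXU eqxx //.
  move=> a /loc_mulf_eq0[|//]; rewrite -[0](rmorph0 (iota n.+1)).
  move=> /loc_frac_inj/eqP; rewrite -msize_poly_eq0 msizeX //.
- exact: von_neumann_regular_coherent.
- exact: vnr0.
Qed.
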